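(* Let $n\ge 2$ and let $\Omega\subset\mathbb{R}^n$ be a domain. Suppose $u$ is a real-analytic function in $\Omega$ and $v$ is a harmonic function in $\Omega$. If $Z(v)\subset Z(u)$, then there exists a real-analytic function $f$ in $\Omega$ such that $u=vf$.
   Context: All functions are real-valued, and $Z(g)=\{x\in\Omega: g(x)=0\}$ denotes the zero set of a function $g$ on $\Omega$. *)

(* Defs.v *)
From HB Require Import structures.
From mathcomp Require Import all_boot all_order all_algebra.
From mathcomp Require Import finmap.
From mathcomp Require Import all_classical all_reals all_analysis.
From mathcomp.analysis.showcase Require summability.

Set Implicit Arguments.
Unset Strict Implicit.
Unset Printing Implicit Defensive.

Import Order.TTheory GRing.Theory Num.Theory.
Import numFieldNormedType.Exports.

Local Open Scope classical_set_scope.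
Local Open Scope ring_scope.

(* R^n is 'rV[R]_n; its norm is the sup norm, which induces the usual topology.
   A function on an open set Omega is represented by a total function on R^n;
   none of the predicates below depends on its values outside Omega. *)

Section Euclidean.
Context {R : realType} {n : nat}.
Implicit Types (Omega : set 'rV[R]_n) (f g : 'rV[R]_n -> R).

Definition domain Omega : Prop :=
  [/\ Omega !=set0, open Omega & connected Omega].

Definition zero_set Omega g : set 'rV[R]_n := [set x | Omega x /\ g x = 0].

Definition multi_index : choiceType := {ffun 'I_n -> nat}.

Definition monomial (alpha : multi_index) (x : 'rV[R]_n) : R :=
  \prod_(i < n) x 0 i ^+ alpha i.

(* The multiple series converges to s along the directed set of finite sets of
   multi-indices, i.e. unconditionally; for real terms this is the same as
   absolute convergence. *)
Definition power_series_sum (c : multi_index -> R) (a x : 'rV[R]_n) (s : R)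
    : Prop :=
  summability.partial_sum (fun alpha => c alpha * monomial alpha (x - a))
    @ summability.totally --> s.

Definition real_analytic Omega f : Prop :=
  forall a, Omega a -> exists c : multi_index -> R,
    \forall x \near a, power_series_sum c a x (f x).

Definition basis_vec (i : 'I_n) : 'rV[R]_n := delta_mx 0 i.

Definition partial (i : 'I_n) f : 'rV[R]_n -> R :=
  fun x => 'D_(basis_vec i) (f : _ -> R^o) x.

Fixpoint class_C (k : nat) Omega f : Prop :=
  {within Omega, continuous f} /\
  if k is k'.+1 then
    forall i : 'I_n,
      (forall x, Omega x -> derivable (f : _ -> R^o) x (basis_vec i)) /\
      class_C k' Omega (partial i f)
  else True.

Definition laplacian f : 'rV[R]_n -> R :=
  fun x => \sum_(i < n) partial i (partial i f) x.

Definition harmonic_in Omega f : Prop :=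
  class_C 2 Omega f /\ forall x, Omega x -> laplacian f x = 0.

End Euclidean.

(* Main.v *)
(* Near a point, v is the sum of its homogeneous Taylor polynomials v_k (a harmonic
   function is analytic, by interior gradient estimates), u is a sum of homogeneous
   u_k, and the lowest part P = v_N is a harmonic polynomial.  A quotient u / v has
   homogeneous parts F_k with P F_k = u_(N+k) - (sum of v_(N+k-i) F_i over i < k), so
   one must see that P divides the right-hand side Q.  Rescaling the zeros of v on
   small segments shows that P and Q have a common zero on every segment from
   {P < 0} to {P > 0}, and this implies that P divides Q: for the Gaussian mean P is
   orthogonal to all polynomials of smaller degree.  If p is a prime factor of P and
   P = p s, then P s = p s^2 has mean zero, so that p changes sign; and p does not
   divide s = p s', for otherwise P s' = (p s')^2 would have mean zero.  Elimination
   between p and Q s along segments crossing {p = 0} then shows that p divides Q.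
   The formal quotient converges in a weighted l^1 norm for which a single monomial
   of P dominates both the rest of P and the tail of v.  The local quotients match
   because, by unique continuation, v vanishes on no open set unless v = 0. *)
Require Import Defs.
From HB Require Import structures.
From mathcomp Require Import all_boot all_order all_algebra.
From mathcomp Require Import finmap.
From mathcomp Require Import all_classical all_reals all_analysis.
From mathcomp.analysis.showcase Require summability.
From mathcomp Require Import ring lra.
From mathcomp.real_closed Require polyrcf.
From mathcomp Require Import -(notations) ssrcomplements mpoly.

Set Implicit Arguments.
Unset Strict Implicit.
Unset Printing Implicit Defensive.

Import Order.TTheory GRing.Theory Num.Theory.
Import numFieldNormedType.Exports.

Local Open Scope ring_scope.
Local Open Scope classical_set_scope.

(** * Unique factorization *)

(** For a general polynomial P, vanishing on its real zeros says little: x^2 + y^2 vanishes only at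
    the origin, and x vanishes on the zeros of x^2 without being divisible by it. Harmonicity
    excludes both defects, since no prime factor of P can be of constant sign or repeated. The
    division step is iterated by applying it not to u but to u - v g, where g is the sum of the
    quotient parts found so far: this function still vanishes on Z(v), and its lowest part is the
    next right-hand side. Gaussian means are given by their moments, so orthogonality is an
    algebraic identity and only positivity uses analysis. Interior estimates come from the maximum
    principle on a cube with an explicit barrier, so that no integral or Poisson kernel enters; k
    nested estimates, each over a k-th of the radius, cost a factor k^k, which k! absorbs up to e^k.
    Divisibility at each degree gives no bound on the quotient, which is why its convergence needs a
    separate norm argument. *)

Section Factorial.
Variable D : idomainType.
Implicit Types a b c p q : D.

Definition divides a b := exists c, b = a * c.

Definition prime_elt p :=
  [/\ p != 0, p \isn't a GRing.unit &
      forall a b, divides p (a * b) -> divides p a \/ divides p b].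

(** The factors are prime rather than irreducible, which makes the factorization unique up to units
    without further proof; only existence has to pass to polynomial rings. *)
Definition factorial_ring :=
  forall a, a != 0 -> exists (u : D) (s : seq D),
    [/\ u \is a GRing.unit, a = u * \prod_(p <- s) p &
        forall p, p \in s -> prime_elt p].

Lemma dividesxx a : divides a a.
Proof. by exists 1; rewrite mulr1. Qed.

Lemma divides_mulr a b c : divides a b -> divides a (b * c).
Proof. by move=> [d ->]; exists (d * c); rewrite mulrA. Qed.

Lemma divides_mull a b c : divides a b -> divides a (c * b).
Proof. by rewrite mulrC; exact: divides_mulr. Qed.

Lemma divides_trans b a c : divides a b -> divides b c -> divides a c.
Proof. by move=> [d ->] [e ->]; exists (d * e); rewrite mulrA. Qed.

Lemma dividesD a b c : divides a b -> divides a c -> divides a (b + c).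
Proof. by move=> [d ->] [e ->]; exists (d + e); rewrite mulrDr. Qed.

Lemma dividesB a b c : divides a b -> divides a c -> divides a (b - c).
Proof. by move=> [d ->] [e ->]; exists (d - e); rewrite mulrBr. Qed.

Lemma divides0 a : divides a 0.
Proof. by exists 0; rewrite mulr0. Qed.

Lemma prime_dvd_prod p (s : seq D) : prime_elt p ->
  divides p (\prod_(q <- s) q) -> exists2 q, q \in s & divides p q.
Proof.
move=> [p0 pu pP]; elim: s => [|q s IH].
  rewrite big_nil => -[c]; move/eqP; rewrite eq_sym => /eqP pc.
  by case/negP: pu; apply/unitrPr; exists c.
rewrite big_cons => /pP [pq|/IH[r rs pr]].
  by exists q; rewrite ?mem_head.
by exists r => //; rewrite in_cons rs orbT.
Qed.

Lemma divides_unit a u : u \is a GRing.unit -> divides a u ->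
  a \is a GRing.unit.
Proof. by move=> uu [c uc]; move: uu; rewrite uc unitrM => /andP[]. Qed.

Lemma prime_assoc p q : prime_elt p -> prime_elt q -> divides p q ->
  exists2 w, w \is a GRing.unit & q = p * w.
Proof.
move=> [p0 pu pP] [q0 qu qP] [w qE]; exists w => //.
have /qP[[k pE]|[k wE]] : divides q (p * w) by rewrite -qE; exact: dividesxx.
  have /eqP : p * 1 = p * (w * k) by rewrite mulr1 mulrA -qE.
  by rewrite (inj_eq (mulfI p0)) eq_sym => /eqP wk; apply/unitrPr; exists k.
have w0 : w != 0 by apply: contraNneq q0 => w0; rewrite qE w0 mulr0.
have /eqP : w * 1 = w * (p * k) by rewrite mulr1 {1}wE qE; ring.
rewrite (inj_eq (mulfI w0)) eq_sym => /eqP pk.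
by case/negP: pu; apply/unitrPr; exists k.
Qed.

(* This replaces uniqueness of factorizations: removing a prime divisor
   shortens the list by exactly one. *)
Lemma factor_cancel p b u (s : seq D) : prime_elt p ->
    u \is a GRing.unit -> (forall q, q \in s -> prime_elt q) ->
    p * b = u * \prod_(q <- s) q ->
  exists (u' : D) (s' : seq D), [/\ u' \is a GRing.unit,
    (forall q, q \in s' -> prime_elt q), b = u' * \prod_(q <- s') q &
    size s = (size s').+1].
Proof.
move=> pp uu sP E.
have [p0 pu pP] := pp.
have pd : divides p (u * \prod_(q <- s) q) by exists b; rewrite -E.
have [/(divides_unit uu) pu'|/(prime_dvd_prod pp) [q qs pq]] := pP _ _ pd.
  by rewrite pu' in pu.
have [w wu qE] := prime_assoc pp (sP _ qs) pq.
exists (u * w), (rem q s); split.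
- by rewrite unitrM uu.
- by move=> r /mem_rem; exact: sP.
- apply: (mulfI p0); rewrite E (perm_big _ (perm_to_rem qs)) big_cons /= {1}qE.
  by ring.
- by rewrite size_rem // prednK //; case: (s) qs.
Qed.

End Factorial.

(** * Gauss's lemma and factoriality of polynomial rings *)

Section GaussLemma.
Variable D : idomainType.
Implicit Types (a b c p : D) (f g h : {poly D}).

Lemma divides_polyC_coef p f i : divides p%:P f -> divides p f`_i.
Proof. by move=> [g ->]; rewrite coefCM; exists g`_i. Qed.

(** If [p] divides the product, it divides one of the two leading coefficients; removing that
    leading term preserves the hypothesis and lowers the total size. *)
Lemma prime_polyC p : prime_elt p -> prime_elt p%:P.
Proof.
move=> [p0 pu pP]; split; first by rewrite polyC_eq0.
  by rewrite poly_unitE size_polyC p0 coefC eqxx.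
move=> f g.
have [m] := ubnP (size f + size g).
elim: m f g => // m IH f g; rewrite ltnS => szm dfg.
have [->|f0] := eqVneq f 0; first by left; exact: divides0.
have [->|g0] := eqVneq g 0; first by right; exact: divides0.
have splitlead h : h != 0 ->
    exists2 h', h = h' + (lead_coef h)%:P * 'X^((size h).-1)
              & (size h' < size h)%N.
  move=> h0; exists (h - (lead_coef h)%:P * 'X^((size h).-1)).
    by rewrite subrK.
  have sh : (0 < size h)%N by rewrite size_poly_gt0.
  rewrite -(ltn_predK sh) ltnS; apply/leq_sizeP => j.
  rewrite leq_eqVlt => /orP[/eqP<-|lj].
    by rewrite coefB coefCM coefXn eqxx mulr1 subrr.
  rewrite coefB coefCM coefXn gtn_eqF // mulr0 subr0 nth_default //.
  by rewrite -(ltn_predK sh).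
have leadP h k : divides p (lead_coef h) ->
    divides p%:P ((lead_coef h)%:P * 'X^k).
  by move=> [c ->]; exists (c%:P * 'X^k); rewrite polyCM mulrA.
have /pP : divides p (lead_coef f * lead_coef g).
  by rewrite -lead_coefM; exact: divides_polyC_coef.
case=> lp.
- have [f' fE sf] := splitlead _ f0.
  have [||df'|] := IH f' g; last by right.
  + by apply: leq_trans szm; rewrite ltn_add2r.
  + suff -> : f' * g = f * g - (lead_coef f)%:P * 'X^((size f).-1) * g.
      by apply: dividesB => //; apply: divides_mulr; exact: leadP.
    by rewrite {1}fE; ring.
  + by left; rewrite fE; apply: dividesD => //; exact: leadP.
- have [g' gE sg] := splitlead _ g0.
  have [|||dg'] := IH f g'; [| |by left|].
  + by apply: leq_trans szm; rewrite ltn_add2l.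
  + suff -> : f * g' = f * g - (lead_coef g)%:P * 'X^((size g).-1) * f.
      by apply: dividesB => //; apply: divides_mulr; exact: leadP.
    by rewrite {1}gE; ring.
  + by right; rewrite gE; apply: dividesD => //; exact: leadP.
Qed.

Definition primitive f := forall p, prime_elt p -> ~ divides p%:P f.

Hypothesis fD : factorial_ring D.

(** The primes of [c] are removed one at a time: each stays prime in the polynomial ring and cannot
    divide the primitive [f], hence divides the cofactor. *)
Lemma primitive_cancel f g c : primitive f -> c != 0 ->
  divides f (c%:P * g) -> divides f g.
Proof.
move=> fp c0; have [u [s [uu cE sP]]] := fD c0.
have {c0}: u != 0 by apply: contraNneq c0 => u0; rewrite cE u0 mul0r.
rewrite {}cE polyCM => u0.
elim: s sP => [|p s IH] sP.
  rewrite big_nil mulr1 => -[h E]; exists (u^-1%:P * h).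
  by rewrite mulrCA -E mulrA -polyCM mulVr // mul1r.
move=> [h E]; apply: IH; first by move=> q qs; apply: sP; rewrite in_cons qs orbT.
have pp : prime_elt p by apply: sP; rewrite mem_head.
have [p0 _ pP] := prime_polyC pp.
have [|/fp//|[h' hE]] := pP f h.
  rewrite -E big_cons polyCM; exists (u%:P * (\prod_(q <- s) q)%:P * g); ring.
exists h'; apply: (mulfI p0); rewrite [RHS]mulrCA -hE -E big_cons polyCM; ring.
Qed.

(** Each prime constant split off uses up exactly one prime of the leading coefficient, so the
    process stops. *)
Lemma content_primitive f : f != 0 -> exists (s : seq D) g,
  [/\ f = (\prod_(p <- s) p)%:P * g, (forall p, p \in s -> prime_elt p)
    & primitive g].
Proof.
move=> f0; have : lead_coef f != 0 by rewrite lead_coef_eq0.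
move=> /fD[u [s [uu + sP]]].
have [m] := ubnP (size s).
elim: m u s f f0 uu sP => // m IH u s f f0 uu sP; rewrite ltnS => szm fE.
have [fp|] := pselect (primitive f).
  by exists [::], f; split=> //; rewrite big_nil mul1r.
move=> /existsNP[p] /not_implyP[pp] /contrapT[g gE].
have g0 : g != 0 by apply: contraNneq f0 => g0; rewrite gE g0 mulr0.
have lE : p * lead_coef g = u * \prod_(q <- s) q.
  by rewrite -fE gE lead_coefM lead_coefC.
have [u' [s' [uu' s'P lgE sz]]] := factor_cancel pp uu sP lE.
have [||t [h [hE tP hp]]] := IH u' s' g g0 uu' s'P; rewrite -?sz //.
exists (p :: t), h; split=> //; first by rewrite gE hE big_cons polyCM mulrA.
by move=> q; rewrite in_cons => /predU1P[->|/tP].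
Qed.

Lemma primitive_const f : primitive f -> size f = 1%N -> f \is a GRing.unit.
Proof.
move=> fp /eqP /size_poly1P[c c0 fE]; rewrite fE poly_unitE size_polyC c0 coefC eqxx /=.
have [u [s [uu cE sP]]] := fD c0.
case: s cE sP => [|p s] cE sP; first by rewrite cE big_nil mulr1.
have pp : prime_elt p by apply: sP; rewrite mem_head.
case: (fp _ pp); rewrite fE cE big_cons; exists (u * \prod_(q <- s) q)%:P.
by rewrite -polyCM; congr _%:P; ring.
Qed.

(** Over a domain [%|] allows a scalar multiple of [g]. Primitivity removes that scalar, which makes
    the gcd theory of polynomials usable for true divisibility. *)
Lemma primitive_dvdp f g : primitive f -> f %| g -> divides f g.
Proof.
move=> fp /Pdiv.Idomain.dvdpP[[c q] /= c0 E]; apply: (primitive_cancel fp c0).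
by exists q; rewrite mul_polyC E mulrC.
Qed.

Lemma divides_primitive f g : primitive f -> divides g f -> primitive g.
Proof. by move=> fp gf p /fp pf pg; apply: pf; exact: divides_trans gf. Qed.

(** If [f] does not divide [a], its gcd with [a] is constant: otherwise the primitive part of the
    gcd would be [f] up to a unit. Coprimality then gives divisibility of [b] up to a scalar, and
    primitivity removes the scalar. *)
Lemma primitive_irreducible_prime f : primitive f -> (1 < size f)%N ->
    (forall g h, f = g * h -> size g = 1%N \/ size h = 1%N) ->
  prime_elt f.
Proof.
move=> fp f1 fI; have f0 : f != 0 by rewrite -size_poly_gt0 ltnW.
split=> //; first by rewrite poly_unitE gtn_eqF.
move=> a b fab; have [fa|nfa] := pselect (divides f a); [by left|right].
apply: (primitive_dvdp fp).
suff cp : coprimep f a.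
  rewrite -(Pdiv.Idomain.Gauss_dvdpr _ cp).
  by case: fab => c ->; rewrite Pdiv.Idomain.dvdp_mulr.
apply/negPn/negP; rewrite /coprimep => sz.
set d := gcdp f a in sz.
have d0 : d != 0 by rewrite gcdp_eq0 (negPf f0).
have [s [d' [dE sP d'p]]] := content_primitive d0.
have s0 : \prod_(p <- s) p != 0.
  by apply: contraNneq d0 => s0; rewrite dE s0 mul0r.
have sd' : size d' = size d by rewrite dE size_Cmul.
have d'd : d' %| d by rewrite dE Pdiv.Idomain.dvdp_mull.
have [e eE] : divides d' f.
  by apply: primitive_dvdp => //; apply: (Pdiv.Idomain.dvdp_trans d'd); rewrite Pdiv.Idomain.dvdp_gcdl.
have [|/primitive_const eu] := fI _ _ eE; first by rewrite sd' => /eqP; rewrite (negPf sz).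
case: nfa; have [k kE] : divides d' a.
  by apply: primitive_dvdp => //; apply: (Pdiv.Idomain.dvdp_trans d'd); rewrite Pdiv.Idomain.dvdp_gcdr.
have {}eu : e \is a GRing.unit.
  by apply: eu; apply: divides_primitive fp _; exists d'; rewrite mulrC.
by exists (e^-1 * k); rewrite kE eE mulrA mulrK.
Qed.

Lemma factorial_poly : factorial_ring {poly D}.
Proof.
move=> f; have [m] := ubnP (size f); elim: m f => // m IH f; rewrite ltnS => szm f0.
have [s [g [fE sP gp]]] := content_primitive f0.
have g0 : g != 0 by apply: contraNneq f0 => g0; rewrite fE g0 mulr0.
suff [u [t [uu gE tP]]] : exists (u : {poly D}) (t : seq {poly D}),
    [/\ u \is a GRing.unit, g = u * \prod_(p <- t) p &
        forall q : {poly D}, q \in t -> prime_elt q].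
  exists u, (map polyC s ++ t); split=> //.
    by rewrite big_cat big_map /= fE gE rmorph_prod mulrCA.
  by move=> p; rewrite mem_cat => /orP[/mapP[q /sP qp ->]|/tP//]; exact: prime_polyC.
have szg : (size g <= size f)%N.
  rewrite fE size_Cmul //; apply: contraNneq f0 => s0; by rewrite fE s0 mul0r.
have [g1|g1] := leqP (size g) 1.
  exists g, [::]; split; rewrite ?big_nil ?mulr1 //.
  by apply: primitive_const => //; apply/eqP; rewrite eqn_leq g1 size_poly_gt0.
have [gI|] := pselect (forall h k, g = h * k -> size h = 1%N \/ size k = 1%N).
  exists 1, [:: g]; split; rewrite ?unitr1 ?big_seq1 ?mul1r //.
  by move=> p; rewrite inE => /eqP ->; exact: primitive_irreducible_prime.
move=> /existsNP[h] /existsNP[k] /not_implyP[gE] /not_orP[/eqP h1 /eqP k1].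
have /norP[h0 k0] : ~~ ((h == 0) || (k == 0)) by rewrite -mulf_eq0 -gE.
have szE : size g = (size h + size k).-1 by rewrite gE size_mul.
have h2 : (1 < size h)%N by rewrite ltn_neqAle eq_sym h1 size_poly_gt0.
have k2 : (1 < size k)%N by rewrite ltn_neqAle eq_sym k1 size_poly_gt0.
have [|u [t [uu hE tP]]] := IH h _ h0.
  apply: leq_trans szm; apply: leq_trans szg; rewrite szE.
  by case: (size k) k2 => [|[|j]] // _; rewrite !addnS /= ltnS leq_addr.
have [|v [r [vu kE rP]]] := IH k _ k0.
  apply: leq_trans szm; apply: leq_trans szg; rewrite szE.
  by case: (size h) h2 => [|[|j]] // _; rewrite !addSn /= ltnS leq_addl.
exists (u * v), (t ++ r); split; first by rewrite unitrM uu.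
  by rewrite big_cat gE {1}hE {1}kE /=; ring.
by move=> p; rewrite mem_cat => /orP[/tP|/rP].
Qed.

End GaussLemma.

Notation mvar i := (mpolyX _ (mnm1 i)).

Lemma mpoly_rmorph_eq n (R : nzRingType) (S : comNzRingType)
    (f g : {rmorphism mpoly n R -> S}) :
  (forall c, f (mpolyC n c) = g (mpolyC n c)) ->
  (forall i, f (mvar i) = g (mvar i)) -> f =1 g.
Proof.
move=> fgC fgX; elim/mpolyind => [|c m p _ _ IH]; first by rewrite !rmorph0.
rewrite !rmorphD /= IH -mul_mpolyC !rmorphM /= fgC; congr (_ * _ + _).
rewrite mpolyXE_id !rmorph_prod; apply: eq_bigr => i _.
by rewrite !rmorphXn /= fgX.
Qed.

(** * Polynomials in n + 1 variables as polynomials in the last one *)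

Section MpolyFactorial.
Variable n : nat.

Lemma muni_var_max (R : nzRingType) : muni (mvar ord_max) = 'X :> {poly mpoly n R}.
Proof.
rewrite muniE msuppX big_seq1 mcoeffX eqxx scale1r mnm1E eqxx expr1.
rewrite (_ : Multinom _ = mnm0) ?mpolyX0 ?scale1r //.
apply/mnmP => i; rewrite mnmE mnm0E mnm1E.
by case: eqP => // /(congr1 val) /= E; have := ltn_ord i; rewrite -E ltnn.
Qed.

Lemma muni_var_widen (R : nzRingType) (i : 'I_n) :
  muni (mvar (widen_ord (leqnSn n) i)) = (mvar i)%:P :> {poly mpoly n R}.
Proof.
rewrite muniE msuppX big_seq1 mcoeffX eqxx scale1r mnm1E.
rewrite (_ : (_ == ord_max) = false); last first.
  by rewrite -val_eqE /= ltn_eqF.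
rewrite expr0 alg_polyC; congr (mpolyX _ _)%:P.
by apply/mnmP => j; rewrite mnmE !mnm1E.
Qed.

Lemma muni_mwiden (R : comNzRingType) (p : mpoly n R) : muni (mwiden p) = p%:P.
Proof.
apply: (mpoly_rmorph_eq (f := @muni n R \o @mwiden n R) (g := polyC)) => [c|i] /=.
  by rewrite mwidenC muniC.
by rewrite mwidenX mnmwiden1 muni_var_widen.
Qed.

(** The inverse of [muni]: coefficients are widened by one variable, and the polynomial variable
    becomes the last one. *)
Definition mpoly_of_uni (R : comNzRingType) : {rmorphism _ -> _} :=
  horner_eval (mvar ord_max) \o map_poly (@mwiden n R).

Lemma mpoly_of_uniK (R : comNzRingType) : cancel (@mpoly_of_uni R) (@muni n R).
Proof.
move=> q; elim/poly_ind: q => [|q c IH]; first by rewrite !rmorph0.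
rewrite (rmorphD (mpoly_of_uni R)) (rmorphM (mpoly_of_uni R)) muniD muniM IH.
rewrite /= map_polyX map_polyC /= /horner_eval.
by rewrite hornerX hornerC muni_var_max muni_mwiden.
Qed.

Lemma muniK (R : comNzRingType) : cancel (@muni n R) (@mpoly_of_uni R).
Proof.
suff : @mpoly_of_uni R \o @muni n R =1 idfun by [].
apply: mpoly_rmorph_eq.
  by move=> c /=; rewrite muniC /= map_polyC /horner_eval hornerC /= mwidenC.
move=> i /=; case: (unliftP ord_max i) => [j ->|->].
  have -> : lift ord_max j = widen_ord (leqnSn n) j.
    by apply: val_inj; rewrite /= /bump leqNgt ltn_ord.
  by rewrite muni_var_widen map_polyC /horner_eval hornerC /= mwidenX mnmwiden1.
by rewrite muni_var_max map_polyX /horner_eval hornerX.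
Qed.

End MpolyFactorial.

Lemma unit_factorial (D : idomainType) :
  (forall a : D, a != 0 -> a \is a GRing.unit) -> factorial_ring D.
Proof.
move=> uD a /uD au; exists a, [::]; split=> //.
by rewrite big_nil mulr1.
Qed.

Lemma rmorph_divides (D E : idomainType) (f : {rmorphism D -> E}) a b :
  divides a b -> divides (f a) (f b).
Proof. by move=> [c ->]; exists (f c); rewrite rmorphM. Qed.

Lemma iso_prime (D E : idomainType) (f : {rmorphism D -> E})
    (g : {rmorphism E -> D}) p :
  cancel f g -> cancel g f -> prime_elt p -> prime_elt (g p).
Proof.
move=> fK gK [p0 pu pP]; split.
- by apply: contraNneq p0 => gp; rewrite -(gK p) gp rmorph0.
- by apply: contraNN pu => gu; rewrite -(gK p); exact: rmorph_unit.
- move=> a b /(rmorph_divides f); rewrite gK rmorphM.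
  by move=> /pP[] /(rmorph_divides g); rewrite fK; [left|right].
Qed.

Lemma iso_factorial (D E : idomainType) (f : {rmorphism D -> E})
    (g : {rmorphism E -> D}) :
  cancel f g -> cancel g f -> factorial_ring E -> factorial_ring D.
Proof.
move=> fK gK fE a a0.
have [|u [s [uu faE sP]]] := fE (f a).
  by apply: contraNneq a0 => fa; rewrite -(fK a) fa rmorph0.
exists (g u), (map g s); split; first exact: rmorph_unit.
  by rewrite big_map -rmorph_prod -rmorphM -faE fK.
by move=> p /mapP[q /sP qp ->]; exact: iso_prime qp.
Qed.

Lemma mpoly_nvar0 (R : nzRingType) (p : mpoly 0 R) :
  p = mpolyC 0 (mcoeff mnm0 p).
Proof.
apply/mpolyP => m; rewrite mcoeffC (_ : m = mnm0) ?eqxx ?mulr1 //.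
by apply/mnmP => -[].
Qed.

Lemma factorial_mpoly (R : fieldType) n : factorial_ring (mpoly n R).
Proof.
elim: n => [|n IH].
  apply: unit_factorial => p; rewrite (mpoly_nvar0 p) mpolyC_eq0 => c0.
  by apply: rmorph_unit; rewrite unitfE.
exact: (iso_factorial (@muniK n R) (@mpoly_of_uniK n R) (factorial_poly IH)).
Qed.

(** * Homogeneous polynomials *)

Section Monomials.
Variables (n : nat) (R : nzRingType).
Implicit Types p q : mpoly n R.

(** The support changes with the polynomial; a common degree bound puts several such sums over one
    finite type, where linearity and the triangle inequality are termwise. *)
Lemma msupp_sumE (V : nmodType) (F : multinom n -> R -> V) p k :
    (forall m, F m 0 = 0) -> (mmeasure mdeg p <= k)%N ->
  \sum_(m <- msupp p) F m (mcoeff m p) =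
  \sum_(m : bmultinom n k) F m (mcoeff m p).
Proof.
move=> F0 pk; rewrite (big_mksub (bmultinom n k)) ?msupp_uniq //=; last first.
  by move=> x /(msize_mdeg_lt) /leq_trans; apply.
by rewrite big_rmcond //= => j /memN_msupp_eq0 ->.
Qed.

Definition homog k p := forall m, mdeg m != k -> mcoeff m p = 0.

Lemma homog0 k : homog k 0. Proof. by move=> m _; rewrite mcoeff0. Qed.

Lemma homogD k p q : homog k p -> homog k q -> homog k (p + q).
Proof. by move=> hp hq m mk; rewrite mcoeffD hp // hq // addr0. Qed.

Lemma homogN k p : homog k p -> homog k (- p).
Proof. by move=> hp m mk; rewrite mcoeffN hp // oppr0. Qed.

Lemma homogB k p q : homog k p -> homog k q -> homog k (p - q).
Proof. by move=> hp hq; apply: homogD => //; exact: homogN. Qed.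

Lemma homogZ k c p : homog k p -> homog k (c *: p).
Proof. by move=> hp m mk; rewrite mcoeffZ hp // mulr0. Qed.

Lemma homog_sum I (s : seq I) (P : pred I) k (F : I -> mpoly n R) :
  (forall i, P i -> homog k (F i)) -> homog k (\sum_(i <- s | P i) F i).
Proof. by move=> h; apply: big_ind => //; [exact: homog0 | exact: homogD]. Qed.

Lemma homogX m : homog (mdeg m) (mpolyX R m).
Proof. by move=> m' mm; rewrite mcoeffX; have [E|//] := eqVneq m m'; rewrite E eqxx in mm. Qed.

Lemma homog_supp k p m : homog k p -> m \in msupp p -> mdeg m = k.
Proof.
by move=> hp; rewrite mcoeff_msupp => pm; apply/eqP/negPn/negP => /hp/eqP; rewrite (negPf pm).
Qed.

Lemma homog_mderiv k p i : homog k.+1 p -> homog k (mderiv i p).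
Proof.
move=> hp m mk; rewrite mcoeff_deriv hp ?mul0rn // mdegD mdeg1 addn1.
by rewrite eqSS.
Qed.

Lemma homog0_mderiv p i : homog 0 p -> mderiv i p = 0.
Proof.
move=> hp; apply/mpolyP => m; rewrite mcoeff_deriv hp ?mul0rn ?mcoeff0 //.
by rewrite mdegD mdeg1 addn1.
Qed.

End Monomials.

Section Dilation.
Variables (n : nat) (R : idomainType).
Implicit Types p q : mpoly n R.

(** This is p(t x) as a polynomial in t. Homogeneous of degree k means a multiple of t^k here, so
    that questions on factors become questions on monomials in one variable. *)
Definition dilation : mpoly n R -> {poly mpoly n R} :=
  mmap (polyC \o mpolyC n (R:=R)) (fun i => (mvar i)%:P * 'X).

HB.instance Definition _ := GRing.RMorphism.on dilation.

Lemma dilationX m : dilation (mpolyX R m) = mpolyX R m *: 'X^(mdeg m).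
Proof.
rewrite /dilation mmapX /mmap1 mdegE -mul_polyC.
rewrite [in RHS]mpolyXE_id rmorph_prod /= -prodrXr -big_split /=.
by apply: eq_bigr => i _; rewrite exprMn rmorphXn.
Qed.

Lemma dilationE p :
  dilation p = \sum_(m <- msupp p) (mcoeff m p *: mpolyX R m) *: 'X^(mdeg m).
Proof.
rewrite {1}[p]mpolyE rmorph_sum; apply: eq_bigr => m _.
rewrite -mul_mpolyC rmorphM /= dilationX /dilation mmapC /=.
by rewrite -!mul_polyC mulrA -rmorphM.
Qed.

Lemma mcoeff_dilation p k m :
  mcoeff m (dilation p)`_k = if mdeg m == k then mcoeff m p else 0.
Proof.
rewrite dilationE coef_sum raddf_sum /=.
under eq_bigr do rewrite coefZ coefXn mulr_natr mcoeffMn mcoeffZ mcoeffX.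
have [mp|mp] := boolP (m \in msupp p); last first.
  rewrite (memN_msupp_eq0 mp) if_same big_seq big1 // => m' m'p.
  by case: eqP mp => [<-|_ _]; rewrite ?m'p // mulr0 mul0rn.
rewrite (bigD1_seq m) //= eqxx mulr1 big1 ?addr0 => [|m' /negPf ->].
  by rewrite eq_sym; case: eqP => _; rewrite ?mulr1n ?mulr0n.
by rewrite mulr0 mul0rn.
Qed.

Lemma homogP k p : homog k p <-> dilation p = p *: 'X^k.
Proof.
split => [hp|E m mk].
  apply/polyP => j; apply/mpolyP => m; rewrite mcoeff_dilation coefZ coefXn.
  rewrite mulr_natr mcoeffMn; have [->|mk] := eqVneq (mdeg m) k.
    by rewrite eq_sym; case: eqP.
  by rewrite hp // if_same mul0rn.
have := mcoeff_dilation p (mdeg m) m; rewrite eqxx E coefZ coefXn (negPf mk).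
by rewrite mulr0 mcoeff0.
Qed.

(** As long as [N] is positive, one of the two constant coefficients vanishes, and a factor ['X] can
    be cancelled from that side. *)
Lemma monomial_factor (D : idomainType) (f g : {poly D}) c N : c != 0 ->
  f * g = c *: 'X^N -> exists a k, f = a *: 'X^k.
Proof.
move=> c0; elim: N f g => [|N IH] f g E.
  move: E; rewrite expr0 alg_polyC => E.
  have : size (f * g) = 1%N by rewrite E size_polyC c0.
  move=> /eqP; rewrite size_mul_eq1 => /andP[/size_poly1P[a _ ->] _].
  by exists a, 0%N; rewrite expr0 alg_polyC.
have /eqP : f`_0 * g`_0 = 0 by rewrite -coef0M E coefZ coefXn mulr0.
have X0 (h : {poly D}) : h`_0 = 0 -> exists h', h = h' * 'X.
  rewrite -horner_coef0 => /eqP /factor_theorem[h' ->]; exists h'.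
  by rewrite subr0.
have Xreg := mulIf (monic_neq0 (monicX D)).
rewrite mulf_eq0 => /orP[] /eqP /X0[h hE].
  have [|a [k hE']] := IH h g.
    by apply: Xreg; rewrite -scalerAl -exprSr -E hE mulrAC.
  by exists a, k.+1; rewrite hE hE' -scalerAl exprSr.
by apply: (IH f h); apply: Xreg; rewrite -scalerAl -exprSr -E hE mulrA.
Qed.

(** A monomial in t has only monomial factors, and t = 1 recovers a polynomial from its dilation. *)
Lemma homog_factor N p q : p * q != 0 -> homog N (p * q) ->
  exists k l, [/\ homog k p, homog l q & N = (k + l)%N].
Proof.
move=> pq0 /homogP; rewrite rmorphM => E.
have dil1 r : (dilation r).[1] = r.
  rewrite dilationE horner_sum [RHS]mpolyE; apply: eq_bigr => m _.
  by rewrite hornerZ hornerXn expr1n mulr1.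
have mono r a k : dilation r = a *: 'X^k -> homog k r.
  move=> rE; apply/homogP; rewrite rE; congr (_ *: _).
  by rewrite -(dil1 r) rE hornerZ hornerXn expr1n mulr1.
have [a [k pE]] := monomial_factor pq0 E.
have [b [l qE]] : exists b l, dilation q = b *: 'X^l.
  by apply: (monomial_factor pq0 (g := dilation p) (N := N)); rewrite mulrC.
exists k, l; split; [exact: mono pE | exact: mono qE |].
move: E => /=; rewrite ((homogP k p).1 (mono _ _ _ pE)).
rewrite ((homogP l q).1 (mono _ _ _ qE)).
rewrite -scalerAl -scalerAr scalerA -exprD => /(congr1 (coefp N)) /=.
rewrite !coefZ !coefXn eqxx mulr1; case: eqP => // _ /esym/eqP.
by rewrite mulr0 (negPf pq0).
Qed.

End Dilation.

Section Euler.
Variables (n : nat) (R : comNzRingType).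
Implicit Types p q : mpoly n R.

Lemma homog_mvar k p i : homog k p -> homog k.+1 (mvar i * p).
Proof.
move=> hp; rewrite [p]mpolyE big_distrr /= big_seq_cond.
apply: homog_sum => m /andP[mp _]; rewrite -scalerAr -mpolyXD; apply: homogZ.
by rewrite -(homog_supp hp mp) -add1n -(mdeg1 i) -mdegD; exact: homogX.
Qed.

Lemma euler_monomial m :
  \sum_(i < n) mvar i * mderiv i (mpolyX R m) = (mdeg m)%:R *: mpolyX R m.
Proof.
rewrite mdegE natr_sum scaler_suml; apply: eq_bigr => i _.
rewrite mderivX -scalerAr -mpolyXD.
have [->|mi] := eqVneq (m i) 0%N; first by rewrite !scale0r.
by rewrite addmC submK // lep1mP.
Qed.

Lemma euler k p : homog k p ->
  \sum_(i < n) mvar i * mderiv i p = k%:R *: p.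
Proof.
move=> hp; under eq_bigr do rewrite {1}[p]mpolyE raddf_sum mulr_sumr /=.
rewrite exchange_big [in RHS](mpolyE p) scaler_sumr; apply: eq_big_seq => m mp /=.
under eq_bigr do rewrite mderivZ -scalerAr.
rewrite -scaler_sumr euler_monomial (homog_supp hp mp) !scalerA.
by rewrite mulrC.
Qed.

Lemma meval_homog k p s x : homog k p ->
  meval (fun i => s * x i) p = s ^+ k * meval x p.
Proof.
move=> hp; rewrite !mevalE mulr_sumr; apply: eq_big_seq => m mp.
rewrite mulrCA; congr (_ * _); rewrite -(homog_supp hp mp) mdegE -prodrXr.
by rewrite -big_split; apply: eq_bigr => i _; rewrite exprMn.
Qed.

End Euler.

(** * Gaussian means *)

Section GaussianMoments.
Variable R : realType.
Implicit Types f y : {poly R}.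

(** The moments of the standard normal law, through E t^(k+2) = (k+1) E t^k. Means are sums of
    moments, without any integral. *)
Fixpoint gmoment (k : nat) : R :=
  match k with
  | 0%N => 1
  | 1%N => 0
  | (k'.+1 as k1).+1 => k1%:R * gmoment k'
  end.

Lemma gmomentS k : gmoment k.+1 = k%:R * gmoment k.-1.
Proof. by case: k => //=; rewrite mul0r. Qed.

Definition gmean f : R := \sum_(k < size f) gmoment k * f`_k.

(** Stein's equation for the normal law. The moments recur with step two, hence the induction on
    pairs; the witness for k + 2 is X^(k+1) plus k + 1 times the one for k. *)
Lemma stein_monomial k :
  exists y, 'X^k - (gmoment k)%:P = 'X * y - y^`().
Proof.
suff : (exists y, 'X^k - (gmoment k)%:P = 'X * y - y^`()) /\
       (exists y, 'X^(k.+1) - (gmoment k.+1)%:P = 'X * y - y^`()) by case.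
elim: k => [|k [[y yE] IH]].
  split; first by exists 0; rewrite expr0 /= linear0 mulr0 subrr subr0.
  by exists 1; rewrite expr1 /= derivC polyC0 mulr1.
split=> //; exists ('X^(k.+1) + k.+1%:R *: y).
rewrite derivD derivZ derivXn /= !scaler_nat.
have -> : (k.+1%:R * gmoment k)%:P = (gmoment k)%:P *+ k.+1 :> {poly R}.
  by rewrite mulr_natl raddfMn.
have -> : (gmoment k)%:P = 'X^k - ('X * y - y^`()) by rewrite -yE; ring.
by rewrite [in LHS]exprS; ring.
Qed.

Lemma gmean_le f N : (size f <= N)%N ->
  gmean f = \sum_(k < N) gmoment k * f`_k.
Proof.
move=> fN; rewrite /gmean (big_ord_widen N (fun k => gmoment k * f`_k)) //.
rewrite big_mkcond; apply: eq_bigr => k _; case: ltnP => // fk.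
by rewrite nth_default ?mulr0.
Qed.

Lemma stein f : exists y, f - (gmean f)%:P = 'X * y - y^`().
Proof.
have [Y YE] := choice stein_monomial.
exists (\sum_(k < size f) f`_k *: Y k).
rewrite mulr_sumr (raddf_sum (@deriv _)) -sumrB -{1}[f]coefK poly_def /gmean.
rewrite (raddf_sum polyC) -sumrB; apply: eq_bigr => k _.
by rewrite /= derivZ -scalerAr -scalerBr -YE scalerBr mulrC -!mul_polyC polyCM.
Qed.

Lemma is_derive_horner f t : is_derive t (1 : R) (horner f) (f^`()).[t].
Proof.
apply: DeriveDef; first exact: derivable_horner.
by rewrite -derive1E derivE.
Qed.

(* With f - gmean f = t y - y', the derivative of y e^(-t^2/2) is
   (gmean f - f) e^(-t^2/2); were gmean f nonpositive, y e^(-t^2/2) would be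
   nonincreasing, whereas t y - y' >= 0 forces y to be negative near -oo and
   positive near +oo. *)
Lemma gmean_gt0 f : (forall t, 0 <= f.[t]) -> f != 0 -> 0 < gmean f.
Proof.
move=> fge0 f0; rewrite ltNge; apply/negP => gle0.
have [y yE] := stein f.
have hge0 t : 0 <= ('X * y - y^`()).[t].
  by rewrite -yE hornerD hornerN hornerC addr_ge0 // oppr_ge0.
have [y0|y0] := eqVneq y 0.
  move: yE; rewrite y0 mulr0 linear0 subr0 => /eqP; rewrite subr_eq0 => /eqP fE.
  have := fge0 0; rewrite fE hornerC => gge0.
  case/negP: f0; rewrite fE polyC_eq0 eq_le gle0.
  by move: gge0; rewrite fE.
set h := 'X * y - y^`() in hge0 *.
pose g t := y.[t] * expR (- (t ^+ 2 / 2)).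
have dg (t : R) : is_derive t 1 g ((- h.[t]) * expR (- (t ^+ 2 / 2))).
  have dy := is_derive_horner y t.
  apply: is_derive_eq; rewrite /h !hornerE.
  by rewrite /GRing.scale /=; field.
have gdec s t : s <= t -> g t <= g s.
  move=> st; apply: (@ler0_derive1_nincr _ g s t) => //.
  - move=> x _; rewrite derive1E; have [_ ->] := dg x.
    by rewrite mulr_le0_ge0 ?expR_ge0 // oppr_le0.
  - by apply: derivable_within_continuous => x _; have [] := dg x.
have szXy : size ('X * y) = (size y).+1 by rewrite mulrC size_mulX.
have szd : (size (- y^`()) < size ('X * y)%R)%N.
  by rewrite size_polyN szXy ltnS ltnW // lt_size_deriv.
have lh : lead_coef h = lead_coef y.
  by rewrite /h lead_coefDl // mulrC lead_coefMX.
have szh : size h = (size y).+1 by rewrite /h size_polyDl.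
have lead_ge0 (p : {poly R}) : (forall t, 0 <= p.[t]) -> 0 <= lead_coef p.
  move=> pge0; rewrite leNgt -oppr_gt0 -lead_coefN; apply/negP => lp.
  have [N /(_ N (lexx _))] := polyrcf.poly_pinfty_gt_lc lp.
  move=> /(lt_le_trans lp); rewrite hornerN oppr_gt0 ltNge.
  by rewrite pge0.
have lpos : 0 < lead_coef y.
  by rewrite lt_neqAle eq_sym lead_coef_eq0 y0 -lh lead_ge0.
have lead_sym (p : {poly R}) :
    lead_coef (p \Po (- 'X)) = lead_coef p * (-1) ^+ (size p).-1.
  by rewrite lead_coef_comp ?size_polyN ?size_polyX // lead_coefN lead_coefX.
(* A nonnegative polynomial has even degree, and the degree of [h] is the size of [y]; so the degree
   of [y] is odd and [y] has opposite signs far out on the two sides. *)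
have odd_y : (-1) ^+ (size y) = 1 :> R.
  have : 0 <= lead_coef (h \Po (- 'X)).
    by apply: lead_ge0 => t; rewrite horner_comp.
  rewrite lead_sym lh szh /= pmulr_rge0 // -signr_odd.
  by case: odd; rewrite ?expr1 ?expr0 // oppr_ge0 ler10.
have [N1 N1P] := polyrcf.poly_pinfty_gt_lc lpos.
have lpos' : 0 < lead_coef (- (y \Po (- 'X))).
  rewrite lead_coefN lead_sym; move: odd_y.
  have : (0 < size y)%N by rewrite size_poly_gt0.
  case: (size y) => // k _; rewrite exprS mulN1r => /eqP.
  by rewrite eqr_oppLR => /eqP ->; rewrite mulrN1 opprK.
have [N2 N2P] := polyrcf.poly_pinfty_gt_lc lpos'.
pose T := Num.max 0 (Num.max N1 N2).
have T0 : 0 <= T by rewrite le_max lexx.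
have y1 : 0 < y.[T].
  by apply: lt_le_trans lpos _; apply: N1P; rewrite !le_max lexx orbT.
have y2 : y.[- T] < 0.
  rewrite -oppr_gt0; apply: lt_le_trans lpos' _.
  have -> : - y.[- T] = (- (y \Po (- 'X))).[T].
    by rewrite hornerN horner_comp hornerN hornerX.
  by apply: N2P; rewrite !le_max lexx !orbT.
have : g T <= g (- T) by apply: gdec; lra.
rewrite /g sqrrN ler_pM2r ?expR_gt0 //; lra.
Qed.

End GaussianMoments.

Section MpolyReal.
Variable R : realType.

Lemma poly_eq0_near (q : {poly R}) a e : 0 < e ->
  (forall t, `|t - a| < e -> q.[t] = 0) -> q = 0.
Proof.
move=> e0 qt; apply/eqP; apply: contraT => q0.
pose rs := [seq a + e / (k.+2)%:R | k <- iota 0 (size q)].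
have := max_poly_roots q0 (rs := rs).
rewrite size_map size_iota ltnn => -> //.
- apply/allP => _ /mapP[k _ ->]; apply/rootP/qt.
  rewrite addrAC subrr add0r ger0_norm ?divr_ge0 ?ler0n ?ltW //.
  by rewrite ltr_pdivrMr ?ltr0n // ltr_pMr // ltr1n.
- rewrite map_inj_uniq ?iota_uniq // => i j /addrI/(mulfI (lt0r_neq0 e0))/invr_inj.
  by move/eqP; rewrite eqr_nat => /eqP[].
Qed.

Variable n : nat.

Definition init_point (x : 'I_n.+1 -> R) : 'I_n -> R :=
  fun i => x (widen_ord (leqnSn n) i).

Definition snoc_point (x : 'I_n -> R) t : 'I_n.+1 -> R :=
  fun i => if insub (val i) is Some j then x j else t.

Lemma snoc_pointK x t : init_point (snoc_point x t) =1 x.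
Proof.
move=> i; rewrite /init_point /snoc_point; case: insubP => [j _ /val_inj-> //|] /=.
by rewrite ltn_ord.
Qed.

Lemma snoc_point_max x t : snoc_point x t ord_max = t.
Proof. by rewrite /snoc_point insubN //= ltnn. Qed.

Lemma meval_muni (p : mpoly n.+1 R) x :
  meval x p = (map_poly (meval (init_point x)) (muni p)).[x ord_max].
Proof.
apply: (mpoly_rmorph_eq (f := meval x) (g := horner_eval (x ord_max) \o
  (map_poly (meval (init_point x)) \o @muni n R))) => [c|i] /=.
  by rewrite mevalC muniC map_polyC /horner_eval hornerC /= mevalC.
rewrite mevalXU; case: (unliftP ord_max i) => [j ->|->].
  have -> : lift ord_max j = widen_ord (leqnSn n) j.
    by apply: val_inj; rewrite /= /bump leqNgt ltn_ord.
  by rewrite muni_var_widen map_polyC /horner_eval hornerC /= mevalXU.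
by rewrite muni_var_max map_polyX /horner_eval hornerX.
Qed.

End MpolyReal.

(** Freeze all coordinates but the last: a polynomial in one variable with infinitely many zeros
    vanishes, so the coefficients vanish on a cube of one dimension less. *)
Lemma mpoly_eq0_near (R : realType) n (p : mpoly n R) a e : 0 < e ->
  (forall x, (forall i, `|x i - a i| < e) -> meval x p = 0) -> p = 0.
Proof.
move=> e0; elim: n p a => [|n IH] p a px.
  have := px a; rewrite (mpoly_nvar0 p) mevalC => ->; first by rewrite mpolyC0.
  by case.
apply: (can_inj (@muniK n R)); rewrite rmorph0; apply/polyP => k; rewrite coef0.
apply: (IH _ (init_point a)) => x xa.
rewrite -(coef_map (meval x)); have -> // : map_poly (meval x) (muni p) = 0.
  apply: (poly_eq0_near (a := a ord_max) e0) => t ta.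
  have := px (snoc_point x t); rewrite meval_muni snoc_point_max.
  rewrite (eq_map_poly (fun q => meval_eq q (snoc_pointK x t))) => -> // i.
  case: (unliftP ord_max i) => [j ->|->]; last by rewrite snoc_point_max.
  have -> : lift ord_max j = widen_ord (leqnSn n) j.
    by apply: val_inj; rewrite /= /bump leqNgt ltn_ord.
  have := snoc_pointK x t j; rewrite /init_point => ->; exact: xa.
by rewrite coef0.
Qed.

Lemma mpoly_eq0 (R : realType) n (p : mpoly n R) :
  (forall x, meval x p = 0) -> p = 0.
Proof. by move=> px; apply: (mpoly_eq0_near (a := fun=> 0) ltr01) => x _. Qed.

Section GaussianMean.
Variable R : realType.

Definition Gmean n (p : mpoly n R) : R :=
  \sum_(m <- msupp p) mcoeff m p * \prod_(i < n) gmoment R (m i).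

Lemma GmeanE n k (p : mpoly n R) : (mmeasure mdeg p <= k)%N ->
  Gmean p = \sum_(m : bmultinom n k) mcoeff m p * \prod_(i < n) gmoment R ((m : multinom n) i).
Proof.
by apply: (msupp_sumE (F := fun m c => c * \prod_(i < n) gmoment R (m i))) => m; rewrite mul0r.
Qed.

Lemma Gmean_is_linear n : linear_for *%R (@Gmean n).
Proof.
move=> c p q; pose k := maxn (mmeasure mdeg (c *: p + q)) (maxn (mmeasure mdeg p) (mmeasure mdeg q)).
rewrite !(GmeanE (k := k)) ?leq_max ?leqnn ?orbT // mulr_sumr -big_split.
by apply: eq_bigr => m _; rewrite mcoeffD mcoeffZ mulrDl mulrA.
Qed.

HB.instance Definition _ n := GRing.isLinear.Build R (mpoly n R) R *%R (@Gmean n)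
  (@Gmean_is_linear n).

Lemma GmeanX n m : Gmean (mpolyX R m) = \prod_(i < n) gmoment R (m i).
Proof. by rewrite /Gmean msuppX big_seq1 mcoeffX eqxx mul1r. Qed.

(** On a monomial this is the moment recursion [gmomentS] in the i-th coordinate. *)
Lemma Gmean_by_parts n i (p : mpoly n R) :
  Gmean (mvar i * p) = Gmean (mderiv i p).
Proof.
rewrite [p]mpolyE mulr_sumr (raddf_sum (mderiv i)) !(raddf_sum (@Gmean n)).
apply: eq_bigr => m _ /=.
rewrite mderivZ -scalerAr !linearZ /=; congr (_ * _).
rewrite -mpolyXD mderivX linearZ /= !GmeanX.
rewrite (bigD1 i) //= [X in _ = _ * X](bigD1 i) //= mnmDE mnm1E eqxx add1n.
rewrite gmomentS -mulrA; congr (_ * _); rewrite mnmBE mnm1E eqxx subn1; congr (_ * _).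
apply: eq_bigr => j ji; rewrite mnmDE mnmBE mnm1E eq_sym (negPf ji).
by rewrite add0n subn0.
Qed.

(** The mean in the last variable alone, which reduces positivity in several variables to one
    variable, as in Fubini's theorem. *)
Definition Gmean_last n (p : mpoly n.+1 R) : mpoly n R :=
  \sum_(k < size (muni p)) gmoment R k *: (muni p)`_k.

Lemma Gmean_lastE n k (p : mpoly n.+1 R) : (size (muni p) <= k)%N ->
  Gmean_last p = \sum_(j < k) gmoment R j *: (muni p)`_j.
Proof.
move=> pk; rewrite /Gmean_last (big_ord_widen k (fun j => gmoment R j *: (muni p)`_j)) //.
rewrite big_mkcond; apply: eq_bigr => j _; case: ltnP => // fk.
by rewrite nth_default ?scaler0.
Qed.

Lemma Gmean_last_is_linear n : linear (@Gmean_last n).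
Proof.
move=> c p q; pose a := size (muni p); pose b := size (muni q).
pose d := size (muni (c *: p + q)); pose k := maxn d (maxn a b).
have dk : (d <= k)%N := leq_maxl _ _.
have ak : (a <= k)%N := leq_trans (leq_maxl _ _) (leq_maxr _ _).
have bk : (b <= k)%N := leq_trans (leq_maxr _ _) (leq_maxr _ _).
rewrite (Gmean_lastE dk) (Gmean_lastE ak) (Gmean_lastE bk).
rewrite scaler_sumr -big_split.
apply: eq_bigr => j _ /=; rewrite muniD muniZ coefD coefZ mul_mpolyC.
by rewrite scalerDr !scalerA [c * _]mulrC.
Qed.

HB.instance Definition _ n := GRing.isLinear.Build R (mpoly n.+1 R) (mpoly n R)
  *:%R (@Gmean_last n) (@Gmean_last_is_linear n).

Lemma Gmean_lastP n (p : mpoly n.+1 R) : Gmean (Gmean_last p) = Gmean p.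
Proof.
rewrite [p]mpolyE (raddf_sum (@Gmean_last n)) (raddf_sum (@Gmean n)).
rewrite (raddf_sum (@Gmean n.+1)); apply: eq_bigr => m _ /=.
rewrite !linearZ /=; congr (_ * _).
have muniX : muni (mpolyX R m) =
    mpolyX R (Multinom [tuple m (widen_ord (leqnSn n) i) | i < n]) *: 'X^(m ord_max).
  by rewrite muniE msuppX big_seq1 mcoeffX eqxx scale1r.
rewrite (Gmean_lastE (k := (m ord_max).+1)); last first.
  by rewrite muniX (leq_trans (size_scale_leq _ _)) // size_polyXn.
rewrite big_ord_recr /= big1 ?add0r => [|j _]; last first.
  by rewrite muniX coefZ coefXn ltn_eqF // mulr0 scaler0.
rewrite muniX coefZ coefXn eqxx mulr1 linearZ /= !GmeanX big_ord_recr /= mulrC.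
by congr (_ * _); apply: eq_bigr => i _; rewrite mnmE.
Qed.

Lemma Gmean_last_eval n (p : mpoly n.+1 R) x :
  meval x (Gmean_last p) = gmean (map_poly (meval x) (muni p)).
Proof.
rewrite (gmean_le (N := size (muni p))) ?size_poly // /Gmean_last raddf_sum.
by apply: eq_bigr => k _; rewrite /= mevalZ coef_map.
Qed.

(** If the mean over the last variable were identically zero, each slice would be a nonnegative
    polynomial of mean zero, hence zero. *)
Lemma Gmean_gt0 n (p : mpoly n R) :
  (forall x, 0 <= meval x p) -> p != 0 -> 0 < Gmean p.
Proof.
elim: n p => [|n IH] p pge0 p0.
  have := pge0 (fun=> 0); move: p0; rewrite (mpoly_nvar0 p) mpolyC_eq0 mevalC => c0 cge0.
  rewrite -[mpolyC _ _]mulr1 mul_mpolyC linearZ /= -mpolyX0 GmeanX big_ord0 mulr1.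
  by rewrite lt_neqAle eq_sym c0.
rewrite -Gmean_lastP.
have uni_ge0 x t : 0 <= (map_poly (meval x) (muni p)).[t].
  have := pge0 (snoc_point x t); rewrite meval_muni snoc_point_max.
  by rewrite (eq_map_poly (fun q => meval_eq q (snoc_pointK x t))).
have gm_ge0 x : 0 <= gmean (map_poly (meval x) (muni p)).
  have [->|q0] := eqVneq (map_poly (meval x) (muni p)) 0.
    by rewrite /gmean size_poly0 big_ord0.
  by rewrite ltW // gmean_gt0.
apply: IH => [x|]; first by rewrite Gmean_last_eval.
apply: contra p0 => /eqP q0; apply/eqP/mpoly_eq0 => x.
rewrite meval_muni; set q := map_poly _ _; have [->|qn0] := eqVneq q 0; first by rewrite horner0.
have := gmean_gt0 (uni_ge0 _) qn0.
by rewrite -Gmean_last_eval q0 meval0 ltxx.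
Qed.

Definition mlaplacian n (p : mpoly n R) := \sum_(i < n) mderiv i (mderiv i p).

Lemma mlaplacian_mderiv n i (p : mpoly n R) :
  mlaplacian (mderiv i p) = mderiv i (mlaplacian p).
Proof.
rewrite /mlaplacian (raddf_sum (mderiv i)); apply: eq_bigr => j _ /=.
by rewrite (mderiv_comm i j p) (mderiv_comm i j).
Qed.

(* By Euler's identity N P s = \sum_i x_i (d_i P) s; integrating by parts leaves
   only the terms (d_i P) (d_i s), in which both degrees have dropped. *)
Lemma harmonic_orthogonal n N k (P s : mpoly n R) :
    homog N P -> mlaplacian P = 0 -> homog k s -> (k < N)%N ->
  Gmean (P * s) = 0.
Proof.
elim: k N P s => [|k IH] [//|N] P s hP lP hs kN;
  (suff /eqP : N.+1%:R * Gmean (P * s) = 0 by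
     rewrite mulf_eq0 pnatr_eq0 => /eqP);
  rewrite -[_ * Gmean _]linearZ /= scalerAl -(euler hP) mulr_suml raddf_sum /=;
  (under eq_bigr do rewrite -mulrA Gmean_by_parts mderivM raddfD /=);
  rewrite big_split /= -raddf_sum -mulr_suml [X in X * s](_ : _ = mlaplacian P) // lP mul0r raddf0 add0r.
- by rewrite big1 // => i _; rewrite (homog0_mderiv i hs) mulr0 raddf0.
- rewrite big1 // => i _; apply: (IH N) => //.
  + exact: homog_mderiv.
  + by rewrite mlaplacian_mderiv lP raddf0.
  + exact: homog_mderiv.
Qed.

End GaussianMean.

Lemma near_normP (R : realType) (V : normedModType R) (a : V) (Q : set V) :
  (\forall x \near a, Q x) <-> exists2 e, 0 < e & forall x, `|x - a| < e -> Q x.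
Proof.
split=> [/nbhs_ballP[e /= e0 eQ]|[e e0 eQ]].
  by exists e => // x xa; apply: eQ; rewrite -ball_normE /ball_/= distrC.
apply/nbhs_ballP; exists e => // x; rewrite -ball_normE /ball_/= distrC.
exact: eQ.
Qed.

(** * Polynomials as functions on row vectors *)

Section RowVectors.
Variables (R : realType) (n : nat).
Implicit Types x y : 'rV[R]_n.

Lemma rV_norm_lt x e : 0 < e -> (forall i, `|x ord0 i| < e) -> `|x| < e.
Proof.
move=> e0 xe; rewrite /Num.norm /= mx_normrE; apply/bigmax_ltP; split=> // -[i j] _.
by rewrite ord1.
Qed.

Lemma rV_norm_le x e : 0 <= e -> (forall i, `|x ord0 i| <= e) -> `|x| <= e.
Proof.
move=> e0 xe; rewrite /Num.norm /= mx_normrE; apply/bigmax_leP; split=> // -[i j] _.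
by rewrite ord1.
Qed.

Lemma coord_norm_le x i : `|x ord0 i| <= `|x|.
Proof.
by rewrite [leRHS]/Num.norm /= mx_normrE; apply/bigmax_geP; right => /=; exists (ord0, i).
Qed.

Definition peval (p : mpoly n R) x : R := meval (x ord0) p.

Lemma pevalB p q x : peval (p - q) x = peval p x - peval q x.
Proof. exact: mevalB. Qed.
Lemma pevalM p q x : peval (p * q) x = peval p x * peval q x.
Proof. exact: mevalM. Qed.
Lemma pevalZ c p x : peval (c *: p) x = c * peval p x.
Proof. exact: mevalZ. Qed.
Lemma peval0 x : peval 0 x = 0.
Proof. exact: meval0. Qed.
Lemma peval_sum I (r : seq I) (P : pred I) (F : I -> mpoly n R) x :
  peval (\sum_(i <- r | P i) F i) x = \sum_(i <- r | P i) peval (F i) x.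
Proof. exact: (raddf_sum (meval (x ord0))). Qed.

Lemma fun_continuousD (f g : 'rV[R]_n -> R) :
  continuous f -> continuous g -> continuous (fun x => f x + g x).
Proof. by move=> cf cg x; exact: (cvgD (cf x) (cg x)). Qed.

Lemma fun_continuousM (f g : 'rV[R]_n -> R) :
  continuous f -> continuous g -> continuous (fun x => f x * g x).
Proof. by move=> cf cg x; exact: (cvgM (cf x) (cg x)). Qed.

Lemma peval_continuous p : continuous (peval p).
Proof.
have -> : peval p = fun x => \sum_(m <- msupp p) mcoeff m p * \prod_(i < n) x ord0 i ^+ m i.
  by apply/funext => x; rewrite /peval mevalE.
elim: (msupp p) => [|m s IH].
  under eq_fun do rewrite big_nil; exact: cst_continuous.
under eq_fun do rewrite big_cons; apply: fun_continuousD; last exact: IH.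
apply: fun_continuousM; first exact: cst_continuous.
elim: (index_enum _) => [|i r IHr].
  under eq_fun do rewrite big_nil; exact: cst_continuous.
under eq_fun do rewrite big_cons; apply: fun_continuousM; last exact: IHr.
elim: (m i) => [|k IHk].
  under eq_fun do rewrite expr0; exact: cst_continuous.
under eq_fun do rewrite exprS; apply: fun_continuousM; last exact: IHk.
exact: coord_continuous.
Qed.

Lemma peval_eq0_near (p : mpoly n R) a e : 0 < e ->
  (forall x, `|x - a| < e -> peval p x = 0) -> p = 0.
Proof.
move=> e0 px; apply: (mpoly_eq0_near (a := a ord0) e0) => x xa.
have := px (\row_i x i); rewrite /peval (meval_eq _ (v2 := x)); last first.
  by move=> i; rewrite mxE.
by apply; apply: rV_norm_lt => // i; rewrite !mxE.
Qed.

Lemma peval_homog k p s x : homog k p -> peval p (s *: x) = s ^+ k * peval p x.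
Proof.
by move=> hp; rewrite -(meval_homog s (x ord0) hp); apply: meval_eq => i; rewrite mxE.
Qed.

End RowVectors.

Section SignChange.
Variable R : realType.
Implicit Types f h : {poly R}.

(** At the supremum [t0] of the points where [f] is negative, [f] vanishes; so [h] keeps a nonzero
    sign near [t0], and the sign change of [f] passes to [f * h]. *)
Lemma poly_sign_change f h : f.[0] < 0 -> 0 < f.[1] ->
    (forall t, 0 <= t <= 1 -> f.[t] = 0 -> h.[t] != 0) ->
  exists t1 t2, [/\ 0 <= t1, t1 <= t2, t2 <= 1, (f * h).[t1] * (f * h).[t2] < 0
    & forall t, t1 <= t <= t2 -> h.[t] != 0].
Proof.
move=> f0 f1 fh.
have near_poly (q : {poly R}) t : 0 < q.[t] ->
    exists2 e, 0 < e & forall s, `|s - t| < e -> 0 < q.[s].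
  by move=> qt; apply/near_normP; exact: (cvgr_gt _ (continuous_horner (x:=t)) _ qt).
have near_polyN (q : {poly R}) t : q.[t] < 0 ->
    exists2 e, 0 < e & forall s, `|s - t| < e -> q.[s] < 0.
  by move=> qt; apply/near_normP; exact: (cvgr_lt _ (continuous_horner (x:=t)) _ qt).
pose S := [set t : R | 0 <= t <= 1 /\ f.[t] < 0].
have S0 : S 0 by split=> //; rewrite lexx ler01.
have Sub : ubound S 1 by move=> t [/andP[]].
have supS : has_sup S by split; [exists 0 | exists 1].
pose t0 := sup S.
have t00 : 0 <= t0 by exact: sup_upper_bound.
have t01 : t0 <= 1 by apply: ge_sup => //; exists 0.
have adh e : 0 < e -> exists t, [/\ S t, t0 - e < t & t <= t0].
  move=> e0; have [t St te] := sup_adherent e0 supS.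
  by exists t; split=> //; exact: sup_upper_bound.
have ft0 : f.[t0] = 0.
  apply/eqP; rewrite eq_le; apply/andP; split; rewrite leNgt; apply/negP.
  - move=> /near_poly[e e0 fe]; have [t [[_ ft] te tt0]] := adh _ e0.
    have := fe t; rewrite ltr_norml => /(_ _)/lt_trans/(_ ft); rewrite ltxx.
    by move=> H; suff : false by []; apply: H; lra.
  - move=> ft; have t01' : t0 < 1.
      rewrite lt_neqAle t01 andbT; apply: contraTneq ft => ->.
      by rewrite -leNgt ltW.
    have [e e0 fe] := near_polyN _ _ ft.
    pose d := Num.min (e / 2) ((1 - t0) / 2).
    have d0 : 0 < d by rewrite lt_min; apply/andP; split; lra.
    have de : d <= e / 2 by rewrite ge_min lexx.
    have d1 : d <= (1 - t0) / 2 by rewrite ge_min lexx orbT.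
    have : t0 + d <= t0.
      apply: sup_upper_bound => //; split; first by apply/andP; split; lra.
      by apply: fe; rewrite addrAC subrr add0r ger0_norm; lra.
    by lra.
have ht0 : h.[t0] != 0 by apply: fh => //; rewrite t00.
have [e e0 he] : exists2 e, 0 < e & forall s, `|s - t0| < e -> 0 < h.[s] * h.[t0].
  have [|e e0 he] := near_poly (h * h.[t0]%:P) t0.
    by rewrite hornerM hornerC -expr2 exprn_even_gt0.
  by exists e => // s /he; rewrite hornerM hornerC.
have t01' : t0 < 1 by rewrite lt_neqAle t01 andbT; apply: contraTneq f1 => <-; rewrite ft0 ltxx.
have fge t : t0 < t -> t <= 1 -> 0 <= f.[t].
  move=> tt t1; rewrite leNgt; apply/negP => ft.
  have : t <= t0 by apply: sup_upper_bound => //; split=> //; apply/andP; split=> //; lra.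
  by lra.
have [t1 [[/andP[t10 t11] ft1] t1e t1t0]] := adh _ e0.
pose d := Num.min (e / 2) ((1 - t0) / 2).
have d0 : 0 < d by rewrite lt_min; apply/andP; split; lra.
have de : d <= e / 2 by rewrite ge_min lexx.
have d1 : d <= (1 - t0) / 2 by rewrite ge_min lexx orbT.
(* Right of [t0], [f] is only known to be nonnegative; as a nonzero polynomial it cannot vanish on a
   whole interval, so it is positive at some [t2] there. *)
have [t2 [t2d ft2]] : exists t2, `|t2 - (t0 + d)| < d /\ f.[t2] != 0.
  apply: contrapT => /forallNP H.
  have f00 : f = 0.
    apply: (poly_eq0_near (a := t0 + d) d0) => t td.
    by have /not_andP[//|/negP/negPn/eqP] := H t.
  by move: f0; rewrite f00 horner0 ltxx.
move: t2d; rewrite ltr_norml => /andP[t2d1 t2d2].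
have {}ft2 : 0 < f.[t2].
  by rewrite lt_neqAle eq_sym ft2; apply: fge; lra.
have hpos t : t1 <= t <= t2 -> 0 < h.[t] * h.[t0].
  by move=> /andP[ta tb]; apply: he; rewrite ltr_norml; apply/andP; split; lra.
exists t1, t2; split=> //; [by lra | by lra | |].
  rewrite !hornerM mulrACA nmulr_rlt0; last by rewrite nmulr_rlt0.
  have h1 : 0 < h.[t1] * h.[t0] by apply: hpos; rewrite lexx /=; lra.
  have h2 : 0 < h.[t2] * h.[t0] by apply: hpos; rewrite lexx andbT; lra.
  have : 0 < (h.[t1] * h.[t2]) * h.[t0] ^+ 2.
    by rewrite expr2 mulrACA mulr_gt0.
  by rewrite pmulr_lgt0 // exprn_even_gt0.
by move=> t /hpos; apply: contraTneq => ->; rewrite mul0r ltxx.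
Qed.

End SignChange.

(** * Division by a harmonic homogeneous polynomial *)

Lemma poly_rmorph_eq (A S : nzRingType) (f g : {rmorphism {poly A} -> S}) :
  (forall c, f c%:P = g c%:P) -> f 'X = g 'X -> f =1 g.
Proof.
move=> fgC fgX; elim/poly_ind => [|q c IH]; first by rewrite !rmorph0.
by rewrite !rmorphD !rmorphM /= IH fgX fgC.
Qed.

(** [d] acts like a resultant: it detects the specializations for which the two polynomials share a
    root. *)
Lemma bezout_common_root (A B : comNzRingType) (f : {rmorphism A -> B})
    (al be P Q : {poly A}) d t : al * P + be * Q = d%:P ->
  (map_poly f P).[t] = 0 -> (map_poly f Q).[t] = 0 -> f d = 0.
Proof.
move=> /(congr1 (map_poly f)) + Pt Qt.
rewrite rmorphD !rmorphM /= map_polyC => /(congr1 (horner^~ t)) /=.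
by rewrite hornerD !hornerM Pt Qt !mulr0 addr0 hornerC.
Qed.

(** * Restriction to lines of a fixed direction *)

Section Translation.
Variables (R : realType) (n : nat).
Implicit Types (p q : mpoly n R) (e x : 'rV[R]_n).

(** This is p(x + t e) as a polynomial in t with x generic, so that all lines of direction e are
    handled at once. *)
Definition translate e : mpoly n R -> {poly mpoly n R} :=
  mmap (polyC \o mpolyC n (R:=R))
    (fun i => (mvar i)%:P + (mpolyC n (e ord0 i))%:P * 'X).

HB.instance Definition _ e := GRing.RMorphism.on (translate e).

Lemma translateC e c : translate e (mpolyC n c) = (mpolyC n c)%:P.
Proof. by rewrite /translate mmapC. Qed.

Lemma translateX e i :
  translate e (mvar i) = (mvar i)%:P + (mpolyC n (e ord0 i))%:P * 'X.
Proof. by rewrite /translate mmapX mmap1U. Qed.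

Lemma horner_translate e p x t :
  (map_poly (meval (x ord0)) (translate e p)).[t] = peval p (x + t *: e).
Proof.
rewrite /peval; apply: (mpoly_rmorph_eq (f := horner_eval t \o
  (map_poly (meval (x ord0)) \o translate e)) (g := meval ((x + t *: e) ord0))) => [c|i] /=.
  by rewrite translateC map_polyC /horner_eval hornerC /= !mevalC.
rewrite translateX rmorphD rmorphM /= !map_polyC /= map_polyX /horner_eval.
by rewrite hornerD hornerM !hornerC hornerX /= !mevalXU mevalC !mxE mulrC.
Qed.

Lemma translate_horner0 e p : (translate e p).[0] = p.
Proof.
apply: (mpoly_rmorph_eq (f := horner_eval 0 \o translate e) (g := idfun)) => [c|i] /=.
  by rewrite translateC /horner_eval hornerC.
by rewrite translateX /horner_eval hornerD hornerM !hornerC hornerX mulr0 addr0.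
Qed.

(** Fixing the variable t extends the translation to an automorphism, with inverse the one of [- e];
    this is why the translate of a prime is prime. *)
Definition translate_aut e : {rmorphism {poly mpoly n R} -> {poly mpoly n R}} :=
  horner_eval 'X \o map_poly (translate e).

Lemma translate_autC e p : translate_aut e p%:P = translate e p.
Proof. by rewrite /= map_polyC /horner_eval hornerC. Qed.

Lemma translate_autX e : translate_aut e 'X = 'X.
Proof. by rewrite /= map_polyX /horner_eval hornerX. Qed.

Lemma translate_autK e : cancel (translate_aut e) (translate_aut (- e)).
Proof.
have translateK p : translate_aut (- e) (translate e p) = p%:P.
  apply: (mpoly_rmorph_eq (f := translate_aut (- e) \o translate e) (g := polyC)) => [c|i].
    by change (translate_aut (- e) (translate e (mpolyC n c)) = (mpolyC n c)%:P);
      rewrite translateC translate_autC translateC.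
  change (translate_aut (- e) (translate e (mvar i)) = (mvar i)%:P); rewrite translateX.
  rewrite (rmorphD (translate_aut _)) (rmorphM (translate_aut _)) !translate_autC
    translate_autX translateC translateX mxE mpolyCN polyCN.
  by rewrite mulNr subrK.
suff : translate_aut (- e) \o translate_aut e =1 idfun by [].
apply: poly_rmorph_eq => [c|] /=.
  by rewrite -[RHS]translateK -translate_autC.
by rewrite -[RHS](translate_autX (- e)) -[in RHS](translate_autX e).
Qed.

Lemma prime_translate e p : prime_elt p -> prime_elt (translate e p).
Proof.
move=> /prime_polyC pp; rewrite -translate_autC.
apply: (iso_prime (f := translate_aut (- e))) pp; last exact: translate_autK.
by have := @translate_autK (- e); rewrite opprK.
Qed.

Lemma translate_divides e p q : divides (translate e p) (translate e q) -> divides p q.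
Proof.
move=> [c cE]; exists c.[0].
by rewrite -(translate_horner0 e q) cE hornerM translate_horner0.
Qed.

(** A prime of positive degree in t is coprime, over the fractions in x, to every polynomial that it
    does not divide. Clearing denominators in Bezout's identity leaves a nonzero [d] in x alone. *)
Lemma translate_bezout e p q : prime_elt p -> ~ divides p q ->
    (1 < size (translate e p))%N ->
  exists (a b : {poly mpoly n R}) (d : mpoly n R),
    d != 0 /\ a * translate e p + b * translate e q = d%:P.
Proof.
move=> pp npq; have [P0 Pu PP] := prime_translate e pp.
set P := translate e p in P0 Pu PP *; set Q := translate e q => szP.
have notC c : c != 0 -> ~ divides P c%:P.
  move=> c0 [k kE]; have : size (P * k) = 1%N by rewrite -kE size_polyC c0.
  by move/eqP; rewrite size_mul_eq1 => /andP[/eqP P1 _]; rewrite P1 in szP.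
have gcd1 : size (gcdp P Q) = 1%N.
  have /Pdiv.Idomain.dvdpP[[c d] /= c0 cE] := Pdiv.Idomain.dvdp_gcdl P Q.
  have /PP[[k kE]|Pg] : divides P (d * gcdp P Q).
  - by exists c%:P; rewrite -cE -mul_polyC mulrC.
  - have : k * gcdp P Q = c%:P.
      by apply: (mulfI P0); rewrite mulrA -kE -cE -mul_polyC mulrC.
    move=> /(congr1 (fun r : {poly _} => size r)); rewrite size_polyC c0 => /eqP.
    by rewrite size_mul_eq1 => /andP[_ /eqP].
  - have /Pdiv.Idomain.dvdpP[[c' d'] /= c'0 c'E] := Pdiv.Idomain.dvdp_gcdr P Q.
    have /PP[/(notC _ c'0)//|/translate_divides//] : divides P (c'%:P * Q).
    by rewrite mul_polyC c'E; exact: divides_mull.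
have [[u v] /=] := Pdiv.Idomain.Bezoutp P Q.
move=> /Pdiv.Idomain.eqpP[[c1 c2] /= /andP[c10 c20] E].
have /size_poly1P[g g0 gE] : size (gcdp P Q) == 1%N by rewrite gcd1.
exists (c1 *: u), (c1 *: v), (c2 * g); split; first by rewrite mulf_neq0.
by rewrite -!scalerAl -scalerDr E gE -mul_polyC rmorphM.
Qed.

End Translation.

Section HarmonicDivision.
Variables (R : realType) (n : nat).
Implicit Types (p q s P Q : mpoly n R) (a b x : 'rV[R]_n).

(** This is the form that survives rescaling: the intermediate value theorem puts a zero of v on
    each rescaled segment, and compactness keeps one common zero of the leading parts, rather than
    an inclusion of zero sets. *)
Definition zeros_between P Q := forall a b, peval P a < 0 -> 0 < peval P b ->
  exists2 t, 0 <= t <= 1 &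
    peval P (a + t *: (b - a)) = 0 /\ peval Q (a + t *: (b - a)) = 0.

(** The factor [s] in the conclusion keeps the zeros of [p] on a suitable line away from those of
    [s]. Then [p * s] changes sign on a subsegment where [s] has no zero, and the common zero given
    there is one of [p] and [Q], against the choice of the line. *)
Lemma prime_divides_zeros p s Q a b : prime_elt p ->
    zeros_between (p * s) Q -> peval p a < 0 -> 0 < peval p b ->
  divides p (Q * s).
Proof.
move=> pp zb pa pb; apply: contrapT => npQs; set e := b - a.
have szp : (1 < size (translate e p))%N.
  rewrite ltnNge; apply/negP => /size1_polyC sE.
  have := horner_translate e p a 0; have := horner_translate e p a 1.
  rewrite sE map_polyC !hornerC => -> /=.
  rewrite scale1r scale0r addr0 /e addrC subrK => E.
  by move: pa pb; rewrite -E; lra.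
have [al [be [d [d0 dE]]]] := translate_bezout pp npQs szp.
(* [d] depends on the direction [e] and not on the starting point, so the segment can be shifted
   slightly, parallel to itself, to start where [d] is nonzero. *)
have [y [dy py pye]] : exists y, [/\ peval d y != 0, peval p y < 0 & 0 < peval p (y + e)].
  have [e1 e10 pe1] : exists2 r, 0 < r & forall x, `|x - a| < r -> peval p x < 0.
    by apply/near_normP; exact: (cvgr_lt _ (peval_continuous (x := a)) _ pa).
  have [e2 e20 pe2] : exists2 r, 0 < r & forall x, `|x - b| < r -> 0 < peval p x.
    by apply/near_normP; exact: (cvgr_gt _ (peval_continuous (x := b)) _ pb).
  pose r := Num.min e1 e2.
  have r0 : 0 < r by rewrite lt_min e10.
  have [y [yr dy]] : exists y, `|y - a| < r /\ peval d y != 0.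
    apply: contrapT => /forallNP H; case/eqP: d0.
    apply: (peval_eq0_near (a := a) r0) => y ya.
    by have /not_andP[//|/negP/negPn/eqP] := H y.
  move: yr; rewrite lt_min => /andP[y1 y2]; exists y; split=> //; first exact: pe1.
  by apply: pe2; rewrite /e addrCA addrAC subrr add0r.
pose f := map_poly (meval (y ord0)) (translate e p).
pose h := map_poly (meval (y ord0)) (translate e s).
have fE t : f.[t] = peval p (y + t *: e) by exact: horner_translate.
have hE t : h.[t] = peval s (y + t *: e) by exact: horner_translate.
move: f h fE hE => f h fE hE.
have nocommon t : peval p (y + t *: e) = 0 -> peval (Q * s) (y + t *: e) != 0.
  move=> pt; apply: contra_neqN dy => /eqP qt.
  by apply: (bezout_common_root (t := t) dE); rewrite horner_translate.
have [|||t1 [t2 [t10 t12 t21 fh hn]]] := @poly_sign_change R f h.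
- by rewrite fE scale0r addr0.
- by rewrite fE scale1r.
- move=> t _; rewrite fE hE => /nocommon; rewrite pevalM mulf_eq0 negb_or.
  by case/andP.
have PE t : (f * h).[t] = peval (p * s) (y + t *: e).
  by rewrite hornerM fE hE pevalM.
have [t tt [Pt Qt]] : exists2 t, t1 <= t <= t2 &
    peval (p * s) (y + t *: e) = 0 /\ peval Q (y + t *: e) = 0.
  have lineE r r1 r2 : y + r1 *: e + r *: (y + r2 *: e - (y + r1 *: e))
      = y + (r1 + r * (r2 - r1)) *: e.
    by rewrite opprD addrACA subrr add0r -scalerBl scalerA scalerDl addrA.
  have [P1|P1|P1] := ltgtP (f * h).[t1] 0; last by rewrite P1 mul0r ltxx in fh.
  - have P2 : 0 < (f * h).[t2] by rewrite -(nmulr_rlt0 _ P1).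
    have [||r /andP[r0 r1]] := zb (y + t1 *: e) (y + t2 *: e); rewrite -?PE //.
    rewrite lineE => Hr; exists (t1 + r * (t2 - t1)) => //.
    by apply/andP; split; nra.
  - have P2 : (f * h).[t2] < 0 by rewrite -(pmulr_rlt0 _ P1).
    have [||r /andP[r0 r1]] := zb (y + t2 *: e) (y + t1 *: e); rewrite -?PE //.
    rewrite lineE => Hr; exists (t2 + r * (t1 - t2)) => //.
    by apply/andP; split; nra.
have := hn t tt; rewrite hE => st.
have pt : peval p (y + t *: e) = 0.
  by move: Pt => /eqP; rewrite pevalM mulf_eq0 (negPf st) orbF => /eqP.
by have := nocommon t pt; rewrite pevalM Qt mul0r eqxx.
Qed.

Lemma homog0_unit p : homog 0 p -> p != 0 -> p \is a GRing.unit.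
Proof.
move=> hp p0; have pC : p = mpolyC n (mcoeff mnm0 p).
  apply/mpolyP => m; rewrite mcoeffC.
  have [->|m0] := eqVneq m mnm0; first by rewrite mulr1.
  by rewrite hp ?mdeg_eq0 // mulr0.
rewrite pC; apply: (rmorph_unit (mpolyC n (R:=R))); rewrite unitfE.
by apply: contraNneq p0 => c0; rewrite pC c0 mpolyC0.
Qed.

Section Factor.
Variables (N : nat) (P p s : mpoly n R).
Hypotheses (hP : homog N P) (P0 : P != 0) (lP : mlaplacian P = 0).
Hypotheses (PE : P = p * s) (pp : prime_elt p).

(** The prime [p] is not a unit, so its degree is positive and every divisor of the cofactor [s] has
    degree below [N]. *)
Lemma harmonic_cofactor_orthogonal r : r != 0 -> divides r s -> Gmean (P * r) = 0.
Proof.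
move=> r0 [s' sE]; have ps0 : p * s != 0 by rewrite -PE.
have hps : homog N (p * s) by rewrite -PE.
have [k [l [hp hs NE]]] := homog_factor ps0 hps.
have s0 : s != 0 by apply: contraNneq ps0 => ->; rewrite mulr0.
have hrs : homog l (r * s') by rewrite -sE.
have rs0 : r * s' != 0 by rewrite -sE.
have [k1 [l1 [hr _ lE]]] := homog_factor rs0 hrs.
apply: (harmonic_orthogonal hP lP hr); rewrite NE.
case: k hp {NE} => [hp|k _]; last by rewrite addSn ltnS lE addnCA leq_addr.
have [p0 pu _] := pp; case/negP: pu; exact: homog0_unit.
Qed.

Lemma harmonic_factor_simple : ~ divides p s.
Proof.
move=> [s' sE]; have [p0 _ _] := pp.
have s'0 : s' != 0 by apply: contraNneq P0 => s'0; rewrite PE sE s'0 !mulr0.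
have : Gmean (P * s') = 0.
  by apply: harmonic_cofactor_orthogonal => //; exists p; rewrite sE mulrC.
rewrite PE sE (_ : p * (p * s') * s' = (p * s') ^+ 2); last by ring.
apply/eqP; rewrite gt_eqF // Gmean_gt0 ?expf_neq0 ?mulf_neq0 // => x.
by rewrite rmorphXn /= sqr_ge0.
Qed.

Lemma harmonic_factor_changes_sign :
  exists a b, peval p a < 0 /\ 0 < peval p b.
Proof.
have [p0 _ _] := pp.
have s0 : s != 0 by apply: contraNneq P0 => s0; rewrite PE s0 mulr0.
have Ps : Gmean (p * s ^+ 2) = 0.
  have -> : p * s ^+ 2 = P * s by rewrite PE; ring.
  by apply: harmonic_cofactor_orthogonal => //; exists 1; rewrite mulr1.
(* Used with c = 1 and c = -1: if [p] had constant sign, p s^2 would have nonzero mean. *)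
have key (c : R) : c != 0 -> (forall z, 0 <= c * meval z p) -> False.
  move=> c0 cp; have : 0 < Gmean (c *: (p * s ^+ 2)).
    apply: Gmean_gt0 => [x|]; last first.
      by rewrite mscalerI negb_or c0 mulf_neq0 ?expf_neq0.
    by rewrite mevalZ mevalM mulrA mulr_ge0 // rmorphXn /= sqr_ge0.
  by rewrite linearZ /= Ps mulr0 ltxx.
have pe (z : 'I_n -> R) : meval z p = peval p (\row_i z i).
  by apply: meval_eq => i; rewrite mxE.
apply: contrapT => H; have [[a pa]|/forallNP Ha] := pselect (exists a, peval p a < 0).
  apply: (key (-1)) => [|z]; first by rewrite oppr_eq0 oner_eq0.
  rewrite mulN1r oppr_ge0 pe leNgt; apply/negP => pb; apply: H.
  by exists a, (\row_i z i).
apply: (key 1) => [|z]; first exact: oner_neq0.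
by rewrite mul1r pe leNgt; apply/negP/Ha.
Qed.

End Factor.

(** The primes of [P] are divided out of [Q] one at a time, with the zero condition for the whole
    [P] at each of them. It gives that p divides Q s, and p divides neither [s] nor the product of
    the primes already removed, which is a factor of [s]. *)
Lemma harmonic_division N P Q : homog N P -> P != 0 -> mlaplacian P = 0 ->
  zeros_between P Q -> divides P Q.
Proof.
move=> hP P0 lP zb.
have [u [l [uu PE lprime]]] := factorial_mpoly P0.
suff pre l1 l2 : l = l1 ++ l2 -> divides (\prod_(p <- l1) p) Q.
  have [|c cE] := pre l [::]; first by rewrite cats0.
  by exists (u^-1 * c); rewrite PE cE mulrCA !mulrA mulVr // mul1r.
elim/last_ind: l1 l2 => [l2 _|l1 p IH l2 lE].
  by exists Q; rewrite big_nil mul1r.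
have [|Q1 Q1E] := IH (p :: l2); first by rewrite lE cat_rcons.
have pp : prime_elt p by apply: lprime; rewrite lE mem_cat mem_rcons mem_head.
pose s := u * (\prod_(q <- l1) q) * \prod_(q <- l2) q.
have PE' : P = p * s.
  rewrite PE lE big_cat /= -cats1 big_cat big_seq1 /= /s; ring.
have ps := harmonic_factor_simple hP P0 lP PE' pp.
have [a [b [pa pb]]] := harmonic_factor_changes_sign hP P0 lP PE' pp.
have pl1 : ~ divides p (\prod_(q <- l1) q).
  by move=> H; apply: ps; apply: divides_mulr; exact: divides_mull.
have zb' : zeros_between (p * s) Q by rewrite -PE'.
have [_ _ pP] := pp.
have /pP[|//] := prime_divides_zeros pp zb' pa pb.
rewrite Q1E => /pP[//|[Q2 Q2E]]; exists Q2.
by rewrite -cats1 big_cat big_seq1 /= Q2E mulrA.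
Qed.

End HarmonicDivision.

(** * Derivatives along lines *)

Section DirectionalDerivative.
Variables (R : realType) (V : normedModType R).
Implicit Types (f g : V -> R^o) (x v : V) (d e h t : R).

Lemma is_deriveP f x v d : is_derive x v f d <->
  forall e, 0 < e -> exists2 r, 0 < r & forall h, `|h| < r ->
    `|f (x + h *: v) - f x - h * d| <= e * `|h|.
Proof.
split=> [[fxv <-] e e0|fd].
  have /cvgrPdist_le/(_ _ e0) := fxv.
  move=> /(near_normP (V := R))[r r0 re]; exists r => // h hr.
  have [->|h0] := eqVneq h 0; first by rewrite scale0r addr0 subrr mul0r subrr normr0 mulr0.
  have := re h; rewrite subr0 => /(_ hr h0).
  rewrite /GRing.scale /= -/('D_v f x) [h *: v + x]addrC => H.
  have -> : f (x + h *: v) - f x - h * 'D_v f x = - (h * ('D_v f x - h^-1 * (f (x + h *: v) - f x))).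
    by field.
  by rewrite normrN normrM mulrC ler_pM2r ?normr_gt0.
have cv : (fun h => h^-1 *: ((f \o shift x) (h *: v) - f x)) @ 0^' --> (d : R^o).
  apply/cvgrPdist_le => e e0; have [r r0 H] := fd e e0.
  apply/(near_normP (V := R)); exists r => // h; rewrite subr0 => hr /= h0.
  have := H h hr; rewrite /GRing.scale /= [h *: v + x]addrC => {}H.
  have -> : d - h^-1 * (f (x + h *: v) - f x) = - (h^-1 * (f (x + h *: v) - f x - h * d)).
    by field.
  by rewrite normrN normrM normfV ler_pdivrMl ?normr_gt0 // [_ * e]mulrC.
by apply: DeriveDef; [apply/cvg_ex; exists d | exact: cvg_lim cv].
Qed.

Lemma is_derive_near_ext f g x v d r : 0 < r ->
    (forall h, `|h| < r -> f (x + h *: v) = g (x + h *: v)) ->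
  is_derive x v f d -> is_derive x v g d.
Proof.
move=> r0 fg /is_deriveP fd; apply/is_deriveP => e /fd[s s0 sH].
exists (Num.min r s); first by rewrite lt_min r0.
move=> h; rewrite lt_min => /andP[hr hs]; rewrite -fg //.
have -> : g x = f x by have := fg 0; rewrite scale0r addr0 normr0 => ->.
exact: sH.
Qed.

End DirectionalDerivative.

Lemma is_derive_line (R : realType) (V : normedModType R) (f : V -> R^o)
    (x v : V) (t d : R) : is_derive (x + t *: v) v f d <->
  is_derive t (1 : R) (fun s : R => f (x + s *: v) : R^o) d.
Proof.
suff E (h : R) : x + t *: v + h *: v = x + (t + h *: (1 : R)) *: v.
  split=> [/is_deriveP H|/is_deriveP H]; apply/is_deriveP => e /H[r r0 rH];
    by exists r => // h /rH; rewrite E.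
by rewrite -addrA -scalerDl /GRing.scale /= mulr1.
Qed.

Section RealLine.
Variable R : realType.
Implicit Types (f g df : R -> R) (a b c t : R).

Lemma mvt_abs f df a C : 0 <= a ->
    (forall t, 0 <= t <= a -> is_derive t 1 f (df t)) ->
    (forall t, 0 <= t <= a -> `|df t| <= C) -> `|f a - f 0| <= C * a.
Proof.
move=> a0 fd dC; have [||] := MVT_segment a0 (df := df) (f := f).
- by move=> t; rewrite in_itv /= => /andP[t0 ta]; apply: fd; rewrite !ltW.
- apply: derivable_within_continuous => t; rewrite in_itv /= => /fd.
  by case.
move=> c; rewrite in_itv /= => /dC dcC ->.
by rewrite subr0 normrM (ger0_norm a0) ler_wpM2r.
Qed.

Lemma second_derivative_max f df d2 r : 0 < r ->
    (forall t, `|t| < r -> is_derive t 1 f (df t)) -> is_derive (0 : R) 1 df d2 ->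
    (forall t, `|t| < r -> f t <= f 0) -> d2 <= 0.
Proof.
move=> r0 fd dfd fmax; rewrite leNgt; apply/negP => d20.
have df0 : df 0 = 0.
  have [_ <-] : is_derive (0 : R) 1 f (df 0) by apply: fd; rewrite normr0.
  have [||||_ ->//] := @derive1_at_max R f (- r) r 0.
  - by lra.
  - by move=> t; rewrite in_itv /= => tr; have [] : is_derive t 1 f (df t) by apply: fd; rewrite ltr_norml.
  - by rewrite in_itv /=; apply/andP; split; lra.
  - by move=> t; rewrite in_itv /= => tr; apply: fmax; rewrite ltr_norml.
have /is_deriveP/(_ (d2 / 2))[|s s0 sH] := dfd; first by lra.
pose a := Num.min (r / 2) (s / 2).
have a0 : 0 < a by rewrite lt_min; apply/andP; split; lra.
have ar : a <= r / 2 by rewrite ge_min lexx.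
have as_ : a <= s / 2 by rewrite ge_min lexx orbT.
have [||c] := MVT a0 (df := df) (f := f).
- by move=> t; rewrite in_itv /= => /andP[t0 ta]; apply: fd; rewrite ltr_norml; apply/andP; split; lra.
- apply: derivable_within_continuous => t; rewrite in_itv /= => /andP[t0 ta].
  by have [] : is_derive t 1 f (df t) by apply: fd; rewrite ltr_norml; apply/andP; split; lra.
rewrite in_itv /= => /andP[c0 ca] E.
have fa : f a <= f 0 by apply: fmax; rewrite ltr_norml; apply/andP; split; lra.
have := sH c; rewrite df0 /GRing.scale /= mulr1 add0r subr0 (ger0_norm (ltW c0)).
move=> /(_ _) H; have {}H : `|df c - c * d2| <= d2 / 2 * c by apply: H; lra.
have dc : 0 < df c.
  by move: H; rewrite ler_norml => /andP[H _]; nra.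
by nra.
Qed.

Lemma derivative_le f d C r : 0 < r -> f 0 = 0 -> is_derive (0 : R) 1 f d ->
  (forall t, 0 <= t <= r -> f t <= C * t) -> d <= C.
Proof.
move=> r0 f0 fd fC; apply/ler_addgt0Pr => e e0.
have /is_deriveP/(_ e e0)[s s0 sH] := fd.
pose a := Num.min (r / 2) (s / 2).
have a0 : 0 < a by rewrite lt_min; apply/andP; split; lra.
have ar : a <= r / 2 by rewrite ge_min lexx.
have as_ : a <= s / 2 by rewrite ge_min lexx orbT.
have := sH a; rewrite f0 /GRing.scale /= mulr1 add0r subr0 (ger0_norm (ltW a0)).
move=> H; have {}H : `|f a - a * d| <= e * a by apply: H; lra.
have fa : f a <= C * a by apply: fC; apply/andP; split; lra.
by move: H; rewrite ler_norml => /andP[H _]; nra.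
Qed.

(** No continuity of the second derivative is asked: a maximum at 0 already forces its sign. *)
Definition has2 f c := exists df r, [/\ 0 < r,
  forall t, `|t| < r -> is_derive t 1 f (df t) & is_derive (0 : R) 1 df c].

Lemma has2D f g c d : has2 f c -> has2 g d -> has2 (fun t => f t + g t) (c + d).
Proof.
move=> [df [r [r0 fd dfd]]] [dg [s [s0 gd dgd]]].
exists (fun t => df t + dg t), (Num.min r s); split.
- by rewrite lt_min r0.
- by move=> t; rewrite lt_min => /andP[/fd ? /gd ?]; exact: is_deriveD.
- exact: is_deriveD.
Qed.

Lemma has2Z f c k : has2 f c -> has2 (fun t => k * f t) (k * c).
Proof.
move=> [df [r [r0 fd dfd]]]; exists (fun t => k * df t), r; split=> //.
- by move=> t /fd ?; exact: is_deriveZ.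
- exact: is_deriveZ.
Qed.

Lemma has2_opp f c : has2 f c -> has2 (fun t => f (- t)) c.
Proof.
move=> [df [r [r0 fd dfd]]]; exists (fun t => - df (- t)), r; split=> //.
- move=> t; rewrite -normrN => /fd ?.
  have H := @is_derive1_comp R f (fun t => - t) t (df (- t)) (-1).
  by apply: is_derive_eq; rewrite /GRing.scale /=; ring.
- have dfd' : is_derive (- 0 : R) 1 df c by rewrite oppr0.
  have H := @is_derive1_comp R df (fun t => - t) 0 c (-1).
  by apply: is_derive_eq; rewrite /GRing.scale /=; ring.
Qed.

Lemma has2_quad a b c : has2 (fun t => a + b * t + c * t ^+ 2) (2 * c).
Proof.
exists (fun t => b + 2 * c * t), 1; split; first exact: ltr01.
- by move=> t _; apply: is_derive_eq; rewrite /GRing.scale /=; ring.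
- by apply: is_derive_eq; rewrite /GRing.scale /=; ring.
Qed.

End RealLine.

(** * The maximum principle *)

Section MaximumPrinciple.
Variables (R : realType) (n : nat).
Implicit Types (x a : 'rV[R]_n) (lo hi : 'I_n -> R) (F : 'rV[R]_n -> R).

Definition box lo hi : set 'rV[R]_n :=
  [set x | forall i, `[lo i, hi i] (x ord0 i)].

Lemma box_compact lo hi : compact (box lo hi).
Proof.
apply: (@rV_compact R n (fun i => `[lo i, hi i])) => i.
exact: segment_compact.
Qed.

Lemma line_coord x i k (t : R) :
  (x + t *: basis_vec i) ord0 k = x ord0 k + t * (k == i)%:R.
Proof. by rewrite !mxE eqxx. Qed.

Lemma sumsq_line x a i (t : R) :
  \sum_k ((x + t *: basis_vec i) ord0 k - a ord0 k) ^+ 2 =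
  \sum_k (x ord0 k - a ord0 k) ^+ 2 + 2 * (x ord0 i - a ord0 i) * t + t ^+ 2.
Proof.
rewrite (bigD1 i) //= [in RHS](bigD1 i) //= line_coord eqxx mulr1.
rewrite (eq_bigr (fun k => (x ord0 k - a ord0 k) ^+ 2)); first by ring.
by move=> k ki; rewrite line_coord (negPf ki) mulr0 addr0.
Qed.

Lemma fun_continuous_sum (I : Type) (s : seq I) (f : I -> 'rV[R]_n -> R) :
  (forall i, continuous (f i)) -> continuous (fun x => \sum_(i <- s) f i x).
Proof.
move=> cf; elim: s => [|i s IH].
  under eq_fun do rewrite big_nil; exact: cst_continuous.
under eq_fun do rewrite big_cons; exact: fun_continuousD.
Qed.

Lemma sumsq_continuous a : continuous (fun x => \sum_k (x ord0 k - a ord0 k) ^+ 2).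
Proof.
apply: fun_continuous_sum => k; under eq_fun do rewrite expr2.
have c : continuous (fun x : 'rV[R]_n => x ord0 k - a ord0 k).
  apply: fun_continuousD; [exact: coord_continuous | exact: cst_continuous].
exact: fun_continuousM.
Qed.

Lemma at_continuousD (f g : 'rV[R]_n -> R) x : {for x, continuous f} ->
  {for x, continuous g} -> {for x, continuous (fun y => f y + g y)}.
Proof. by move=> cf cg; exact: (cvgD cf cg). Qed.

Lemma at_continuousZ (c : R) (f : 'rV[R]_n -> R) x :
  {for x, continuous f} -> {for x, continuous (fun y => c * f y)}.
Proof. by move=> cf; exact: (cvgM (cvg_cst c) cf). Qed.

(** Adding a small multiple of |x|^2 - C, which is nonpositive on the box, makes the sum of the
    second derivatives strictly positive, whereas at an interior maximum each of them is
    nonpositive. *)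
Lemma max_principle lo hi F : (0 < n)%N ->
    (forall x, box lo hi x -> {for x, continuous F}) ->
    (forall x, (forall i, lo i < x ord0 i < hi i) ->
      exists D : 'I_n -> R, 0 <= \sum_i D i /\
        forall i, has2 (fun t => F (x + t *: basis_vec i)) (D i)) ->
    (forall x i, box lo hi x -> x ord0 i = lo i \/ x ord0 i = hi i -> F x <= 0) ->
  forall x, box lo hi x -> F x <= 0.
Proof.
move=> n0 cF hF bF x0 bx0; rewrite leNgt; apply/negP => Fx0.
pose S x := \sum_k (x ord0 k - (0 : 'rV[R]_n) ord0 k) ^+ 2.
have S0 x : 0 <= S x by apply: sumr_ge0 => k _; exact: sqr_ge0.
have cS : continuous S by exact: sumsq_continuous.
have box0 : box lo hi !=set0 by exists x0.
have [C C0 CP] : exists2 C, 0 <= C & forall x, box lo hi x -> S x <= C.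
  have [c _ cmax] := compact_EVT_max box0 (@box_compact lo hi) (continuous_subspaceT cS).
  by exists (S c) => // x bx; apply: cmax; rewrite inE.
(* Since e (C + 1) is half of [F x0], the perturbed function stays positive at [x0]. *)
pose e := F x0 / (2 * (C + 1)).
have e0 : 0 < e by rewrite divr_gt0 //; lra.
pose W x := F x + e * (S x - C).
have cW : {within box lo hi, continuous W}.
  apply: continuous_in_subspaceT => x; rewrite inE => bx.
  apply: at_continuousD; first exact: cF.
  apply: (at_continuousZ (f := fun x => S x - C)).
  by apply: (at_continuousD (g := fun=> - C)); [exact: cS | exact: cst_continuous].
have [c] := compact_EVT_max box0 (@box_compact lo hi) cW.
rewrite inE => bc cmax.
have Wc : 0 < W c.
  apply: (@lt_le_trans _ _ (W x0)); last by apply: cmax; rewrite inE.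
  rewrite /W; have : e * (C + 1) = F x0 / 2 by rewrite /e; field; lra.
  by have := S0 x0; nra.
have bdF i : c ord0 i = lo i \/ c ord0 i = hi i -> False.
  move=> /(bF _ _ bc) Fc; have := CP _ bc; move: Wc; rewrite /W; nra.
have ic i : lo i < c ord0 i < hi i.
  have /= := bc i; rewrite in_itv /= => /andP[l h].
  rewrite !lt_neqAle l h !andbT.
  by apply/andP; split; apply/eqP => E; apply: (bdF i); [left|right].
have [D [D0 HD]] := hF c ic.
suff : \sum_i D i <= \sum_(i < n) (- (2 * e)).
  rewrite sumr_const card_ord -mulr_natl; have : (0 : R) < n%:R by rewrite ltr0n.
  by nra.
apply: ler_sum => i _.
suff : D i + 2 * e <= 0 by lra.
pose q t := e * (S c - C) + (2 * e * c ord0 i) * t + e * t ^+ 2.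
have [df [r [r0 fd dfd]]] := has2D (HD i) (has2_quad (e * (S c - C)) (2 * e * c ord0 i) e).
have qE t : W (c + t *: basis_vec i) = F (c + t *: basis_vec i) + q t.
  by rewrite /W /S /q sumsq_line mxE /S; ring.
pose s := Num.min r (Num.min (c ord0 i - lo i) (hi i - c ord0 i)).
have /andP[li hi'] := ic i.
have s0 : 0 < s by rewrite !lt_min r0 /= !subr_gt0 li.
apply: (second_derivative_max s0 _ dfd).
  by move=> t; rewrite lt_min => /andP[+ _]; exact: fd.
move=> t; rewrite !lt_min => /and3P[_ t1 t2].
rewrite -/(q t) -/(q 0) -!qE scale0r addr0; apply: cmax; rewrite inE => k /=.
rewrite line_coord in_itv /=; have [->|ki] := eqVneq k i.
  by move: t1 t2; rewrite !ltr_norml mulr1 => /andP[? ?] /andP[? ?]; apply/andP; split; lra.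
by rewrite mulr0 addr0; have /= := bc k; rewrite in_itv.
Qed.

End MaximumPrinciple.

(** * Interior estimates for harmonic functions *)

Section Harmonic.
Variables (R : realType) (n : nat).
Implicit Types (x a z : 'rV[R]_n) (U : set 'rV[R]_n).
Implicit Types (f : 'rV[R]_n -> R) (g : 'I_n -> 'rV[R]_n -> R).
Implicit Types (h : 'I_n -> 'I_n -> 'rV[R]_n -> R) (d M c t r : R).

(* g i and h i j are the partial derivatives of f and of g i. *)
Record harm2 U f g h : Prop := Harm2 {
  harm_cont : forall x, U x -> {for x, continuous f};
  harm_contg : forall i x, U x -> {for x, continuous (g i)};
  harm_conth : forall i j x, U x -> {for x, continuous (h i j)};
  harm_der : forall i x, U x -> is_derive x (basis_vec i) (f : _ -> R^o) (g i x);
  harm_der2 : forall i j x, U x ->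
    is_derive x (basis_vec j) (g i : _ -> R^o) (h i j x);
  harm_lap : forall x, U x -> \sum_i h i i x = 0 }.

Lemma harm2_sub U U' f g h : U' `<=` U -> harm2 U f g h -> harm2 U' f g h.
Proof.
by move=> UU [cf cg ch df dg lf]; split=> *; auto.
Qed.

Lemma is_derive_scale f x v d c : is_derive x v (f : _ -> R^o) d ->
  is_derive x v ((fun y => c * f y) : _ -> R^o) (c * d).
Proof. by move=> H; exact: is_deriveZ. Qed.

Lemma is_derive_add f f' x v d d' : is_derive x v (f : _ -> R^o) d ->
  is_derive x v (f' : _ -> R^o) d' ->
  is_derive x v ((fun y => f y + f' y) : _ -> R^o) (d + d').
Proof. by move=> H H'; exact: is_deriveD. Qed.

Lemma harm2Z U f g h (c : R) : harm2 U f g h ->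
  harm2 U (fun x => c * f x) (fun i x => c * g i x) (fun i j x => c * h i j x).
Proof.
move=> [cf cg ch df dg lf]; split=> *.
- exact/at_continuousZ/cf.
- exact/at_continuousZ/cg.
- exact/at_continuousZ/ch.
- by apply: is_derive_scale; auto.
- by apply: is_derive_scale; auto.
- by rewrite -mulr_sumr lf // mulr0.
Qed.

Lemma harm2D U f g h f' g' h' : harm2 U f g h -> harm2 U f' g' h' ->
  harm2 U (fun x => f x + f' x) (fun i x => g i x + g' i x)
    (fun i j x => h i j x + h' i j x).
Proof.
move=> [cf cg ch df dg lf] [cf' cg' ch' df' dg' lf']; split=> *.
- by apply: at_continuousD; auto.
- by apply: at_continuousD; auto.
- by apply: at_continuousD; auto.
- by apply: is_derive_add; auto.
- by apply: is_derive_add; auto.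
- by rewrite big_split /= lf // lf' // addr0.
Qed.

Lemma is_derive_translate f z x v d : is_derive (x + z) v (f : _ -> R^o) d ->
  is_derive x v ((fun y => f (y + z)) : _ -> R^o) d.
Proof.
move=> /is_deriveP H; apply/is_deriveP => e /H[r r0 rH]; exists r => // t /rH.
by rewrite (addrAC x).
Qed.

Lemma at_continuous_translate f z x : {for x + z, continuous f} ->
  {for x, continuous (fun y : 'rV[R]_n => f (y + z))}.
Proof.
move=> cf; have ct : {for x, continuous (fun y : 'rV[R]_n => y + z)}.
  by apply: continuousD; [exact: cvg_id | exact: cst_continuous].
exact: (continuous_comp ct cf).
Qed.

Lemma harm2_translate U f g h z : harm2 U f g h ->
  harm2 [set x | U (x + z)] (fun x => f (x + z)) (fun i x => g i (x + z))
    (fun i j x => h i j (x + z)).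
Proof.
move=> H; split=> [x|i x|i j x|i x|i j x|x] /= Ux.
- exact: (at_continuous_translate (harm_cont H Ux)).
- exact: (@at_continuous_translate (g i) z x (harm_contg H Ux)).
- exact: (@at_continuous_translate (h i j) z x (harm_conth H Ux)).
- by apply: (@is_derive_translate f); exact: (harm_der H).
- by apply: (@is_derive_translate (g i)); exact: (harm_der2 H).
- exact: (harm_lap H Ux).
Qed.

Lemma open_line U x v : open U -> U x ->
  exists2 r : R, 0 < r & forall t, `|t| < r -> U (x + t *: v).
Proof.
move=> oU Ux; have /near_normP[r r0 rU] : \forall y \near x, U y by exact: open_nbhs_nbhs.
have v1 : 0 < `|v| + 1 by rewrite ltr_wpDl.
exists (r / (`|v| + 1)); first by rewrite divr_gt0.
move=> t tr; apply: rU; rewrite addrAC subrr add0r normrZ.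
move: tr; rewrite ltr_pdivlMr // => tr; apply: le_lt_trans tr.
by rewrite ler_wpM2l // lerDl.
Qed.

Lemma harm2_has2 U f g h x i : open U -> harm2 U f g h -> U x ->
  has2 (fun t => f (x + t *: basis_vec i)) (h i i x).
Proof.
move=> oU H Ux; have [r r0 rU] := open_line (basis_vec i) oU Ux.
exists (fun t => g i (x + t *: basis_vec i)), r; split=> //.
  by move=> t /rU Ut; apply/(@is_derive_line R _ f); exact: (harm_der H).
apply/(@is_derive_line R _ (g i)); rewrite scale0r addr0; exact: (harm_der2 H).
Qed.

Lemma box_norm lo hi a d : 0 <= d -> (forall i, a ord0 i - d <= lo i) ->
  (forall i, hi i <= a ord0 i + d) -> forall x, box lo hi x -> `|x - a| <= d.
Proof.
move=> d0 lod hid x bx; apply: rV_norm_le => // i; rewrite !mxE ler_norml.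
have /= := bx i; rewrite in_itv /= => /andP[l l'].
by have := lod i; have := hid i => ? ?; apply/andP; split; lra.
Qed.

(* Comparison with the harmonic quadratic
   (M/d^2)(|x - a|^2 - n y^2 + n d y), y = x_i - a_i, on the half cube y >= 0. *)
Lemma gradient_estimate_le U f g h a d M i : open U -> harm2 U f g h ->
    0 < d -> 0 <= M -> (forall x, `|x - a| <= d -> U x) ->
    (forall x, `|x - a| <= d -> `|f x| <= M) ->
  g i a <= n%:R * M / d.
Proof.
move=> oU H d0 M0 dU fM; have n0 : (0 < n)%N by case: (n) i => [[]|].
have n1 : (1 : R) <= n%:R by rewrite ler1n.
pose y x := x ord0 i - a ord0 i.
(* Reflection in the hyperplane y = 0. Half the difference of f and its reflection is harmonic,
   vanishes on that hyperplane, is bounded by [M], and has the same i-th derivative at [a] as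
   [f]. *)
pose rho x := x - (2 * y x) *: basis_vec i.
pose S x := \sum_k (x ord0 k - a ord0 k) ^+ 2.
pose c := M / d ^+ 2.
have c0 : 0 <= c by rewrite divr_ge0 // sqr_ge0.
have cd : c * d ^+ 2 = M by rewrite /c divfK // expf_neq0 // gt_eqF.
pose psi x := S x - n%:R * y x ^+ 2 + n%:R * d * y x.
pose F x := 2^-1 * f x + (- 2^-1) * f (rho x) + (- c) * psi x.
pose lo k := if k == i then a ord0 i else a ord0 k - d.
pose hi k := a ord0 k + d.
have boxd x : box lo hi x -> `|x - a| <= d.
  apply: box_norm => // [|k]; first exact: ltW.
  by rewrite /lo; case: eqP => [->|_]; rewrite ?gerBl ?lexx ?ltW.
have rhoE x k : rho x ord0 k = if k == i then 2 * a ord0 i - x ord0 i else x ord0 k.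
  rewrite /rho -scaleNr line_coord /y; case: eqP => [->|_]; rewrite ?mulr1 ?mulr0 ?addr0 //.
  by ring.
have rhod x : `|x - a| <= d -> `|rho x - a| <= d.
  move=> xd; apply: rV_norm_le => [|k]; first exact: ltW.
  have H1 k' : `|x ord0 k' - a ord0 k'| <= d.
    by apply: le_trans xd; have := coord_norm_le (x - a) k'; rewrite !mxE.
  have -> : (rho x - a) ord0 k = rho x ord0 k - a ord0 k by rewrite mxE [(- a) _ _]mxE.
  rewrite rhoE; case: eqP => [->|_]; last exact: H1.
  have -> : 2 * a ord0 i - x ord0 i - a ord0 i = - (x ord0 i - a ord0 i) by ring.
  by rewrite normrN.
have S0 x : 0 <= S x by apply: sumr_ge0 => k _; exact: sqr_ge0.
have Sk x k : (x ord0 k - a ord0 k) ^+ 2 <= S x.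
  rewrite /S (bigD1 k) //= lerDl; apply: sumr_ge0 => j _; exact: sqr_ge0.
have cy : continuous y.
  by apply: fun_continuousD; [exact: coord_continuous | exact: cst_continuous].
have crho : continuous rho.
  move=> x; have cz : {for x, continuous (fun z => (2 * y z) *: basis_vec i)}.
    have c2 := at_continuousZ (c := 2) (cy x).
    have H1 := scalel_continuous (V := 'rV[R]_n) (x := basis_vec i).
    exact: (continuous_comp c2 (H1 _)).
  have ci : {for x, continuous (id : 'rV[R]_n -> _)} by exact: cvg_id.
  exact: (continuousB ci cz).
have cpsi : continuous psi.
  have -> : psi = fun x => S x + (- n%:R * (y x * y x) + n%:R * d * y x).
    by apply/funext => x; rewrite /psi; ring.
  apply: fun_continuousD; first exact: sumsq_continuous.
  apply: fun_continuousD; apply: fun_continuousM; try exact: cst_continuous; last exact: cy.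
  exact: fun_continuousM.
have hic x : (forall k, lo k < x ord0 k < hi k) -> box lo hi x.
  by move=> bx k /=; rewrite in_itv /=; have /andP[? ?] := bx k; rewrite !ltW.
have rho_line x j t : rho (x + t *: basis_vec j) =
    rho x + (if j == i then - t else t) *: basis_vec j.
  apply/rowP => k; rewrite rhoE !line_coord rhoE.
  have [->|ki] := eqVneq k i.
    by rewrite eq_sym; case: eqVneq => _; rewrite ?mulr1 ?mulr0; ring.
  have [kj|kj] := eqVneq k j; last by rewrite !mulr0.
  by rewrite -kj (negPf ki).
have Fle0 : forall x, box lo hi x -> F x <= 0.
  apply: max_principle => //.
  - move=> x bx; apply: at_continuousD; last exact/at_continuousZ/cpsi.
    apply: at_continuousD; apply: at_continuousZ.
      by apply: (harm_cont H); apply/dU/boxd.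
    apply: (continuous_comp (crho x)); apply: (harm_cont H).
    exact/dU/rhod/boxd.
  - move=> x /hic bx.
    have Ux : U x by apply/dU/boxd.
    have Urx : U (rho x) by apply/dU/rhod/boxd.
    exists (fun j => 2^-1 * h j j x + (- 2^-1) * h j j (rho x)
      + (- c) * (2 * (1 - n%:R * (j == i)%:R))); split.
      rewrite !big_split /= -!mulr_sumr (harm_lap H Ux) (harm_lap H Urx) !mulr0 !add0r.
      rewrite sumrB sumr_const card_ord -mulr_sumr (bigD1 i) //= eqxx big1.
        by rewrite addr0 mulr1 subrr !mulr0.
      by move=> j /negPf ->.
    move=> j; apply: has2D; first apply: has2D.
    + exact/has2Z/(harm2_has2 _ oU H).
    + apply: has2Z; under eq_fun do rewrite rho_line.
      case: eqP => [ji|_]; last exact: (harm2_has2 _ oU H).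
      exact: (has2_opp (f := fun t => f (rho x + t *: basis_vec j)) (harm2_has2 _ oU H Urx)).
    + apply: has2Z.
      pose b : R := (j == i)%:R.
      have -> : (fun t => psi (x + t *: basis_vec j)) = fun t =>
          psi x + (2 * (x ord0 j - a ord0 j) - 2 * n%:R * y x * b + n%:R * d * b) * t
            + (1 - n%:R * b) * t ^+ 2.
        apply/funext => t; rewrite /psi /S sumsq_line.
        have -> : y (x + t *: basis_vec j) = y x + t * b.
          by rewrite /y line_coord eq_sym /b; ring.
        have b2 : b ^+ 2 = b by rewrite /b; case: eqP => _; rewrite ?expr1n ?expr0n.
        have -> : 1 - n%:R * b = 1 - n%:R * b ^+ 2 by rewrite b2.
        by ring.
      exact: has2_quad.
  - move=> x k bx xk; rewrite /F.
    have xd := boxd x bx; have fx := fM x xd; have frx := fM _ (rhod _ xd).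
    have /= := bx i; rewrite in_itv /= /lo /hi eqxx => /andP[y0 yd].
    have {}y0 : 0 <= y x by rewrite /y subr_ge0.
    have {}yd : y x <= d by rewrite /y lerBlDl.
    (* On the half cube n y (d - y) is nonnegative, so psi is at least |x - a|^2, and c psi reaches
       [M] on every face other than y = 0. *)
    have ypsi : S x <= psi x.
      rewrite /psi -addrA lerDl; have : 0 <= n%:R * (y x * (d - y x)).
        by rewrite mulr_ge0 ?ler0n // mulr_ge0 // subr_ge0.
      by nra.
    have side : d ^+ 2 <= S x -> 2^-1 * f x - 2^-1 * f (rho x) - c * psi x <= 0.
      move=> dS; have : c * d ^+ 2 <= c * psi x.
        by rewrite ler_wpM2l // (le_trans dS).
      by rewrite cd; move: fx frx; rewrite !ler_norml => /andP[? ?] /andP[? ?]; lra.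
    have [ki|ki] := eqVneq k i; last first.
      rewrite mulNr mulNr; apply: side; apply: le_trans (Sk x k).
      case: xk; rewrite /lo /hi ?(negPf ki) => ->.
        by rewrite (_ : _ - _ = - d) ?sqrrN //; ring.
      by rewrite (_ : _ - _ = d) //; ring.
    case: xk; rewrite /lo /hi ki ?eqxx => xi.
      have yx0 : y x = 0 by rewrite /y xi subrr.
      have -> : rho x = x by rewrite /rho yx0 mulr0 scale0r subr0.
      have : 0 <= c * psi x by rewrite mulr_ge0 // (le_trans (S0 x)).
      by lra.
    rewrite mulNr mulNr; apply: side; apply: le_trans (Sk x i).
    by rewrite xi (_ : _ - _ = d) //; ring.
(* Along the i-th axis psi is (1 - n) t^2 + n d t, at most n d t; comparing slopes at t = 0 gives
   the bound c n d, which is n M / d. *)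
apply: (@derivative_le _ (fun t => 2^-1 * f (a + t *: basis_vec i)
    - 2^-1 * f (a - t *: basis_vec i)) _ _ d) => //.
- by rewrite scale0r addr0 subr0 subrr.
- have fd : is_derive (0 : R) 1 (fun t : R => f (a + t *: basis_vec i)) (g i a).
    apply/(@is_derive_line R _ f); rewrite scale0r addr0; apply: (harm_der H).
    by apply: dU; rewrite subrr normr0 ltW.
  have fd' : is_derive (- (0 : R)) 1 (fun t : R => f (a + t *: basis_vec i)) (g i a).
    by rewrite oppr0.
  have E : (fun t => f (a - t *: basis_vec i)) = (fun t : R => f (a + t *: basis_vec i)) \o -%R.
    by apply/funext => t /=; rewrite scaleNr.
  have gd : is_derive (0 : R) 1 (fun t : R => f (a - t *: basis_vec i)) (- g i a).
    rewrite E; have K := @is_derive1_comp R _ -%R 0 _ _ fd' (is_deriveN _).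
    by apply: is_derive_eq; rewrite /GRing.scale /=; ring.
  by apply: is_derive_eq; rewrite /GRing.scale /=; field.
move=> t /andP[t0 td]; have := Fle0 (a + t *: basis_vec i).
have yt : y (a + t *: basis_vec i) = t by rewrite /y line_coord eqxx mulr1; ring.
have -> : F (a + t *: basis_vec i) = 2^-1 * f (a + t *: basis_vec i)
    - 2^-1 * f (a - t *: basis_vec i) - c * (t ^+ 2 - n%:R * t ^+ 2 + n%:R * d * t).
  rewrite /F /psi yt /rho yt /S sumsq_line big1 => [|k _]; last by rewrite subrr expr0n.
  rewrite subrr mulr0 mul0r !add0r.
  have -> : a + t *: basis_vec i - (2 * t) *: basis_vec i = a - t *: basis_vec i.
    by rewrite -addrA -scalerBl (_ : t - 2 * t = - t) ?scaleNr //; ring.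
  by ring.
have bt : box lo hi (a + t *: basis_vec i).
  move=> k /=; rewrite line_coord in_itv /lo /hi /=; case: eqP => [->|_].
    by rewrite mulr1 lerDl t0 lerD2l.
  by rewrite mulr0 addr0 gerBl lerDl !ltW.
move=> /(_ bt); rewrite subr_le0 => /le_trans; apply.
have -> : n%:R * M / d * t = c * (n%:R * d * t).
  by rewrite -cd; field; rewrite gt_eqF.
rewrite ler_wpM2l // gerDr; nra.
Qed.

End Harmonic.

Section HarmonicEstimates.
Variables (R : realType) (n : nat).
Implicit Types (x a z v : 'rV[R]_n) (U : set 'rV[R]_n).
Implicit Types (f : 'rV[R]_n -> R) (g : 'I_n -> 'rV[R]_n -> R).
Implicit Types (h : 'I_n -> 'I_n -> 'rV[R]_n -> R) (d M c t r e : R).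

Lemma gradient_estimate U f g h a d M i : open U -> harm2 U f g h ->
    0 < d -> 0 <= M -> (forall x, `|x - a| <= d -> U x) ->
    (forall x, `|x - a| <= d -> `|f x| <= M) ->
  `|g i a| <= n%:R * M / d.
Proof.
move=> oU H d0 M0 dU fM; rewrite ler_norml.
have := gradient_estimate_le i oU H d0 M0 dU fM.
have := gradient_estimate_le i oU (harm2Z (-1) H) d0 M0 dU.
rewrite mulN1r => H1 H2; rewrite H2 andbT lerNl; apply: H1 => x /fM.
by rewrite mulN1r normrN.
Qed.

Lemma derivative_abs_le f x v d c r : 0 < r ->
    is_derive x v (f : _ -> R^o) d ->
    (forall t, 0 < t < r -> `|f (x + t *: v) - f x| <= c * t) -> `|d| <= c.
Proof.
move=> r0 /is_deriveP fd fc; apply/ler_addgt0Pr => e /fd[s s0 sH].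
pose t := Num.min (r / 2) (s / 2).
have t0 : 0 < t by rewrite lt_min; apply/andP; split; lra.
have tr : t <= r / 2 by rewrite ge_min lexx.
have ts : t <= s / 2 by rewrite ge_min lexx orbT.
have := sH t; rewrite (gtr0_norm t0) => H1.
have {}H1 : `|f (x + t *: v) - f x - t * d| <= e * t by apply: H1; lra.
have {}fc : `|f (x + t *: v) - f x| <= c * t by apply: fc; rewrite t0; lra.
rewrite -(ler_pM2r t0) mulrDl -{1}(gtr0_norm t0) -normrM mulrC.
have -> : t * d = (f (x + t *: v) - f x) - (f (x + t *: v) - f x - t * d) by ring.
by rewrite (le_trans (ler_normB _ _)) // lerD.
Qed.

Lemma segment_ball a x v r t s : `|x - a| <= r -> 0 <= t -> t * `|v| <= s ->
  `|x + t *: v - a| <= r + s.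
Proof.
move=> xr t0 ts; rewrite addrAC (le_trans (ler_normD _ _)) // lerD // normrZ.
by rewrite ger0_norm.
Qed.

Lemma basis_vec_norm (i : 'I_n) : `|basis_vec i : 'rV[R]_n| <= 1.
Proof.
apply: rV_norm_le => // k; rewrite mxE eqxx /=.
by case: eqP; rewrite ?normr1 ?normr0.
Qed.

Lemma increment_le f g x t c i : 0 <= t ->
    (forall s, 0 <= s <= t ->
      is_derive (x + s *: basis_vec i) (basis_vec i) (f : _ -> R^o) (g i (x + s *: basis_vec i))) ->
    (forall s, 0 <= s <= t -> `|g i (x + s *: basis_vec i)| <= c) ->
  `|f (x + t *: basis_vec i) - f x| <= c * t.
Proof.
move=> t0 fd gc; have := @mvt_abs R (fun s => f (x + s *: basis_vec i))
  (fun s => g i (x + s *: basis_vec i)) t c t0 _ gc.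
rewrite scale0r addr0; apply=> s st.
by apply/(@is_derive_line R _ f); exact: fd.
Qed.

Lemma open_translate U z : open U -> open [set x | U (x + z)].
Proof.
move=> oU; apply: (@open_comp _ _ (fun x : 'rV[R]_n => x + z) U) => // x _.
have ci : {for x, continuous (id : 'rV[R]_n -> _)} by exact: cvg_id.
exact: (continuousD ci (cst_continuous (x := z) (x0 := x))).
Qed.

Lemma harm2_difference U f g h z c : harm2 U f g h ->
  harm2 (U `&` [set x | U (x + z)]) (fun x => c * (f (x + z) - f x))
    (fun i x => c * (g i (x + z) - g i x))
    (fun i j x => c * (h i j (x + z) - h i j x)).
Proof.
move=> H; apply: harm2Z; have H1 := harm2Z (-1) (harm2_sub (@subIsetl _ _ [set x | U (x + z)]) H).
have H2 := harm2_sub (@subIsetr _ U _) (harm2_translate z H).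
have := harm2D H2 H1; congr (harm2 _ _ _ _).
- by apply/funext => x; rewrite mulN1r.
- by apply/funext => i; apply/funext => x; rewrite mulN1r.
- by apply/funext => i; apply/funext => j; apply/funext => x; rewrite mulN1r.
Qed.

(** The gradient estimate is applied to difference quotients of [f], whose derivatives are not yet
    known to be harmonic. The radius 3 d adds up the cube for the quotient, the length of the
    increment, and the cube that bounds the first derivative. *)
Lemma second_derivative_estimate U f g h a d M i k : open U -> harm2 U f g h ->
    0 < d -> 0 <= M -> (forall x, `|x - a| <= 3 * d -> U x) ->
    (forall x, `|x - a| <= 3 * d -> `|f x| <= M) ->
  `|h k i a| <= (n%:R / d) ^+ 2 * M.
Proof.
move=> oU H d0 M0 dU fM.
have nMd : 0 <= n%:R * M / d by rewrite divr_ge0 ?mulr_ge0 // ltW.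
have Ua : U a by apply: dU; rewrite subrr normr0; lra.
have hd : is_derive a (basis_vec i) (g k : _ -> R^o) (h k i a).
  exact: (harm_der2 H).
apply: (derivative_abs_le d0 hd) => t /andP[t0 td].
set z := t *: basis_vec i.
have zt : `|z| <= t.
  by rewrite normrZ gtr0_norm // ler_piMr ?(ltW t0) // basis_vec_norm.
pose U' := U `&` [set x | U (x + z)].
have oU' : open U' by apply: openI => //; exact: open_translate.
have dU' x : `|x - a| <= d -> U' x.
  move=> xd; split; apply: dU; first by lra.
  by rewrite addrAC (le_trans (ler_normD _ _)) //; lra.
have := gradient_estimate k oU' (harm2_difference z t^-1 H) d0 nMd dU'.
move=> H1; have {}H1 : `|t^-1 * (g k (a + z) - g k a)| <= n%:R * (n%:R * M / d) / d.
  apply: H1 => x xd; rewrite normrM normfV (gtr0_norm t0) mulrC ler_pdivrMr //.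
  have seg s : 0 <= s <= t -> `|x + s *: basis_vec i - a| <= 2 * d.
    move=> /andP[s0 st]; have -> : 2 * d = d + d by ring.
    apply: segment_ball => //; apply: (@le_trans _ _ s); last by lra.
    by rewrite ler_piMr // basis_vec_norm.
  apply: increment_le => [|s /seg sd|s /seg sd]; first exact: ltW.
    by apply: (harm_der H); apply: dU; lra.
  apply: (gradient_estimate i oU H) => // y yd; [apply: dU|apply: fM].
    rewrite -[y](subrK (x + s *: basis_vec i)) -addrA (le_trans (ler_normD _ _)) //; lra.
  rewrite -[y](subrK (x + s *: basis_vec i)) -addrA (le_trans (ler_normD _ _)) //; lra.
move: H1; rewrite normrM normfV (gtr0_norm t0) ler_pdivrMl // mulrC => /le_trans; apply.
by rewrite ler_pM2r // le_eqVlt; apply/orP; left; apply/eqP; field; rewrite gt_eqF.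
Qed.

End HarmonicEstimates.

(** * Limits of harmonic functions *)

Section UniformLimits.
Variables (R : realType) (V : normedModType R).
Implicit Types (U : set V) (x v : V) (F D : nat -> V -> R) (L f : V -> R) (e : R).

Definition ucauchy U D := forall e, 0 < e -> exists N, forall m m',
  (N <= m)%N -> (N <= m')%N -> forall x, U x -> `|D m x - D m' x| <= e.

Definition uconv U D L := forall e, 0 < e -> exists N, forall m,
  (N <= m)%N -> forall x, U x -> `|D m x - L x| <= e.

Lemma uconv_cvg U D L x : uconv U D L -> U x -> D m x @[m --> \oo] --> L x.
Proof.
move=> uD Ux; apply/cvgrPdist_le => e /uD[N ND].
by exists N => // m /= Nm; rewrite distrC; exact: ND.
Qed.

Lemma ucauchy_uconv U D : ucauchy U D -> exists L, uconv U D L.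
Proof.
move=> cD; have cv x : U x -> cvg (D m x @[m --> \oo]).
  move=> Ux; apply: cauchy_cvg; apply: cauchy_exP => e e0.
  have [|N ND] := cD (e / 2); first by lra.
  exists (D N x); exists N => // m /= Nm; rewrite -ball_normE /ball_ /=.
  by have := ND N m (leqnn N) Nm x Ux; lra.
exists (fun x => lim (D m x @[m --> \oo])) => e e0.
have [|N ND] := cD e; first by lra.
exists N => m Nm x Ux; have := cv x Ux => /cvg_ex[l /[dup] Dl /cvg_lim -> //].
rewrite leNgt; apply/negP => lt; have /cvgrPdist_le := Dl.
move=> /(_ ((`|D m x - l| - e) / 2))[|K _ KD]; first by lra.
have := KD (maxn N K) (leq_maxr _ _) => /= H1.
have H2 := ND m (maxn N K) Nm (leq_maxl _ _) x Ux.
have : `|D m x - l| <= `|D m x - D (maxn N K) x| + `|l - D (maxn N K) x|.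
  by rewrite -[X in _ <= _ + X]normrN opprB (le_trans _ (ler_normD _ _)) // addrA subrK.
by lra.
Qed.

Lemma uconv_continuous U D L x : open U -> U x ->
  (forall m, {for x, continuous (D m)}) -> uconv U D L -> {for x, continuous L}.
Proof.
move=> oU Ux cD uD; apply/cvgrPdist_le => e e0.
have [|N ND] := uD (e / 3); first by lra.
have /cvgrPdist_le/(_ (e / 3)) := cD N.
have nU : \forall y \near x, U y by exact: open_nbhs_nbhs.
move=> H; have {}H : \forall t \near x, `|D N x - D N t| <= e / 3 by apply: H; lra.
near=> y; have Uy : U y by near: y.
have H1 : `|D N x - D N y| <= e / 3 by near: y.
have H2 := ND N (leqnn N) x Ux; have H3 := ND N (leqnn N) y Uy.
move: H1 H2 H3; rewrite !ler_norml => /andP[? ?] /andP[? ?] /andP[? ?].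
by apply/andP; split; lra.
Unshelve. all: by end_near. Qed.

(** After subtraction of the linear part, the mean value theorem bounds the increment of [F m] by e
    |t| with one radius for all large m, and the bound passes to the limit. *)
Lemma derive_limit U F D f L x v : open U -> U x ->
    (forall m x, U x -> is_derive x v (F m : _ -> R^o) (D m x)) ->
    {for x, continuous L} -> uconv U D L ->
    (forall x, U x -> F m x @[m --> \oo] --> f x) ->
  is_derive x v (f : _ -> R^o) (L x).
Proof.
move=> oU Ux FD cL uD Ff; apply/is_deriveP => e e0.
have [|N ND] := uD (e / 2); first by lra.
have nU : \forall y \near x, U y /\ `|L x - L y| <= e / 2.
  have nU : \forall y \near x, U y by exact: open_nbhs_nbhs.
  have /cvgrPdist_le/(_ (e / 2)) H := cL.
  have {}H : \forall t \near x, `|L x - L t| <= e / 2 by apply: H; lra.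
  by near=> y; split; near: y.
have /near_normP[r r0 rU] := nU.
have v1 : 0 < `|v| + 1 by rewrite ltr_wpDl.
exists (r / (`|v| + 1)); first by rewrite divr_gt0.
move=> t tr; have line s : `|s| <= `|t| -> U (x + s *: v) /\ `|L x - L (x + s *: v)| <= e / 2.
  move=> st; apply: rU; rewrite addrAC subrr add0r normrZ.
  move: tr; rewrite ltr_pdivlMr // => tr; apply: le_lt_trans tr.
  by rewrite ler_pM // lerDl.
have main m : (N <= m)%N -> `|F m (x + t *: v) - F m x - t * L x| <= e * `|t|.
  move=> Nm; pose G s := F m (x + (s * t) *: v) - s * (t * L x).
  have st s : 0 <= s <= 1 -> `|s * t| <= `|t|.
    by move=> /andP[s0 s1]; rewrite normrM ger0_norm // ler_piMl.
  have := @mvt_abs R G (fun s => t * (D m (x + (s * t) *: v) - L x)) 1 (e * `|t|) ler01.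
  rewrite /G mul1r !mul0r scale0r addr0 subr0 mul1r mulr1 addrAC; apply=> s s01.
    have [Us _] := line _ (st s s01).
    have H1 := FD m _ Us.
    have H2 : is_derive (s : R) 1 (fun s : R => F m (x + (s * t) *: v)) (t * D m (x + (s * t) *: v)).
      have /(@is_derive_line R V (F m) x v (s * t)) H3 := H1.
      have H4 : is_derive (s : R) 1 (fun s : R => s * t) t.
        by apply: is_derive_eq; rewrite /GRing.scale /=; ring.
      have H5 := @is_derive1_comp R (fun s => F m (x + s *: v)) (fun s => s * t) s _ _ H3 H4.
      by apply: is_derive_eq; rewrite /GRing.scale /=; ring.
    by apply: is_derive_eq; rewrite /GRing.scale /=; ring.
  have [Us Ls] := line _ (st s s01).
  rewrite normrM mulrC ler_wpM2r //.
  have := ND m Nm _ Us; move: Ls; rewrite !ler_norml => /andP[? ?] /andP[? ?].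
  by apply/andP; split; lra.
have [Ut _] := line t (lexx _).
have c1 : F m (x + t *: v) - F m x - t * L x @[m --> \oo] --> f (x + t *: v) - f x - t * L x.
  apply: cvgB; last exact: cvg_cst.
  by apply: cvgB; exact: Ff.
have c2 := cvg_norm c1.
apply: (cvgr_to_le (c2 _)).
by exists N => // m /= Nm; exact: main.
Unshelve. all: by end_near. Qed.

End UniformLimits.

Section HarmonicLimits.
Variables (R : realType) (n : nat).
Implicit Types (x a z v : 'rV[R]_n) (U : set 'rV[R]_n).
Implicit Types (d M c t r e : R).

Definition nball a r : set 'rV[R]_n := [set x | `|x - a| < r].

Lemma open_nball a r : open (nball a r).
Proof.
rewrite openE => x xr; apply: (near_normP x (nball a r)).2; exists (r - `|x - a|).
  by rewrite subr_gt0.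
move=> y yx; rewrite /nball /=.
have -> : y - a = (y - x) + (x - a) by rewrite addrA subrK.
by rewrite (le_lt_trans (ler_normD _ _)) //; lra.
Qed.

Lemma cvg_fsum (I : Type) (s : seq I) (u : I -> nat -> R) (l : I -> R) :
  (forall i, u i m @[m --> \oo] --> l i) ->
  \sum_(i <- s) u i m @[m --> \oo] --> \sum_(i <- s) l i.
Proof.
move=> ul; elim: s => [|i s IH].
  by under eq_fun do rewrite big_nil; rewrite big_nil; exact: cvg_cst.
by under eq_fun do rewrite big_cons; rewrite big_cons; apply: cvgD; [exact: ul | exact: IH].
Qed.

(** Interior estimates for differences of two terms turn the uniform Cauchy property of [f] into
    that of its first and second derivatives. The second ones need radius 3 r around each point of
    the ball of radius r, hence 4 r. *)
Lemma harmonic_limit U (f : nat -> 'rV[R]_n -> R) (g : nat -> 'I_n -> 'rV[R]_n -> R)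
    (h : nat -> 'I_n -> 'I_n -> 'rV[R]_n -> R) (W : 'rV[R]_n -> R) a r :
    0 < r -> open U -> (forall m, harm2 U (f m) (g m) (h m)) ->
    (forall x, `|x - a| <= 4 * r -> U x) ->
    ucauchy [set x | `|x - a| <= 4 * r] f ->
    (forall x, nball a r x -> f m x @[m --> \oo] --> W x) ->
  exists G H, harm2 (nball a r) W G H /\
    forall i x, nball a r x -> g m i x @[m --> \oo] --> G i x.
Proof.
move=> r0 oU Hf rU cf fW.
have near_a x y c : nball a r x -> `|y - x| <= c -> `|y - a| <= c + r.
  move=> xa yx; have -> : y - a = (y - x) + (x - a) by rewrite addrA subrK.
  by rewrite (le_trans (ler_normD _ _)) // lerD // ltW.
have Hd m m' := harm2D (Hf m) (harm2Z (-1) (Hf m')).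
have nball_U x : nball a r x -> U x.
  by move=> xa; apply: rU; move: xa; rewrite /nball /=; lra.
have cg (i : 'I_n) : ucauchy (nball a r) (fun m => g m i).
  have n1 : (0 : R) < n%:R by rewrite ltr0n; case: (n) i => [[]|].
  move=> e e0; have e'0 : 0 < e * r / n%:R by rewrite divr_gt0 // mulr_gt0.
  have [N NP] := cf _ e'0; exists N => m m' Nm Nm' x xa.
  have := gradient_estimate i oU (Hd m m') (a := x) r0 (ltW e'0).
  rewrite mulN1r (_ : n%:R * (e * r / n%:R) / r = e); last by field; rewrite !gt_eqF.
  apply=> y yx; have ya := near_a _ _ _ xa yx.
    by apply: rU; lra.
  by rewrite mulN1r; apply: NP => //=; lra.
have ch (i j : 'I_n) : ucauchy (nball a r) (fun m => h m i j).
  have n1 : (0 : R) < n%:R by rewrite ltr0n; case: (n) i => [[]|].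
  move=> e e0; have e'0 : 0 < e * (r / n%:R) ^+ 2 by rewrite mulr_gt0 // exprn_gt0 // divr_gt0.
  have [N NP] := cf _ e'0; exists N => m m' Nm Nm' x xa.
  have := second_derivative_estimate j i oU (Hd m m') (a := x) r0 (ltW e'0).
  rewrite mulN1r (_ : (n%:R / r) ^+ 2 * _ = e); last by field; rewrite !gt_eqF.
  apply=> y yx; have ya := near_a _ _ _ xa yx.
    by apply: rU; lra.
  by rewrite mulN1r; apply: NP => //=; lra.
have [G GP] := choice (fun i => ucauchy_uconv (cg i)).
have [H HP] := choice (fun ij : 'I_n * 'I_n => ucauchy_uconv (ch ij.1 ij.2)).
have oB := @open_nball a r.
have cG i x : nball a r x -> {for x, continuous (G i)}.
  move=> xa; apply: (uconv_continuous oB xa _ (GP i)) => m.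
  by apply: (harm_contg (Hf m)); exact: nball_U.
have cH i j x : nball a r x -> {for x, continuous (H (i, j))}.
  move=> xa; apply: (uconv_continuous oB xa _ (HP (i, j))) => m.
  by apply: (harm_conth (Hf m)); exact: nball_U.
have cvG i x : nball a r x -> g m i x @[m --> \oo] --> G i x.
  by move=> xa; exact: (uconv_cvg (GP i) xa).
exists G, (fun i j => H (i, j)); split=> //; split.
- move=> x xa; have cf' : ucauchy (nball a r) f.
    move=> e /cf[N NP]; exists N => m m' Nm Nm' y ya; apply: NP => //=.
    by move: ya; rewrite /nball /=; lra.
  have [W' W'P] := ucauchy_uconv cf'.
  have WW' y : nball a r y -> W' y = W y.
    move=> ya; apply: (@cvg_unique _ _ (f m y @[m --> \oo])) => //.
      exact: (uconv_cvg W'P ya).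
    exact: fW.
  have fuW : uconv (nball a r) f W.
    by move=> e /W'P[N NP]; exists N => m Nm y ya; rewrite -WW' //; exact: NP.
  apply: (uconv_continuous oB xa _ fuW) => m.
  by apply: (harm_cont (Hf m)); exact: nball_U.
- exact: cG.
- exact: cH.
- move=> i x xa; apply: (derive_limit oB xa _ (cG i x xa) (GP i) fW) => m y ya.
  by apply: (harm_der (Hf m)); exact: nball_U.
- move=> i j x xa.
  apply: (derive_limit oB xa _ (cH i j x xa) (HP (i, j)) (cvG i)) => m y ya.
  by apply: (harm_der2 (Hf m)); exact: nball_U.
- move=> x xa; have c1 : \sum_i h m i i x @[m --> \oo] --> \sum_i H (i, i) x.
    apply: cvg_fsum => i; exact: (uconv_cvg (HP (i, i)) xa).
  apply: (cvg_unique _ c1) => //.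
  have -> : (fun m => \sum_i h m i i x) = fun=> 0.
    by apply/funext => m; apply: (harm_lap (Hf m)); exact: nball_U.
  exact: cvg_cst.
Qed.

End HarmonicLimits.

Lemma at_continuousP (R : realType) (V : normedModType R) (f : V -> R) x :
  {for x, continuous f} <-> forall e, 0 < e ->
    exists2 r, 0 < r & forall y, `|y - x| < r -> `|f x - f y| <= e.
Proof.
split=> [cf e e0|cf].
  by apply/near_normP; have /cvgrPdist_le := cf; exact.
by apply/cvgrPdist_le => e /cf H; exact: (near_normP x _).2.
Qed.

(** * Derivatives of harmonic functions are harmonic *)

Section HarmonicDerivatives.
Variables (R : realType) (n : nat).
Implicit Types (x a z v : 'rV[R]_n) (U : set 'rV[R]_n).
Implicit Types (f : 'rV[R]_n -> R) (d M c t r e : R).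

(** Limits first produce derivative families without a formula; [harm2_harm] identifies them with
    these iterated partial derivatives. *)
Definition harm U f :=
  harm2 U f (fun i => partial i f) (fun i j => partial j (partial i f)).

Lemma near_eq_continuous f f' x : (\forall y \near x, f y = f' y) ->
  {for x, continuous f} -> {for x, continuous f'}.
Proof.
move=> ff' cf; have fx := nbhs_singleton ff'.
apply/at_continuousP => e e0; have /at_continuousP/(_ e e0)[r r0 rH] := cf.
have /near_normP[s s0 sH] := ff'.
exists (Num.min r s); first by rewrite lt_min r0.
by move=> y; rewrite lt_min => /andP[/rH + /sH <-]; rewrite -fx.
Qed.

Lemma near_eq_is_derive f f' x v d : (\forall y \near x, f y = f' y) ->
  is_derive x v (f : _ -> R^o) d -> is_derive x v (f' : _ -> R^o) d.
Proof.
move=> /near_normP[r r0 ff']; have v1 : 0 < `|v| + 1 by rewrite ltr_wpDl.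
apply: (@is_derive_near_ext _ _ f f' x v d (r / (`|v| + 1))); first by rewrite divr_gt0.
move=> t tr; apply: ff'; rewrite addrAC subrr add0r normrZ.
move: tr; rewrite ltr_pdivlMr // => tr; apply: le_lt_trans tr.
by rewrite ler_wpM2l // lerDl.
Qed.

Lemma harm2_harm U f g h : open U -> harm2 U f g h ->
  [/\ harm U f, forall i x, U x -> partial i f x = g i x &
      forall i j x, U x -> partial j (partial i f) x = h i j x].
Proof.
move=> oU H.
have pE i x : U x -> partial i f x = g i x.
  by move=> Ux; have [_ <-] := harm_der H i Ux.
have near_p i x : U x -> \forall y \near x, g i y = partial i f y.
  by move=> Ux; near=> y; rewrite pE //; near: y; exact: open_nbhs_nbhs.
have dp i j x : U x -> is_derive x (basis_vec j) (partial i f : _ -> R^o) (h i j x).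
  by move=> Ux; apply: near_eq_is_derive (near_p i x Ux) _; exact: (harm_der2 H).
have ppE i j x : U x -> partial j (partial i f) x = h i j x.
  by move=> Ux; have [_ <-] := dp i j x Ux.
split=> //; split=> //.
- by move=> x Ux; exact: (harm_cont H).
- by move=> i x Ux; apply: near_eq_continuous (near_p i x Ux) _; exact: (harm_contg H).
- move=> i j x Ux; apply: (@near_eq_continuous (h i j)); last exact: (harm_conth H).
  by near=> y; rewrite ppE //; near: y; exact: open_nbhs_nbhs.
- by move=> i x Ux; rewrite pE //; exact: (harm_der H).
- by move=> i j x Ux; rewrite ppE //; exact: dp.
- move=> x Ux; rewrite (eq_bigr (fun i => h i i x)); first exact: (harm_lap H).
  by move=> i _; exact: ppE.
Unshelve. all: by end_near. Qed.

Lemma cube_bounded f a d : (forall x, `|x - a| <= d -> {for x, continuous f}) ->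
  exists2 M, 0 <= M & forall x, `|x - a| <= d -> `|f x| <= M.
Proof.
move=> cf; have [d0|d0] := ltP d 0.
  by exists 0 => // x xd; have := normr_ge0 (x - a); lra.
pose B := box (fun i => a ord0 i - d) (fun i => a ord0 i + d).
have Bd x : B x -> `|x - a| <= d by apply: box_norm.
have dB x : `|x - a| <= d -> B x.
  move=> xd i; have := le_trans (coord_norm_le (x - a) i) xd.
  by rewrite !mxE ler_norml /= in_itv /= => /andP[? ?]; apply/andP; split; lra.
have B0 : B !=set0 by exists a; apply: dB; rewrite subrr normr0.
have cB : {within B, continuous f}.
  by apply: continuous_in_subspaceT => x; rewrite inE => /Bd; exact: cf.
have [c1 _ H1] := compact_EVT_max B0 (@box_compact _ _ _ _) cB.
have [c2 _ H2] := compact_EVT_min B0 (@box_compact _ _ _ _) cB.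
exists (`|f c1| + `|f c2|); first by rewrite addr_ge0.
move=> x /dB Bx; have := H1 x; have := H2 x; rewrite !inE => /(_ Bx) m1 /(_ Bx) m2.
have := ler_norm (f c1); have := ler_norm (- f c2); rewrite normrN ler_norml.
by have := normr_ge0 (f c1); have := normr_ge0 (f c2) => ? ? ? ?; apply/andP; split; lra.
Qed.

Lemma difference_quotient_cvg f x v d (t : nat -> R) : (forall m, t m != 0) ->
    t m @[m --> \oo] --> (0 : R) -> is_derive x v (f : _ -> R^o) d ->
  (t m)^-1 * (f (x + t m *: v) - f x) @[m --> \oo] --> d.
Proof.
move=> t0 tcv /is_deriveP fd; apply/cvgrPdist_le => e /fd[r r0 rH].
have /cvgrPdist_lt/(_ r r0) := tcv; apply: filterS => m; rewrite sub0r normrN => /rH.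
have -> : d - (t m)^-1 * (f (x + t m *: v) - f x) =
    - ((t m)^-1 * (f (x + t m *: v) - f x - t m * d)) by field.
by rewrite normrN normrM normfV ler_pdivrMl ?normr_gt0 // [_ * e]mulrC.
Qed.

Lemma difference_quotient_le U f x t M j : harm U f -> 0 < t ->
    (forall s, 0 <= s <= t -> U (x + s *: basis_vec j)) ->
    (forall s, 0 <= s <= t -> `|partial j (partial j f) (x + s *: basis_vec j)| <= M) ->
  `|t^-1 * (f (x + t *: basis_vec j) - f x) - partial j f x| <= M * t.
Proof.
move=> H t0 tU tM; have M0 : 0 <= M.
  by apply: le_trans (tM 0 _); rewrite // lexx ltW.
have dg s : 0 <= s <= t -> `|partial j f (x + s *: basis_vec j) - partial j f x| <= M * t.
  move=> /andP[s0 st]; apply: (@le_trans _ _ (M * s)); last by rewrite ler_wpM2l.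
  apply: (@increment_le _ _ (partial j f) (fun i => partial i (partial j f)) x s M j s0) => w /andP[w0 ws].
    by apply: (harm_der2 H); apply: tU; rewrite w0 (le_trans ws).
  by apply: tM; rewrite w0 (le_trans ws).
have := @mvt_abs R (fun s => f (x + s *: basis_vec j) - s * partial j f x)
  (fun s => partial j f (x + s *: basis_vec j) - partial j f x) t (M * t) (ltW t0) _ dg.
rewrite scale0r addr0 mul0r subr0 => H1.
have -> : t^-1 * (f (x + t *: basis_vec j) - f x) - partial j f x =
    t^-1 * (f (x + t *: basis_vec j) - t * partial j f x - f x).
  by field; rewrite gt_eqF.
rewrite normrM normfV (gtr0_norm t0) ler_pdivrMl // [t * (M * t)]mulrC; apply: H1 => s st.
have /(@is_derive_line R _ f) H2 := harm_der H j (tU s st).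
by apply: is_derive_eq; rewrite /GRing.scale /=; ring.
Qed.

(** Difference quotients in direction j are harmonic and converge uniformly, so [harmonic_limit]
    applies. Their i-th derivatives are difference quotients of [partial i f], whose limit gives the
    symmetry of mixed derivatives as well. Iteration yields derivatives of all orders from class
    C^2. *)
Lemma harm_partial U f j : open U -> harm U f ->
  harm U (partial j f) /\
  forall i x, U x -> partial i (partial j f) x = partial j (partial i f) x.
Proof.
move=> oU H.
suff loc a : U a -> exists r, [/\ 0 < r, nball a r `<=` U,
    harm (nball a r) (partial j f) &
    forall i x, nball a r x -> partial i (partial j f) x = partial j (partial i f) x].
  split; last first.
    move=> i x Ux; have [r [r0 _ _ +]] := loc x Ux; apply.
    by rewrite /nball /= subrr normr0.
  split; [move=> x Ux|move=> i x Ux|move=> i k x Ux|move=> i x Ux|move=> i k x Ux|move=> x Ux];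
    (have [r [r0 _ [c1 c2 c3 c4 c5 c6] _]] := loc x Ux);
    (have xx : nball x r x by rewrite /nball /= subrr normr0); by auto.
move=> Ua; have /near_normP[r6 r60 rU] : \forall y \near a, U y by exact: open_nbhs_nbhs.
(* A closed cube of radius 4 r for the limit, an open one of radius 5 r where the quotients are
   harmonic, and a further r for the shift [z m]. *)
pose r := r6 / 6; have r0 : 0 < r by rewrite divr_gt0.
have r6E : r6 = 6 * r by rewrite /r; field.
pose t m := r / (m.+1)%:R : R.
have t0 m : 0 < t m by rewrite divr_gt0 // ltr0n.
have tr m : t m <= r by rewrite ler_pdivrMr ?ltr0n // ler_peMr ?ler1n // ltW.
have tcv : t m @[m --> \oo] --> (0 : R).
  have := cvgM (cvg_cst r) (@cvg_harmonic R); rewrite mulr0; exact.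
pose z m : 'rV[R]_n := t m *: basis_vec j.
have zr m : `|z m| <= r.
  by rewrite normrZ gtr0_norm // (le_trans _ (tr m)) // ler_piMr ?(ltW (t0 m)) // basis_vec_norm.
pose U0 := nball a (5 * r).
have U0U m : U0 `<=` U `&` [set x | U (x + z m)].
  move=> x; rewrite /U0 /nball /= => xa; split; apply: rU; rewrite r6E; first by lra.
  by rewrite addrAC (le_lt_trans (ler_normD _ _)) //; have := zr m; lra.
have Hm m := harm2_sub (U0U m) (harm2_difference (z m) (t m)^-1 H).
have near_a x : nball a r x -> U x by move=> xa; apply: rU; move: xa; rewrite /nball /= r6E; lra.
have [M M0 MP] : exists2 M, 0 <= M & forall x, `|x - a| <= 5 * r ->
    `|partial j (partial j f) x| <= M.
  by apply: cube_bounded => x xa; apply: (harm_conth H); apply: rU; rewrite r6E; lra.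
have unif m x : `|x - a| <= 4 * r ->
    `|(t m)^-1 * (f (x + z m) - f x) - partial j f x| <= M * t m.
  move=> xa; have seg s : 0 <= s <= t m -> `|x + s *: basis_vec j - a| <= 5 * r.
    move=> /andP[s0 st]; have -> : 5 * r = 4 * r + r by ring.
    apply: segment_ball => //; apply: (@le_trans _ _ s); last by have := tr m; lra.
    by rewrite ler_piMr // basis_vec_norm.
  apply: (difference_quotient_le H) => // s /seg sa; last exact: MP.
  by apply: rU; rewrite r6E; lra.
have cau : ucauchy [set x | `|x - a| <= 4 * r] (fun m x => (t m)^-1 * (f (x + z m) - f x)).
  move=> e e0; have e2 : 0 < e / (2 * (M + 1)) by rewrite divr_gt0 //; lra.
  have /cvgrPdist_le/(_ _ e2)[N _ NP] := tcv.
  have small m : (N <= m)%N -> M * t m <= e / 2.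
    move=> /NP /=; rewrite sub0r normrN gtr0_norm // => tm.
    apply: (@le_trans _ _ ((M + 1) * t m)); first by rewrite ler_pM2r //; lra.
    rewrite (le_trans (ler_wpM2l _ tm)) //; first by lra.
    by rewrite le_eqVlt; apply/orP; left; apply/eqP; field; lra.
  exists N => m m' /small Nm /small Nm' x /= xa.
  have := unif m x xa; have := unif m' x xa; rewrite !ler_norml => /andP[? ?] /andP[? ?].
  by apply/andP; split; lra.
have tn0 m : t m != 0 by rewrite gt_eqF.
have cvx x : nball a r x -> (t m)^-1 * (f (x + z m) - f x) @[m --> \oo] --> partial j f x.
  move=> /near_a Ux; apply: difference_quotient_cvg => //; exact: (harm_der H).
have sub4 x : `|x - a| <= 4 * r -> U0 x by rewrite /U0 /nball /=; lra.
have [G [K [HG cG]]] := harmonic_limit r0 (@open_nball _ _ a (5 * r)) Hm sub4 cau cvx.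
have [HG1 GE _] := harm2_harm (@open_nball _ _ a r) HG.
exists r; split; [exact: r0 | exact: near_a | exact: HG1 |].
move=> i x xa; rewrite (GE i x xa).
apply: (cvg_unique _ (cG i x xa)) => //.
apply: difference_quotient_cvg => //; apply: (harm_der2 H); exact: near_a.
Qed.

Lemma harmonic_in_harm U f : open U -> harmonic_in U f -> harm U f.
Proof.
move=> oU [[cf df] lf].
have cat (F : 'rV[R]_n -> R) : {within U, continuous F} -> forall x, U x -> {for x, continuous F}.
  by rewrite continuous_open_subspace // => cF x Ux; apply: cF; rewrite inE.
split.
- exact: cat.
- by move=> i x Ux; have [_ [cp _]] := df i; exact: cat.
- by move=> i j x Ux; have [_ [_ /(_ j)[_ [cp _]]]] := df i; exact: cat.
- by move=> i x Ux; have [dp _] := df i; apply: DeriveDef => //; exact: dp.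
- by move=> i j x Ux; have [_ [_ /(_ j)[dp _]]] := df i; apply: DeriveDef => //; exact: dp.
- exact: lf.
Qed.

End HarmonicDerivatives.

(** * Weighted l^1 norms of polynomials *)

Section WeightedNorm.
Variables (R : realType) (n : nat).
Implicit Types (p q : mpoly n R) (w : 'I_n -> R) (m : multinom n) (x : 'rV[R]_n).

Definition mweight w m : R := \prod_(i < n) w i ^+ m i.

(** This norm bounds the values on the box |x_i| <= w i, is submultiplicative, and is multiplied by
    exactly [mweight w m] under a monomial; the last fact makes division by a dominant monomial
    quantitative. *)
Definition wnorm w p : R := \sum_(m <- msupp p) `|mcoeff m p| * mweight w m.

Lemma mweight_ge0 w m : (forall i, 0 <= w i) -> 0 <= mweight w m.
Proof. by move=> w0; apply: prodr_ge0 => i _; rewrite exprn_ge0. Qed.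

Lemma mweightD w m m' : mweight w (mnm_add m m') = mweight w m * mweight w m'.
Proof. by rewrite /mweight -big_split; apply: eq_bigr => i _; rewrite mnmDE exprD. Qed.

Lemma wnorm_ge0 w p : (forall i, 0 <= w i) -> 0 <= wnorm w p.
Proof. by move=> w0; apply: sumr_ge0 => m _; rewrite mulr_ge0 // mweight_ge0. Qed.

Lemma wnormE w p k : (mmeasure mdeg p <= k)%N ->
  wnorm w p = \sum_(m : bmultinom n k) `|mcoeff m p| * mweight w m.
Proof.
by apply: (msupp_sumE (F := fun m c => `|c| * mweight w m)) => m; rewrite normr0 mul0r.
Qed.

Lemma wnorm0 w : wnorm w 0 = 0.
Proof. by rewrite /wnorm msupp0 big_nil. Qed.

Lemma wnormD w p q : (forall i, 0 <= w i) -> wnorm w (p + q) <= wnorm w p + wnorm w q.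
Proof.
move=> w0; pose a := mmeasure mdeg p; pose b := mmeasure mdeg q.
pose d := mmeasure mdeg (p + q); pose k := maxn d (maxn a b).
have dk : (d <= k)%N := leq_maxl _ _.
have ak : (a <= k)%N := leq_trans (leq_maxl _ _) (leq_maxr _ _).
have bk : (b <= k)%N := leq_trans (leq_maxr _ _) (leq_maxr _ _).
rewrite (wnormE w dk) (wnormE w ak) (wnormE w bk) -big_split /=; apply: ler_sum => m _.
by rewrite -mulrDl mcoeffD ler_wpM2r ?mweight_ge0 // ler_normD.
Qed.

Lemma wnormZ w c p : wnorm w (c *: p) = `|c| * wnorm w p.
Proof.
have [->|c0] := eqVneq c 0; first by rewrite scale0r wnorm0 normr0 mul0r.
rewrite /wnorm (perm_big _ (msuppZ _ c0)) mulr_sumr; apply: eq_bigr => m _.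
by rewrite mcoeffZ normrM mulrA.
Qed.

Lemma wnormN w p : wnorm w (- p) = wnorm w p.
Proof. by rewrite -scaleN1r wnormZ normrN1 mul1r. Qed.

Lemma wnormB w p q : (forall i, 0 <= w i) -> wnorm w (p - q) <= wnorm w p + wnorm w q.
Proof. by move=> w0; rewrite (le_trans (wnormD _ _ w0)) // wnormN. Qed.

Lemma wnorm_sum w (I : Type) (s : seq I) (P : pred I) (F : I -> mpoly n R) :
  (forall i, 0 <= w i) ->
  wnorm w (\sum_(i <- s | P i) F i) <= \sum_(i <- s | P i) wnorm w (F i).
Proof.
move=> w0; elim/big_rec2: _ => [|i a p _ IH]; first by rewrite wnorm0.
by rewrite (le_trans (wnormD _ _ w0)) // lerD2l.
Qed.

Lemma wnormXM w m p : wnorm w (mpolyX R m * p) = mweight w m * wnorm w p.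
Proof.
rewrite mulrC /wnorm (perm_big _ (msuppMX _ _)) big_map mulr_sumr.
apply: eq_bigr => m' _; rewrite mcoeffMX mweightD; ring.
Qed.

Lemma wnormM w p q : (forall i, 0 <= w i) -> wnorm w (p * q) <= wnorm w p * wnorm w q.
Proof.
move=> w0; rewrite {1}[p]mpolyE mulr_suml (le_trans (wnorm_sum _ _ _ w0)) //.
rewrite [X in _ <= X * _]/wnorm mulr_suml; apply: ler_sum => m _.
by rewrite -scalerAl wnormZ wnormXM mulrA.
Qed.

Lemma wnorm_mvarM w i p : wnorm w (mvar i * p) = w i * wnorm w p.
Proof.
rewrite wnormXM; congr (_ * _); rewrite /mweight (bigD1 i) //= mnm1E eqxx expr1.
by rewrite big1 ?mulr1 // => j ji; rewrite mnm1E eq_sym (negPf ji).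
Qed.

Lemma wnormC w c : wnorm w (mpolyC n c) = `|c|.
Proof.
rewrite -[mpolyC n c]mulr1 mul_mpolyC wnormZ -mpolyX0 /wnorm msuppX big_seq1.
rewrite mcoeffX eqxx normr1 mul1r /mweight big1 ?mulr1 // => i _.
by rewrite mnm0E expr0.
Qed.

Lemma wnorm_le w w' p : (forall i, 0 <= w i <= w' i) -> wnorm w p <= wnorm w' p.
Proof.
move=> ww; apply: ler_sum => m _; rewrite ler_wpM2l //; apply: ler_prod => i _.
by have /andP[? ?] := ww i; rewrite exprn_ge0 //= lerXn2r ?nnegrE // (le_trans _ (_ : w i <= _)).
Qed.

Lemma wnorm_homog w p k s : homog k p -> wnorm (fun i => s * w i) p = s ^+ k * wnorm w p.
Proof.
move=> hp; rewrite mulr_sumr; apply: eq_big_seq => m mp; rewrite mulrCA; congr (_ * _).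
rewrite -(homog_supp hp mp) mdegE -prodrXr -big_split; apply: eq_bigr => i _.
by rewrite exprMn.
Qed.

Lemma peval_le w p x : (forall i, `|x ord0 i| <= w i) -> `|peval p x| <= wnorm w p.
Proof.
move=> xw; rewrite /peval mevalE (le_trans (ler_norm_sum _ _ _)) //.
apply: ler_sum => m _; rewrite normrM ler_wpM2l // normr_prod; apply: ler_prod => i _.
rewrite normr_ge0 /= normrX lerXn2r ?nnegrE // (le_trans _ (xw i)) //.
Qed.

Lemma mcoeff_le w p m : (forall i, 0 <= w i) -> `|mcoeff m p| * mweight w m <= wnorm w p.
Proof.
move=> w0; have [mp|/memN_msupp_eq0->] := boolP (m \in msupp p); last first.
  by rewrite normr0 mul0r wnorm_ge0.
rewrite /wnorm (bigD1_seq m) //= lerDl; apply: sumr_ge0 => m' _.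
by rewrite mulr_ge0 // mweight_ge0.
Qed.

End WeightedNorm.

(** * Taylor expansions of harmonic functions *)

Section Taylor.
Local Opaque partial.
Variables (R : realType) (n : nat).
Implicit Types (x a z v : 'rV[R]_n) (U : set 'rV[R]_n).
Implicit Types (f : 'rV[R]_n -> R) (d M c t r e : R).

(** Euler's identity read backwards: a homogeneous part is recovered from its partial derivatives.
    Only iterated [partial] occurs, without multi-index derivatives. *)
Fixpoint taylor k f a : mpoly n R :=
  match k with
  | 0%N => mpolyC n (f a)
  | k'.+1 => k'.+1%:R^-1 *: \sum_i mvar i * taylor k' (partial i f) a
  end.

Arguments taylor : simpl never.

Lemma taylorS k f a :
  taylor k.+1 f a = k.+1%:R^-1 *: \sum_i mvar i * taylor k (partial i f) a.
Proof. by []. Qed.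

Lemma mderiv_mvar i j : mderiv j (mvar i : mpoly n R) = (i == j)%:R.
Proof.
rewrite mderivX mnm1E; case: eqP => [->|_]; last by rewrite scale0r.
rewrite scale1r (_ : mnm_sub _ _ = mnm0) ?mpolyX0 //.
by apply/mnmP => k; rewrite mnmBE subnn mnm0E.
Qed.

Lemma homog_taylor k f a : homog k (taylor k f a).
Proof.
elim: k f => [|k IH] f; rewrite ?taylorS.
  by move=> m m0; rewrite /taylor mcoeffC -mdeg_eq0 (negPf m0) mulr0.
by apply/homogZ/homog_sum => i _; exact: homog_mvar.
Qed.

Lemma harm_eq_partial U f f' : open U -> harm U f -> (forall x, U x -> f x = f' x) ->
  forall i x, U x -> partial i f x = partial i f' x.
Proof.
move=> oU H ff' i x Ux.
suff [_ <-] : is_derive x (basis_vec i) (f' : _ -> R^o) (partial i f x) by [].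
apply: near_eq_is_derive (harm_der H i Ux).
by have : \forall y \near x, U y by [exact: open_nbhs_nbhs]; apply: filterS.
Qed.

Lemma taylor_eq U k f f' a : open U -> U a -> harm U f ->
  (forall x, U x -> f x = f' x) -> taylor k f a = taylor k f' a.
Proof.
move=> oU Ua; elim: k f f' => [|k IH] f f' H ff'; first by rewrite /taylor ff'.
rewrite !taylorS; congr (_ *: _); apply: eq_bigr => i _; congr (_ * _); apply: IH.
  exact: (harm_partial i oU H).1.
exact: harm_eq_partial H ff' i.
Qed.

(** The product rule gives one copy of the desired part from the differentiated variable; once
    partial derivatives are commuted, the other terms are a multiple of the same part, and the total
    cancels the inverse factor in front. *)
Lemma mderiv_taylor U k f a j : open U -> U a -> harm U f ->
  mderiv j (taylor k.+1 f a) = taylor k (partial j f) a.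
Proof.
move=> oU Ua; elim: k f => [|k IH] f H.
  rewrite taylorS invr1 scale1r (raddf_sum (mderiv j)) /=.
  under eq_bigr do rewrite mderivM mderivC mulr0 addr0 mderiv_mvar.
  by rewrite (bigD1 j) //= eqxx mul1r big1 ?addr0 // => i /negPf->; rewrite mul0r.
have Hp i := harm_partial i oU H.
have tE i : taylor k (partial j (partial i f)) a = taylor k (partial i (partial j f)) a.
  apply: (@taylor_eq U k _ _ a oU Ua (harm_partial j oU (Hp i).1).1) => x Ux.
  by apply/esym; exact: (Hp j).2.
rewrite taylorS mderivZ (raddf_sum (mderiv j)) /=.
under eq_bigr do rewrite mderivM (IH _ (Hp _).1) mderiv_mvar.
rewrite big_split /= (bigD1 j) //= eqxx mul1r [X in _ + X + _]big1 ?addr0; last first.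
  by move=> i /negPf->; rewrite mul0r.
have -> : \sum_i mvar i * taylor k (partial j (partial i f)) a =
    k.+1%:R *: taylor k.+1 (partial j f) a.
  rewrite taylorS.
  have k0 : k.+1%:R != 0 :> R by rewrite pnatr_eq0.
  rewrite scalerKV; last exact: k0.
  by apply: eq_bigr => i _; exact: (congr1 ( *%R (mvar i)) (tE i)).
rewrite -[X in X + _]scale1r -scalerDl scalerA -[1]/(1%:R) -natrD add1n.
by rewrite mulVf ?scale1r ?pnatr_eq0.
Qed.

(** [taylor] is not additive on arbitrary functions; here the relation is differentiated on [U], and
    the induction applies to the derivatives. *)
Lemma taylor_sum0 U k (F : 'I_n -> 'rV[R]_n -> R) a : open U -> U a ->
    (forall i, harm U (F i)) -> (forall x, U x -> \sum_i F i x = 0) ->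
  \sum_i taylor k (F i) a = 0.
Proof.
move=> oU Ua; elim: k F => [|k IH] F HF F0.
  rewrite /taylor.
  by rewrite -(raddf_sum (mpolyC n (R:=R))) F0 // mpolyC0.
under eq_bigr do rewrite taylorS.
rewrite -scaler_sumr exchange_big /= big1 ?scaler0 // => j _.
rewrite -mulr_sumr (IH (fun i => partial j (F i))).
- by rewrite mulr0.
- by move=> i; exact: (harm_partial j oU (HF i)).1.
move=> x Ux.
have d1 : is_derive x (basis_vec j) ((fun y => \sum_i F i y) : _ -> R^o)
    (\sum_i partial j (F i) x).
  elim: (index_enum _) => [|i s IHs].
    rewrite big_nil (_ : (fun y => _) = cst 0); last first.
      by apply/funext => y; rewrite big_nil.
    exact: is_derive_cst.
  rewrite big_cons (_ : (fun y => _) = fun y => F i y + \sum_(i <- s) F i y); last first.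
    by apply/funext => y; rewrite big_cons.
  by apply: is_derive_add => //; exact: (harm_der (HF i)).
have d2 : is_derive x (basis_vec j) (cst 0 : 'rV[R]_n -> R^o) (\sum_i partial j (F i) x).
  apply: near_eq_is_derive d1.
  by have : \forall y \near x, U y by [exact: open_nbhs_nbhs]; apply: filterS.
by have [_ <-] := d2; rewrite derive_cst.
Qed.

Lemma mlaplacian_taylor U k f a : open U -> U a -> harm U f ->
  mlaplacian (taylor k f a) = 0.
Proof.
move=> oU Ua H; have Hp i := (harm_partial i oU H).1.
case: k => [|[|k]].
- by rewrite /mlaplacian big1 // => i _; rewrite /taylor mderivC mderiv0.
- rewrite /mlaplacian big1 // => i _.
  by rewrite (mderiv_taylor 0 i oU Ua H) /taylor mderivC.
rewrite /mlaplacian.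
under eq_bigr do rewrite (mderiv_taylor k.+1 _ oU Ua H) (mderiv_taylor k _ oU Ua (Hp _)).
apply: (taylor_sum0 _ oU Ua) => [i|x Ux]; last exact: (harm_lap H).
exact: (harm_partial i oU (Hp i)).1.
Qed.

(** The path goes along v and then along the i-th axis, and continuity of [partial i f] controls the
    second leg. Adding coordinates one by one gives the chain rule. *)
Lemma is_derive_add_basis U f x v d c i : open U -> harm U f -> U x ->
    is_derive x v (f : _ -> R^o) d ->
  is_derive x (v + c *: basis_vec i) (f : _ -> R^o) (d + c * partial i f x).
Proof.
move=> oU H Ux /is_deriveP fd; apply/is_deriveP => e e0.
have c1 : 0 < `|c| + 1 by rewrite ltr_wpDl.
have e1 : 0 < e / (2 * (`|c| + 1)) by rewrite divr_gt0 // mulr_gt0.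
have [|r1 r10 H1] := fd (e / 2); first by lra.
have [r2 r20 H2] : exists2 r, 0 < r & forall y, `|y - x| < r ->
    U y /\ `|partial i f x - partial i f y| <= e / (2 * (`|c| + 1)).
  have /near_normP[s s0 sU] : \forall y \near x, U y by exact: open_nbhs_nbhs.
  have /at_continuousP/(_ _ e1)[r r0 rH] := (harm_contg H Ux : {for x, continuous (partial i f)}).
  exists (Num.min r s); first by rewrite lt_min r0.
  by move=> y; rewrite lt_min => /andP[/rH ? /sU ?].
pose b := `|v| + `|c| + 1; have b0 : 0 < b by rewrite /b; have := normr_ge0 v; have := normr_ge0 c; lra.
exists (Num.min r1 (r2 / b)); first by rewrite lt_min r10 divr_gt0.
move=> t; rewrite lt_min => /andP[t1]; rewrite ltr_pdivlMr // => t2.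
have mid s : 0 <= s <= 1 -> `|x + t *: v + (s * (t * c)) *: basis_vec i - x| < r2.
  move=> /andP[s0 s1]; apply: le_lt_trans t2.
  have -> : x + t *: v + (s * (t * c)) *: basis_vec i - x = t *: (v + (s * c) *: basis_vec i).
    by rewrite addrAC [x + _]addrC addrK scalerDr scalerA; congr (_ + _ *: _); ring.
  rewrite normrZ ler_wpM2l // (le_trans (ler_normD _ _)) // /b -addrA lerD2l normrZ.
  rewrite (@le_trans _ _ `|s * c|) // ?ler_piMr ?basis_vec_norm // normrM (ger0_norm s0).
  by rewrite (@le_trans _ _ `|c|) ?ler_piMl // lerDl.
have := @mvt_abs R (fun s => f (x + t *: v + (s * (t * c)) *: basis_vec i) - s * (t * c * partial i f x))
  (fun s => t * c * (partial i f (x + t *: v + (s * (t * c)) *: basis_vec i) - partial i f x))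
  1 (e / 2 * `|t|) ler01.
rewrite !mul0r scale0r !addr0 subr0 !mul1r mulr1 => M1.
have {}M1 : `|f (x + t *: v + (t * c) *: basis_vec i) - t * c * partial i f x - f (x + t *: v)| <= e / 2 * `|t|.
  apply: M1 => s s01; have [Us ps] := H2 _ (mid s s01).
    have /(@is_derive_line R _ f (x + t *: v) (basis_vec i) (s * (t * c))) H3 := harm_der H i Us.
    have H4 : is_derive (s : R) 1 (fun s : R => s * (t * c)) (t * c).
      by apply: is_derive_eq; rewrite /GRing.scale /=; ring.
    have H5 := @is_derive1_comp R (fun s => f (x + t *: v + s *: basis_vec i)) (fun s => s * (t * c)) s _ _ H3 H4.
    by apply: is_derive_eq; rewrite /GRing.scale /=; ring.
  rewrite -mulrA normrM mulrC ler_wpM2r // normrM distrC.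
  apply: (@le_trans _ _ ((`|c| + 1) * (e / (2 * (`|c| + 1))))).
    by apply: ler_pM => //; rewrite lerDl.
  by rewrite le_eqVlt; apply/orP; left; apply/eqP; field; lra.
have := H1 t t1; rewrite scalerDr scalerA addrA => M2.
have -> : f (x + t *: v + (t * c) *: basis_vec i) - f x - t * (d + c * partial i f x) =
    (f (x + t *: v + (t * c) *: basis_vec i) - t * c * partial i f x - f (x + t *: v))
    + (f (x + t *: v) - f x - t * d) by ring.
by rewrite (le_trans (ler_normD _ _)) //; lra.
Qed.

Lemma harm_chain_rule U f x z : open U -> harm U f -> U x ->
  is_derive x z (f : _ -> R^o) (\sum_i z ord0 i * partial i f x).
Proof.
move=> oU H Ux; rewrite {1}[z]row_sum_delta.
elim: (index_enum _) => [|i s IH].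
  by rewrite !big_nil; exact: is_derive0.
rewrite !big_cons [X in is_derive _ X]addrC [X in is_derive _ _ _ X]addrC.
exact: (is_derive_add_basis _ _ oU H Ux IH).
Qed.

(** Comparison with c t^(k+1) / (k+1). The division by k + 1, which a plain mean value bound would
    lose, accumulates to the factorial in the Taylor remainder. *)
Lemma mvt_power (p dp : R -> R) k c : p 0 = 0 ->
    (forall t, 0 <= t <= 1 -> is_derive t 1 p (dp t)) ->
    (forall t, 0 <= t <= 1 -> `|dp t| <= c * t ^+ k) -> `|p 1| <= c / k.+1%:R.
Proof.
move=> p0 pd dc; have k0 : (0 : R) < k.+1%:R by rewrite ltr0n.
have side (s : R) : `|s| = 1 -> s * p 1 <= c / k.+1%:R.
  move=> s1; pose q t := s * p t - c / k.+1%:R * t ^+ k.+1.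
  pose dq t := s * dp t - c * t ^+ k.
  have qd t : 0 <= t <= 1 -> is_derive t 1 q (dq t).
    move=> /pd pt; have ppow : is_derive t 1 (fun t : R => c / k.+1%:R * t ^+ k.+1) (c * t ^+ k).
      have -> : (fun t : R => c / k.+1%:R * t ^+ k.+1) = horner ((c / k.+1%:R) *: 'X^(k.+1)).
        by apply/funext => w; rewrite hornerZ hornerXn.
      apply: is_derive_eq (is_derive_horner _ _) _.
      rewrite derivZ derivXn hornerZ hornerMn hornerXn -[t ^+ k *+ _]mulr_natl /=.
      by rewrite mulrA divfK // gt_eqF.
    have H1 : is_derive t 1 (fun t => s * p t) (s * dp t) by exact: is_deriveZ.
    exact: is_deriveB.
  have [||u u01] := @MVT_segment R q dq 0 1 ler01.
  - by move=> t /andP[? ?]; apply: qd; apply/andP; split; exact: ltW.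
  - by apply: derivable_within_continuous => t; rewrite in_itv /= => /qd [].
  rewrite /q p0 expr0n /= !mulr0 subrr subr0 expr1n !mulr1 => E.
  have : s * p 1 - c / k.+1%:R <= 0.
    rewrite E subr0 mulr1 /dq subr_le0 (le_trans (ler_norm _)) // normrM s1 mul1r.
    by apply: dc; move: u01; rewrite in_itv.
  by rewrite subr_le0.
rewrite ler_norml; apply/andP; split.
  by rewrite lerNl -mulN1r; apply: side; rewrite normrN1.
by rewrite -[p 1]mul1r; apply: side; rewrite normr1.
Qed.

End Taylor.

(** * Convergence of the Taylor series *)

Section Expansion.
Variables (R : realType) (n : nat).
Implicit Types (x a z v : 'rV[R]_n) (U : set 'rV[R]_n).
Implicit Types (f : 'rV[R]_n -> R) (d M c t r e : R) (p : nat -> mpoly n R).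
Local Opaque partial.

(** A power series grouped by degree, with absolute convergence on the closed cube built in as an
    l^1 bound. It is the common form of the Taylor series of v and the given series of u. *)
Record expansion f a p r M : Prop := Expansion {
  exp_gt0 : 0 < r;
  exp_homog : forall k, homog k (p k);
  exp_bound : forall K, \sum_(k < K) wnorm (fun=> r) (p k) <= M;
  exp_cvg : forall x, `|x| <= r ->
    \sum_(k < K) peval (p k) x @[K --> \oo] --> f (a + x) }.

(** Along the segment, the derivative of the remainder is the sum of z_i times the remainder, of one
    order less, of the i-th partial derivative. Each order costs a margin d, a factor n / d from the
    gradient estimate, and a factor n c from the sum. *)
Lemma taylor_remainder U k f a d M s c z : open U -> harm U f -> 0 < d -> 0 <= M ->
    (forall x, `|x - a| <= s + k%:R * d -> U x /\ `|f x| <= M) ->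
    `|z| <= c -> c <= s ->
  `|f (a + z) - \sum_(j < k) peval (taylor j f a) z| <=
    (n%:R * c * (n%:R / d)) ^+ k * M / k`!%:R.
Proof.
move=> oU + d0; elim: k f M c z => [|k IH] f M c z H M0 fM zc cs.
  rewrite big_ord0 subr0 expr0 mul1r fact0 divr1.
  have [] // := fM (a + z); rewrite mul0r addr0 addrAC subrr add0r.
  exact: le_trans zc cs.
have hT j g : homog j (taylor j g a) by exact: homog_taylor.
have c0 : 0 <= c := le_trans (normr_ge0 _) zc.
have s0 : 0 <= s := le_trans c0 cs.
have Hp i := (harm_partial i oU H).1.
have kd : s + k.+1%:R * d = s + k%:R * d + d by rewrite -addn1 natrD; ring.
have dM : 0 <= n%:R / d * M by rewrite mulr_ge0 // divr_ge0 // ltW.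
have fU x : `|x - a| <= s + k%:R * d -> U x.
  by move=> xa; have [] := fM x; rewrite // kd; lra.
have pM i x : `|x - a| <= s + k%:R * d -> U x /\ `|partial i f x| <= n%:R / d * M.
  move=> xa; split; first exact: fU.
  have -> : n%:R / d * M = n%:R * M / d by rewrite mulrAC.
  have sub y : `|y - x| <= d -> U y /\ `|f y| <= M.
    move=> yx; apply: fM; rewrite kd.
    have -> : y - a = (x - a) + (y - x) by rewrite [RHS]addrC subrKA.
    by rewrite (le_trans (ler_normD _ _)) // lerD.
  by apply: (gradient_estimate i oU H d0 M0) => y /sub[].
pose phi t := f (a + t *: z) - \sum_(j < k.+1) peval (taylor j f a) (t *: z).
pose dphi t := \sum_i z ord0 i *
  (partial i f (a + t *: z) - \sum_(j < k) peval (taylor j (partial i f) a) (t *: z)).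
have phiE t : phi t = f (a + t *: z) - \sum_(j < k.+1) t ^+ j * peval (taylor j f a) z.
  by congr (_ - _); apply: eq_bigr => j _; rewrite (peval_homog _ _ (hT _ _)).
have taylor_euler j x : \sum_i x ord0 i * peval (taylor j (partial i f) a) x
    = j.+1%:R * peval (taylor j.+1 f a) x.
  rewrite taylorS pevalZ mulrA divff ?pnatr_eq0 // mul1r peval_sum.
  by apply: eq_bigr => i _; rewrite pevalM; congr (_ * _); rewrite /peval mevalXU.
have dphiE t : dphi t = \sum_i z ord0 i * partial i f (a + t *: z)
    - \sum_(j < k) j.+1%:R * t ^+ j * peval (taylor j.+1 f a) z.
  rewrite /dphi; under eq_bigr do rewrite mulrBr.
  rewrite sumrB; congr (_ - _).
  under eq_bigr do rewrite mulr_sumr.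
  rewrite exchange_big; apply: eq_bigr => j _ /=.
  rewrite mulrAC -taylor_euler mulr_suml; apply: eq_bigr => i _.
  by rewrite (peval_homog _ _ (hT _ _)); ring.
have tzU t : 0 <= t <= 1 -> U (a + t *: z).
  move=> /andP[t0 t1]; apply: fU; rewrite addrAC subrr add0r normrZ ger0_norm //.
  have : t * `|z| <= s by rewrite (le_trans _ cs) // (le_trans _ zc) // ler_piMl.
  by have : 0 <= k%:R * d; [rewrite mulr_ge0 // ltW | lra].
have phid t : 0 <= t <= 1 -> is_derive t 1 phi (dphi t).
  move=> /tzU Ut; have H1 := harm_chain_rule z oU H Ut.
  have /(@is_derive_line R _ f) {}H1 := H1.
  have H2 : is_derive t 1 (fun t : R => \sum_(j < k.+1) t ^+ j * peval (taylor j f a) z)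
      (\sum_(j < k) j.+1%:R * t ^+ j * peval (taylor j.+1 f a) z).
    pose q : {poly R} := \poly_(j < k.+1) peval (taylor j f a) z.
    have -> : (fun t : R => \sum_(j < k.+1) t ^+ j * peval (taylor j f a) z) = horner q.
      by apply/funext => w; rewrite horner_poly; apply: eq_bigr => j _; rewrite mulrC.
    apply: is_derive_eq (is_derive_horner _ _) _.
    rewrite /q poly_def raddf_sum /= big_ord_recl /= expr0 alg_polyC derivC add0r.
    rewrite horner_sum; apply: eq_bigr => j _.
    rewrite derivZ derivXn hornerZ hornerMn hornerXn /bump add1n.
    by move: (peval _ _) => P; rewrite -[_ *+ j.+1]mulr_natl /=; ring.
  rewrite (_ : phi = fun t => f (a + t *: z) - \sum_(j < k.+1) t ^+ j * peval (taylor j f a) z); last first.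
    by apply/funext => w; exact: phiE.
  by rewrite dphiE; exact: is_deriveB.
pose B := (n%:R * c * (n%:R / d)) ^+ k * (n%:R / d * M) / k`!%:R.
have dphi_le t : 0 <= t <= 1 -> `|dphi t| <= n%:R * c * B * t ^+ k.
  move=> /andP[t0 t1]; rewrite (le_trans (ler_norm_sum _ _ _)) //.
  have -> : n%:R * c * B * t ^+ k = \sum_(i < n) c * (B * t ^+ k).
    by rewrite sumr_const card_ord -mulr_natl; ring.
  apply: ler_sum => i _; rewrite normrM ler_pM //.
    exact: le_trans (coord_norm_le _ _) zc.
  have tzc : `|t *: z| <= t * c by rewrite normrZ ger0_norm // ler_wpM2l.
  have tcs : t * c <= s by rewrite (le_trans _ cs) // ler_piMl.
  have := IH (partial i f) _ (t * c) (t *: z) (Hp i) dM (pM i) tzc tcs.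
  by rewrite /B => /le_trans; apply; rewrite le_eqVlt; apply/orP; left; apply/eqP;
    rewrite (_ : n%:R * (t * c) * (n%:R / d) = t * (n%:R * c * (n%:R / d))) ?exprMn; ring.
have phi0 : phi 0 = 0.
  rewrite phiE scale0r addr0 big_ord_recl /= expr0 mul1r big1 => [|j _].
    by rewrite addr0 /taylor /peval mevalC subrr.
  by rewrite /bump /= expr0n /= mul0r.
have := mvt_power phi0 phid dphi_le; rewrite /phi scale1r => /le_trans; apply.
rewrite /B factS natrM exprS le_eqVlt; apply/orP; left; apply/eqP.
by field; rewrite addrC natr1 !pnatr_eq0 -lt0n fact_gt0 /= gt_eqF.
Qed.

Lemma wnorm_taylor U k f a d M s : open U -> harm U f -> 0 < d -> 0 <= M -> 0 <= s ->
    (forall x, `|x - a| <= k%:R * d -> U x /\ `|f x| <= M) ->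
  wnorm (fun=> s) (taylor k f a) <= (n%:R * s * (n%:R / d)) ^+ k * M / k`!%:R.
Proof.
move=> oU + d0 + s0; elim: k f M => [|k IH] f M H M0 fM.
  rewrite /taylor wnormC expr0 mul1r fact0 divr1.
  by have [] // := fM a; rewrite subrr normr0 mul0r.
have kd : k.+1%:R * d = k%:R * d + d by rewrite -addn1 natrD; ring.
have dM : 0 <= n%:R / d * M by rewrite mulr_ge0 // divr_ge0 // ltW.
have pM i x : `|x - a| <= k%:R * d -> U x /\ `|partial i f x| <= n%:R / d * M.
  move=> xa; split; first by have [] := fM x; rewrite // kd; lra.
  have -> : n%:R / d * M = n%:R * M / d by rewrite mulrAC.
  have sub y : `|y - x| <= d -> U y /\ `|f y| <= M.
    move=> yx; apply: fM; rewrite kd.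
    have -> : y - a = (x - a) + (y - x) by rewrite [RHS]addrC subrKA.
    by rewrite (le_trans (ler_normD _ _)) // lerD.
  by apply: (gradient_estimate i oU H d0 M0) => y /sub[].
pose B := (n%:R * s * (n%:R / d)) ^+ k * (n%:R / d * M) / k`!%:R.
have w0 (i : 'I_n) : 0 <= s by [].
have : wnorm (fun=> s) (\sum_i mvar i * taylor k (partial i f) a) <= n%:R * (s * B).
  rewrite (le_trans (wnorm_sum _ _ _ w0)) // -[n in n%:R * _]card_ord mulr_natl -sumr_const.
  apply: ler_sum => i _; rewrite wnorm_mvarM ler_wpM2l //.
  exact: IH (harm_partial i oU H).1 dM (pM i).
rewrite taylorS wnormZ normfV ger0_norm // ler_pdivrMl ?ltr0n // => /le_trans; apply.
rewrite /B factS natrM exprS le_eqVlt; apply/orP; left; apply/eqP.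
by field; rewrite addrC natr1 !pnatr_eq0 -lt0n fact_gt0 /= gt_eqF.
Qed.

Lemma half_pow_cvg M : M / 2 ^+ K @[K --> \oo] --> (0 : R).
Proof.
rewrite (_ : (fun K => M / 2 ^+ K) = geometric M 2^-1); last first.
  by apply/funext => K; rewrite /geometric /= exprVn.
by apply: cvg_geometric; rewrite ger0_norm //; lra.
Qed.

(** From k to k + 1 the left side grows by (k+1) (1 + 1/k)^k, at most (k+1) e. This pays for margins
    proportional to 1/k in k nested gradient estimates. *)
Lemma exp_self_le_fact (k : nat) : (k%:R : R) ^+ k <= expR 1 ^+ k * k`!%:R.
Proof.
elim: k => [|k IH]; first by rewrite expr0 mul1r fact0.
have [->|k0] := posnP k.
  by rewrite !expr1 factS fact0 muln1 mulr1 (le_trans _ (expR_ge1Dx 1)) // lerDl.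
have kR : (0 : R) < k%:R by rewrite ltr0n.
have : (k.+1%:R / k%:R : R) ^+ k <= expR 1.
  have -> : expR 1 = expR (k%:R^-1) ^+ k :> R.
    by rewrite -expRM_natl mulr_natl -mulr_natr mulVf // gt_eqF.
  rewrite lerXn2r ?nnegrE ?expR_ge0 ?divr_ge0 // (le_trans _ (expR_ge1Dx _)) //.
  by rewrite -addn1 natrD mulrDl divff ?mul1r // gt_eqF.
rewrite exprMn exprVn ler_pdivrMr ?exprn_gt0 // => H1.
rewrite exprS factS natrM [expR 1 ^+ _]exprS.
apply: (@le_trans _ _ (k.+1%:R * (expR 1 * k%:R ^+ k))); first by rewrite ler_wpM2l.
have -> : expR 1 * expR 1 ^+ k * (k.+1%:R * k`!%:R) =
  k.+1%:R * (expR 1 * (expR 1 ^+ k * k`!%:R)) :> R by ring.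
by rewrite ler_wpM2l // ler_wpM2l ?expR_ge0.
Qed.

Lemma harm_expansion U f a : (0 < n)%N -> open U -> harm U f -> U a ->
  exists r M, expansion f a (fun k => taylor k f a) r M.
Proof.
move=> n0 oU H Ua; have nR : (1 : R) <= n%:R by rewrite ler1n.
have /near_normP[r0 r00 rU] : \forall y \near a, U y by exact: open_nbhs_nbhs.
pose r := r0 / 2; have r_gt0 : 0 < r by rewrite divr_gt0.
have Ur x : `|x - a| <= r -> U x by move=> xa; apply: rU; rewrite /r in xa; lra.
have [M M0 fM] : exists2 M, 0 <= M & forall x, `|x - a| <= r -> `|f x| <= M.
  by apply: cube_bounded => x /Ur; exact: (harm_cont H).
have E1 : (1 : R) <= expR 1 by rewrite (le_trans _ (expR_ge1Dx 1)) // lerDl ler01.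
(* With margin d = r / (2 k) this makes n s n / d equal to k / (2 e), so that k^k <= e^k k! leaves M
   / 2^k for the k-th term. *)
pose s : R := r / (4 * n%:R ^+ 2 * expR 1).
have nE : (4 : R) <= 4 * n%:R ^+ 2 * expR 1.
  have : (1 : R) * 1 <= n%:R ^+ 2 * expR 1 by rewrite ler_pM // exprn_ege1.
  by rewrite mul1r -mulrA => ?; lra.
have nE0 : (0 : R) < 4 * n%:R ^+ 2 * expR 1 by lra.
have s0 : 0 < s by rewrite divr_gt0.
have sr : s <= r / 2.
  by rewrite ler_pM2l // lef_pV2 ?posrE //; lra.
have key k : (0 < k)%N -> (n%:R * s * (n%:R / (r / 2 / k%:R))) ^+ k * M / k`!%:R <= M / 2 ^+ k.
  move=> k0; have kR : (0 : R) < k%:R by rewrite ltr0n.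
  have -> : n%:R * s * (n%:R / (r / 2 / k%:R)) = k%:R / (2 * expR 1).
    by rewrite /s; field; rewrite !gt_eqF ?expR_gt0 // ltr0n.
  have fk : (0 : R) < k`!%:R by rewrite ltr0n fact_gt0.
  rewrite exprMn exprVn exprMn ler_pdivrMr // mulrAC ler_pdivrMr; last first.
    by rewrite mulr_gt0 ?exprn_gt0 ?expR_gt0.
  have -> : M / 2 ^+ k * k`!%:R * (2 ^+ k * expR 1 ^+ k) = expR 1 ^+ k * k`!%:R * M.
    by field; rewrite expf_neq0.
  by rewrite ler_wpM2r // exp_self_le_fact.
have term k : wnorm (fun=> s) (taylor k f a) <= M / 2 ^+ k.
  have [->|k0] := posnP k.
    by rewrite /taylor wnormC expr0 divr1; apply: fM; rewrite subrr normr0 ltW.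
  have kR : (0 : R) < k%:R by rewrite ltr0n.
  have d0 : 0 < r / 2 / k%:R by rewrite !divr_gt0.
  apply: le_trans (key k k0); apply: (wnorm_taylor oU H d0 M0 (ltW s0)) => x.
  rewrite mulrC divfK ?gt_eqF // => xa.
  have xr : `|x - a| <= r by lra.
  by split; [exact: Ur | exact: fM].
exists s, (2 * M); split=> //.
- by move=> k; exact: homog_taylor.
- move=> K; apply: (@le_trans _ _ (2 * M - 2 * M / 2 ^+ K)).
    elim: K => [|K IH]; first by rewrite big_ord0 expr0 divr1 subrr.
    rewrite big_ord_recr /= (le_trans (lerD IH (term K))) // exprS invfM.
    by rewrite le_eqVlt; apply/orP; left; apply/eqP; field; rewrite expf_neq0.
  by rewrite gerBl divr_ge0 ?mulr_ge0 ?exprn_ge0.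
move=> x xs; apply/cvgrPdist_le => e e0.
have := half_pow_cvg M => /cvgrPdist_le/(_ e e0)[N _ NP]; exists (maxn N 1) => // K /=.
rewrite geq_max => /andP[/NP /=] + K0; rewrite sub0r normrN => He.
have kR : (0 : R) < K%:R by rewrite ltr0n.
have d0 : 0 < r / 2 / K%:R by rewrite !divr_gt0.
apply: le_trans (le_trans (key K K0) (le_trans (ler_norm _) He)).
apply: (taylor_remainder (s := s) oU H d0 M0 _ xs (lexx _)) => y.
rewrite [K%:R * _]mulrC divfK ?gt_eqF // => ya.
have yr : `|y - a| <= r by lra.
by split; [exact: Ur | exact: fM].
Qed.

End Expansion.

(** * Power series *)

Section PowerSeries.
Local Existing Instance summability.totally_filter.
Variables (R : realType) (n : nat).
Implicit Types (x a y : 'rV[R]_n) (f : 'rV[R]_n -> R) (r s M e : R).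
Implicit Types (c : @multi_index n -> R) (q : mpoly n R) (p : nat -> mpoly n R).
Local Notation index := (@multi_index n).
Implicit Types (al : index) (m : multinom n).

Definition degree al : nat := (\sum_i al i)%N.
Definition multinom_of al : multinom n := Multinom (mktuple (fun i => al i)).
Definition index_of m : index := [ffun i => m i].

Lemma multinom_ofE al i : multinom_of al i = al i.
Proof. by rewrite /fun_of_multinom tnth_mktuple. Qed.

Lemma multinom_ofK : cancel multinom_of index_of.
Proof. by move=> al; apply/ffunP => i; rewrite ffunE multinom_ofE. Qed.

Lemma index_ofK : cancel index_of multinom_of.
Proof. by move=> m; apply/mnmP => i; rewrite multinom_ofE ffunE. Qed.

Lemma mdeg_multinom_of al : mdeg (multinom_of al) = degree al.
Proof. by rewrite mdegE; apply: eq_bigr => i _; rewrite multinom_ofE. Qed.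

(** Finiteness of the multi-indices of degree k comes from [bmultinom], whose degree bound is
    strict, hence [k.+1]. *)
Definition layer k : seq index :=
  [seq index_of (bmnm m) | m : bmultinom n k.+1 <- index_enum (bmultinom n k.+1) & mdeg m == k].

Fixpoint low_indices k : seq index :=
  if k is k'.+1 then low_indices k' ++ layer k' else [::].

Lemma mem_layer k al : (al \in layer k) = (degree al == k).
Proof.
rewrite -mdeg_multinom_of; apply/mapP/idP => [[m + ->]|dk].
  by rewrite index_ofK mem_filter => /andP[].
have dk1 : (mdeg (multinom_of al) < k.+1)%N by rewrite (eqP dk).
exists (BMultinom dk1); last by rewrite /= multinom_ofK.
by rewrite mem_filter mem_index_enum andbT.
Qed.

Lemma uniq_layer k : uniq (layer k).
Proof.
rewrite map_inj_uniq ?filter_uniq ?index_enum_uniq // => m m' /(can_inj index_ofK).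
exact: val_inj.
Qed.

Lemma mem_low_indices k al : (al \in low_indices k) = (degree al < k)%N.
Proof.
elim: k => [|k IH] //=; rewrite mem_cat IH mem_layer ltnS.
by rewrite [RHS]leq_eqVlt orbC.
Qed.

Lemma uniq_low_indices k : uniq (low_indices k).
Proof.
elim: k => [|k IH] //=; rewrite cat_uniq IH uniq_layer andbT /=.
apply/hasPn => al; rewrite mem_layer mem_low_indices => /eqP->.
by rewrite ltnn.
Qed.

Lemma sum_low_indices (F : index -> R) k :
  \sum_(al <- low_indices k) F al = \sum_(j < k) \sum_(al <- layer j) F al.
Proof.
elim: k => [|k IH] /=; first by rewrite big_nil big_ord0.
by rewrite big_cat big_ord_recr /= IH.
Qed.

Lemma sum_msupp_layer (F : multinom n -> R -> R) k q : (forall m, F m 0 = 0) -> homog k q ->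
  \sum_(m <- msupp q) F m (mcoeff m q) =
  \sum_(al <- layer k) F (multinom_of al) (mcoeff (multinom_of al) q).
Proof.
move=> F0 hq; have sq : (mmeasure mdeg q <= k.+1)%N.
  by rewrite mmeasureE big_seq; apply/bigmax_leqP_seq => m mq _; rewrite -(homog_supp hq mq).
rewrite (msupp_sumE (F := F) F0 sq) big_map big_filter [RHS]big_mkcond.
apply: eq_bigr => m _; rewrite index_ofK; case: ifPn => // mk.
by rewrite hq.
Qed.

Lemma wnorm_layer s k q : homog k q ->
  wnorm (fun=> s) q = \sum_(al <- layer k) `|mcoeff (multinom_of al) q| * s ^+ k.
Proof.
move=> hq; rewrite /wnorm (@sum_msupp_layer (fun m d => `|d| * mweight (fun=> s) m) k) //.
  rewrite big_seq [RHS]big_seq; apply: eq_bigr => al; rewrite mem_layer => /eqP <-.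
  rewrite /mweight -expr_sum; congr (_ * s ^+ _); apply: eq_bigr => i _.
  by rewrite multinom_ofE.
by move=> m; rewrite normr0 mul0r.
Qed.

Lemma peval_layer k q x : homog k q ->
  peval q x = \sum_(al <- layer k) mcoeff (multinom_of al) q * monomial al x.
Proof.
move=> hq; rewrite /peval mevalE.
rewrite (@sum_msupp_layer (fun m d => d * \prod_i x ord0 i ^+ m i) k) //.
  apply: eq_bigr => al _; congr (_ * _); apply: eq_bigr => i _.
  by rewrite multinom_ofE.
by move=> m; rewrite mul0r.
Qed.

Definition series_part c k : mpoly n R :=
  \sum_(al <- layer k) c al *: mpolyX R (multinom_of al).

Lemma mcoeff_series_part c al : mcoeff (multinom_of al) (series_part c (degree al)) = c al.
Proof.
have lal : al \in layer (degree al) by rewrite mem_layer.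
rewrite /series_part (bigD1_seq al) ?uniq_layer //= mcoeffD mcoeffZ mcoeffX eqxx mulr1.
rewrite (raddf_sum (mcoeff (multinom_of al))) big1 => [|be bal]; first by rewrite addr0.
by rewrite /= mcoeffZ mcoeffX (can_eq multinom_ofK) (negPf bal) mulr0.
Qed.

Lemma homog_series_part c k : homog k (series_part c k).
Proof.
move=> m mk; rewrite /series_part (raddf_sum (mcoeff m)) big_seq; apply: big1 => al.
rewrite mem_layer -mdeg_multinom_of => /eqP alk; rewrite /= mcoeffZ mcoeffX.
by case: (eqVneq (multinom_of al) m) mk => [<-|_]; rewrite ?mulr0 // alk eqxx.
Qed.

Lemma monomial_le al x r : `|x| <= r -> `|monomial al x| <= r ^+ degree al.
Proof.
move=> xr; rewrite normr_prod /degree expr_sum; apply: ler_prod => i _.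
rewrite normr_ge0 normrX lerXn2r ?nnegrE ?(le_trans _ xr) //.
exact: coord_norm_le.
Qed.

Lemma power_series_sumP c a x s : power_series_sum c a x s <->
  forall e, 0 < e -> exists A : {fset index}, forall B : {fset index},
    (A `<=` B)%fset -> `|s - \sum_(al <- B) c al * monomial al (x - a)| <= e.
Proof.
split=> [/cvgrPdist_le H e e0|H].
  have [A _ AP] := H e e0; exists A => B AB.
  by rewrite big_seq_fsetE; exact: (AP B AB).
apply/cvgrPdist_le => e e0; have [A AP] := H e e0; exists A => // B /= AB.
by have := AP B AB; rewrite big_seq_fsetE.
Qed.

Definition low_fset k : {fset index} := [fset al in low_indices k]%fset.

Lemma sum_low_fset (F : index -> R) k :
  \sum_(al <- low_fset k) F al = \sum_(al <- low_indices k) F al.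
Proof.
apply: perm_big; apply: uniq_perm; [exact: fset_uniq|exact: uniq_low_indices|].
by move=> al; rewrite !inE.
Qed.

Lemma mem_low_fset k al : (al \in low_fset k) = (degree al < k)%N.
Proof. by rewrite inE; exact: mem_low_indices. Qed.

Lemma sub_low_fset (B : {fset index}) : exists K, (B `<=` low_fset K)%fset.
Proof.
exists (\sum_(al <- B) degree al).+1%N; apply/fsubsetP => al alB.
rewrite mem_low_fset ltnS (bigD1_seq al) ?fset_uniq //=.
exact: leq_addr.
Qed.

Lemma fset_sum_le (F : index -> R) (A B : {fset index}) : (forall al, 0 <= F al) ->
  (A `<=` B)%fset -> \sum_(al <- A) F al <= \sum_(al <- B) F al.
Proof.
move=> F0 AB; rewrite [leRHS](big_fsetID _ (mem A)) /=.
rewrite (_ : [fset x in B | x \in A]%fset = A) ?lerDl ?sumr_ge0 //.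
by apply/fsetP => al; rewrite !inE; case: (boolP (al \in A)) => [/(fsubsetP AB)->|]; rewrite ?andbF.
Qed.

(** Grouping by degree is one exhaustion by finite sets; any larger finite set adds only terms of
    degree at least K, which at half the radius are at most M / 2^K in total. *)
Lemma expansion_power_series f a p r M : expansion f a p r M ->
  exists c, \forall x \near a, power_series_sum c a x (f x).
Proof.
move=> H; pose c al := mcoeff (multinom_of al) (p (degree al)).
have hp j : homog j (p j) by case: H.
have r0 := exp_gt0 H; exists c; apply/near_normP; exists (r / 2); first by rewrite divr_gt0.
move=> x xa; have xr : `|x - a| <= r by rewrite ltW // (lt_trans xa) //; lra.
have cE K al : al \in layer K -> c al = mcoeff (multinom_of al) (p K).
  by rewrite mem_layer => /eqP <-.
have partE K : \sum_(j < K) peval (p j) (x - a) =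
    \sum_(al <- low_fset K) c al * monomial al (x - a).
  rewrite sum_low_fset sum_low_indices; apply: eq_bigr => j _.
  rewrite (peval_layer _ (hp j)) big_seq [RHS]big_seq.
  by apply: eq_bigr => al /cE->.
pose F al := `|c al| * r ^+ degree al.
have F0 al : 0 <= F al by rewrite mulr_ge0 // exprn_ge0 // ltW.
have FM (B : {fset index}) : \sum_(al <- B) F al <= M.
  have [K BK] := sub_low_fset B; rewrite (le_trans (fset_sum_le F0 BK)) //.
  rewrite sum_low_fset sum_low_indices; apply: le_trans (exp_bound H K).
  apply: ler_sum => j _; rewrite (wnorm_layer _ (hp j)).
  rewrite big_seq [leRHS]big_seq; apply: ler_sum => al alj.
  by rewrite /F (cE _ _ alj); move: alj; rewrite mem_layer => /eqP->.
apply/power_series_sumP => e e0.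
have := exp_cvg H xr; rewrite (addrC a) subrK => /cvgrPdist_le/(_ (e / 2)).
rewrite divr_gt0 // => /(_ isT)[N1 _ N1P].
have := half_pow_cvg M => /cvgrPdist_le/(_ (e / 2)); rewrite divr_gt0 // => /(_ isT)[N2 _ N2P].
pose K := maxn N1 N2; exists (low_fset K) => B KB.
have := N1P K (leq_maxl _ _); have := N2P K (leq_maxr _ _) => /=.
rewrite sub0r normrN partE => M2 fK.
rewrite (big_fsetID _ (mem (low_fset K))) /=.
rewrite (_ : [fset al in B | al \in low_fset K]%fset = low_fset K); last first.
  apply/fsetP => al; rewrite in_fset inE /=.
  by case: (boolP (al \in low_fset K)) => [/(fsubsetP KB)->|]; rewrite ?andbF.
set T := \sum_(al <- _ | _) _ in fK *; set S := \sum_(al <- _) _.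
have : `|S| <= M / 2 ^+ K.
  rewrite /S (le_trans (ler_norm_sum _ _ _)) //.
  set D := [fset _ in B | _]%fset; rewrite ler_pdivlMr ?exprn_gt0 // mulr_suml.
  apply: le_trans (FM D); rewrite big_seq [leRHS]big_seq; apply: ler_sum => al.
  rewrite in_fset inE /= mem_low_fset -leqNgt => /andP[_ Kd].
  rewrite normrM /F -mulrA ler_wpM2l //.
  have := monomial_le al (ltW xa); rewrite expr_div_n ler_pdivlMr ?exprn_gt0 //.
  by apply: le_trans; rewrite ler_wpM2l // ler_eXn2l // ltr1n.
move=> SM; rewrite opprD addrA (le_trans (ler_normB _ _)) //.
have := ler_norm (M / 2 ^+ K); lra.
Qed.

(** Unconditional convergence bounds all finite partial sums at once; applied separately to the
    nonnegative and the negative terms, this bounds the sum of absolute values. *)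
Lemma power_series_bounded c a x s : power_series_sum c a x s ->
  exists M, forall B : {fset index}, \sum_(al <- B) `|c al * monomial al (x - a)| <= M.
Proof.
move=> /power_series_sumP/(_ 1 ltr01)[A AP].
pose t al := c al * monomial al (x - a).
pose C := `|s| + 1 + \sum_(al <- A) `|t al|.
have tC (B : {fset index}) : `|\sum_(al <- B) t al| <= C.
  (* [B] is the difference between a set containing [A], whose sum is within 1 of [s], and a subset
     of [A]. *)
  have := AP (B `|` A)%fset (fsubsetUr _ _).
  rewrite [X in _ - X](big_fsetID _ (mem B)) /=.
  rewrite (_ : [fset al in (B `|` A) | al \in B]%fset = B); last first.
    by apply/fsetP => al; rewrite !inE; case: (al \in B); rewrite ?andbF.
  set D := [fset al in (B `|` A) | al \notin B]%fset.
  have DA : (D `<=` A)%fset.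
    by apply/fsubsetP => al; rewrite !inE => /andP[/orP[->|]].
  have tD : `|\sum_(al <- D) t al| <= \sum_(al <- A) `|t al|.
    by rewrite (le_trans (ler_norm_sum _ _ _)) // fset_sum_le.
  rewrite -/t /C; set b := \sum_(al <- B) _; set d := \sum_(al <- D) _ in tD *.
  move=> h; have -> : b = s - (s - (b + d)) - d by ring.
  by rewrite (le_trans (ler_normB _ _)) // lerD // (le_trans (ler_normB _ _)) // lerD2l.
exists (C + C) => B; rewrite (big_fsetID _ [pred al | 0 <= t al]) /=; apply: lerD.
  apply: le_trans (tC [fset al in B | 0 <= t al]%fset); rewrite -[leRHS]ger0_norm ?normr_ge0 //.
  rewrite normr_id; apply: le_trans (ler_norm _).
  rewrite big_seq [leRHS]big_seq; apply: ler_sum => al; rewrite !inE => /andP[_ h].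
  by rewrite -/(t al) ger0_norm.
apply: le_trans (tC [fset al in B | ~~ (0 <= t al)]%fset).
rewrite -normrN; apply: le_trans (ler_norm _).
rewrite -sumrN big_seq [leRHS]big_seq; apply: ler_sum => al; rewrite !inE -ltNge => /andP[_ h].
by rewrite -/(t al) ltr0_norm.
Qed.

Lemma analytic_expansion (Omega : set 'rV[R]_n) f a : (0 < n)%N -> real_analytic Omega f ->
  Omega a -> exists p r M, expansion f a p r M.
Proof.
move=> n0 hf /hf[c /near_normP[r0 r00 rP]].
pose r := r0 / 2; have r_gt0 : 0 < r by rewrite divr_gt0.
have series x : `|x| <= r -> power_series_sum c a (a + x) (f (a + x)).
  by move=> xr; apply: rP; rewrite addrAC subrr add0r /r in xr *; lra.
have [M MP] : exists M, forall B : {fset index}, \sum_(al <- B) `|c al| * r ^+ degree al <= M.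
  (* At the corner (r, ..., r) each monomial equals r to its degree, so absolute convergence at this
     single point is the required l^1 bound. *)
  pose z : 'rV[R]_n := const_mx r.
  have zr : `|z| <= r.
    by apply/rV_norm_le => [|i]; rewrite ?mxE ?ger0_norm // ltW.
  have [M MP] := power_series_bounded (series z zr); exists M => B.
  apply: le_trans (MP B); apply: ler_sum => al _; rewrite addrAC subrr add0r normrM.
  rewrite ler_wpM2l // /monomial /degree expr_sum.
  rewrite ger0_norm; first by apply: ler_prod => i _; rewrite mxE lexx exprn_ge0 // ltW.
  by apply: prodr_ge0 => i _; rewrite mxE exprn_ge0 // ltW.
have hc k : homog k (series_part c k) by exact: homog_series_part.
exists (series_part c), r, M; split=> //.
- move=> K; apply: le_trans (MP (low_fset K)); rewrite sum_low_fset sum_low_indices.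
  apply: ler_sum => j _; rewrite (wnorm_layer _ (hc _)).
  rewrite big_seq [leRHS]big_seq; apply: ler_sum => al; rewrite mem_layer => /eqP <-.
  by rewrite mcoeff_series_part.
move=> x xr; apply/cvgrPdist_le => e e0.
have /power_series_sumP/(_ e e0)[A AP] := series x xr.
have [N AN] := sub_low_fset A; exists N => // K /= NK.
have AK : (A `<=` low_fset K)%fset.
  apply/fsubsetP => al /(fsubsetP AN); rewrite !mem_low_fset => h.
  exact: leq_trans h NK.
have := AP _ AK; rewrite sum_low_fset sum_low_indices addrAC subrr add0r.
congr (`|_ - _| <= e); apply: eq_bigr => j _.
rewrite (peval_layer _ (hc _)) big_seq [RHS]big_seq.
by apply: eq_bigr => al; rewrite mem_layer => /eqP <-; rewrite mcoeff_series_part.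
Qed.

End PowerSeries.

(** * Algebra of expansions *)

Section ExpansionAlgebra.
Variables (R : realType) (n : nat).
Implicit Types (x a y z : 'rV[R]_n) (f g h : 'rV[R]_n -> R) (r s M e : R).
Implicit Types (P Q : mpoly n R) (p q : nat -> mpoly n R).

Lemma homogM k l P Q : homog k P -> homog l Q -> homog (k + l) (P * Q).
Proof.
move=> /homogP hP /homogP hQ; apply/homogP.
by rewrite rmorphM /= hP hQ -scalerAl -scalerAr scalerA -exprD.
Qed.

Definition cauchy p q k : mpoly n R := \sum_(i < k.+1) p i * q (k - i)%N.

Lemma cauchy_sum (V : zmodType) (F : nat -> nat -> V) K :
  \sum_(k < K) \sum_(i < k.+1) F i (k - i)%N = \sum_(i < K) \sum_(j < K - i) F i j.
Proof.
elim: K => [|K IH]; first by rewrite !big_ord0.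
rewrite !big_ord_recr /= IH subnn subSnn big_ord1 addrA; congr (_ + _).
rewrite -big_split; apply: eq_bigr => i _ /=.
by rewrite subSn ?big_ord_recr // ltnW.
Qed.

Lemma square_sum_split (V : zmodType) (F : nat -> nat -> V) K :
  \sum_(i < K) \sum_(j < K) F i j =
  \sum_(i < K) \sum_(j < K - i) F i j + \sum_(i < K) \sum_(K - i <= j < K) F i j.
Proof.
rewrite -big_split; apply: eq_bigr => i _ /=.
by rewrite -(big_mkord xpredT (F i)) -(big_mkord xpredT (F i)) -big_cat_nat ?leq_subr.
Qed.

Lemma term_le p k x r s : 0 <= s -> 0 <= r -> homog k (p k) -> `|x| <= s * r ->
  `|peval (p k) x| <= s ^+ k * wnorm (fun=> r) (p k).
Proof.
move=> s0 r0 hp xr; rewrite -(wnorm_homog (fun=> r) s hp).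
by apply: peval_le => i; exact: le_trans (coord_norm_le _ _) xr.
Qed.

Lemma expansion_le f a p r M s : 0 < s -> s <= r -> expansion f a p r M -> expansion f a p s M.
Proof.
move=> s0 sr H; split=> //; first by case: H.
- move=> K; apply: le_trans (exp_bound H K); apply: ler_sum => k _.
  by apply: wnorm_le => i; rewrite ltW.
by move=> x xs; apply: (exp_cvg H); exact: le_trans sr.
Qed.

Lemma expansion_bound_ge0 f a p r M : expansion f a p r M -> 0 <= M.
Proof. by move=> H; have := exp_bound H 0; rewrite big_ord0. Qed.

Lemma expansionB f g a p q r M M' : expansion f a p r M -> expansion g a q r M' ->
  expansion (fun x => f x - g x) a (fun k => p k - q k) r (M + M').
Proof.
move=> H H'; have r0 := exp_gt0 H.
have hp k : homog k (p k) by case: H.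
have hq k : homog k (q k) by case: H'.
split=> //; first by move=> k; exact: homogB.
- move=> K; apply: le_trans (lerD (exp_bound H K) (exp_bound H' K)).
  by rewrite -big_split; apply: ler_sum => k _; apply: wnormB => _; exact: ltW.
move=> x xr; rewrite (_ : (fun K => _) =
  (fun K => \sum_(k < K) peval (p k) x - \sum_(k < K) peval (q k) x)).
  by apply: cvgB; [exact: (exp_cvg H)|exact: (exp_cvg H')].
by apply/funext => K; rewrite -sumrB; apply: eq_bigr => k _; rewrite pevalB.
Qed.

(** The product of the partial sums differs from the partial sum of the Cauchy product by terms with
    i + j >= K; at half the radius these carry a factor 2^-K against the bound M M'. *)
Lemma expansionM f g a p q r M M' : expansion f a p r M -> expansion g a q r M' ->
  expansion (fun x => f x * g x) a (cauchy p q) (r / 2) (M * M').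
Proof.
move=> H H'; have r0 := exp_gt0 H; have r20 : 0 < r / 2 by rewrite divr_gt0.
have r2r : 0 <= r / 2 <= r by apply/andP; split; lra.
have half t : t <= r / 2 -> t <= r /\ t <= 2^-1 * r by move=> ?; split; lra.
have h20 : (0 : R) <= 2^-1 by lra.
have h21 : (2^-1 : R) <= 1 by lra.
have hp k : homog k (p k) by case: H.
have hq k : homog k (q k) by case: H'.
have M0 := expansion_bound_ge0 H; have M0' := expansion_bound_ge0 H'.
have w0 (i : 'I_n) : 0 <= r by exact: ltW.
pose A k := wnorm (fun=> r) (p k); pose B k := wnorm (fun=> r) (q k).
have A0 k : 0 <= A k by exact: wnorm_ge0.
have B0 k : 0 <= B k by exact: wnorm_ge0.
have AB K : \sum_(i < K) \sum_(j < K) A i * B j <= M * M'.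
  under eq_bigr do rewrite -mulr_sumr.
  rewrite -mulr_suml; apply: ler_pM; rewrite ?sumr_ge0 //; [exact: (exp_bound H)|exact: (exp_bound H')].
split=> //.
- move=> k; apply: homog_sum => i _.
  have {1}-> : k = (i + (k - i))%N by rewrite subnKC // leq_ord.
  exact: homogM.
- move=> K; apply: le_trans (AB K).
  rewrite (square_sum_split (fun i j => A i * B j)) -(cauchy_sum (fun i j => A i * B j)).
  rewrite -[leLHS]addr0; apply: lerD; last first.
    by apply: sumr_ge0 => i _; apply: sumr_ge0 => j _; rewrite mulr_ge0.
  apply: ler_sum => k _; apply: (@le_trans _ _ (wnorm (fun=> r) (cauchy p q k))).
    exact: wnorm_le.
  apply: (le_trans (wnorm_sum _ _ _ w0)); apply: ler_sum => i _.
  exact: wnormM.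
move=> x /half[xr xr2].
pose F i j := peval (p i) x * peval (q j) x.
have cE K : \sum_(k < K) peval (cauchy p q k) x =
    (\sum_(k < K) peval (p k) x) * (\sum_(k < K) peval (q k) x)
    - \sum_(i < K) \sum_(K - i <= j < K) F i j.
  apply/eqP; rewrite eq_sym subr_eq; apply/eqP.
  have -> : \sum_(k < K) peval (cauchy p q k) x = \sum_(i < K) \sum_(j < K - i) F i j.
    rewrite -(cauchy_sum F); apply: eq_bigr => k _; rewrite peval_sum.
    by apply: eq_bigr => i _; rewrite pevalM.
  rewrite -(square_sum_split F) mulr_suml; apply: eq_bigr => i _.
  by rewrite mulr_sumr.
rewrite (_ : (fun K => \sum_(k < K) _) = fun K =>
    (\sum_(k < K) peval (p k) x) * (\sum_(k < K) peval (q k) x)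
    - \sum_(i < K) \sum_(K - i <= j < K) F i j); last by apply/funext.
rewrite -[f _ * g _]subr0; apply: cvgB.
  by apply: cvgM; [exact: (exp_cvg H)|exact: (exp_cvg H')].
apply/cvgrPdist_le => e e0.
have /cvgrPdist_le/(_ e e0)[N _ NP] := half_pow_cvg (M * M').
exists N => // K /NP /=; rewrite !sub0r !normrN; apply: le_trans.
apply: le_trans (ler_norm _); rewrite ler_pdivlMr ?exprn_gt0 //.
apply: le_trans (AB K); rewrite -ler_pdivlMr ?exprn_gt0 // mulr_suml.
apply: (le_trans (ler_norm_sum _ _ _)); apply: ler_sum => i _.
apply: (le_trans (ler_norm_sum _ _ _)); rewrite mulr_suml.
rewrite -(big_mkord xpredT (fun j => A i * B j / 2 ^+ K)).
have h : 0 <= \sum_(0 <= j < K - i) A i * B j / 2 ^+ K.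
  by apply: sumr_ge0 => j _; rewrite divr_ge0 ?mulr_ge0 ?exprn_ge0.
rewrite [leRHS](big_cat_nat (n := K - i)) ?leq_subr //=.
rewrite -[leLHS]add0r; apply: lerD h _.
rewrite big_nat_cond [leRHS]big_nat_cond; apply: ler_sum => j; rewrite andbT => /andP[Kj _].
have Kij : (2^-1 : R) ^+ (i + j) <= (2 ^+ K)^-1.
  by rewrite -exprVn ler_wiXn2l // ?h20 ?h21 // -leq_subLR.
have := ler_pM (normr_ge0 _) (normr_ge0 _) (term_le h20 (ltW r0) (hp i) xr2) (term_le h20 (ltW r0) (hq j) xr2).
rewrite /F normrM => /le_trans; apply.
have -> : 2^-1 ^+ i * wnorm (fun=> r) (p i) * (2^-1 ^+ j * wnorm (fun=> r) (q j)) =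
  A i * B j * 2^-1 ^+ (i + j) by rewrite exprD /A /B; ring.
by rewrite ler_wpM2l ?mulr_ge0.
Qed.

Lemma expansion_poly a q K r : 0 < r -> (forall k, (k < K)%N -> homog k (q k)) ->
  expansion (fun x => \sum_(k < K) peval (q k) (x - a)) a
    (fun k => if (k < K)%N then q k else 0) r (\sum_(k < K) wnorm (fun=> r) (q k)).
Proof.
move=> r0 hq; have w0 (i : 'I_n) : 0 <= r by exact: ltW.
have sumE (V : zmodType) (F : mpoly n R -> V) : F 0 = 0 -> forall L,
    \sum_(k < L) F (if (k < K)%N then q k else 0) = \sum_(k < minn L K) F (q k).
  move=> F0 L; rewrite -(big_mkord xpredT (fun k => F (q k))).
  rewrite -(big_mkord xpredT (fun k => F (if (k < K)%N then q k else 0))).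
  rewrite (big_cat_nat (n := minn L K)) ?geq_minl //= [X in _ + X]big1_seq ?addr0.
    rewrite big_nat_cond [RHS]big_nat_cond; apply: eq_bigr => k; rewrite andbT => /andP[_].
    by rewrite leq_min => /andP[_ ->].
  move=> k /=; rewrite mem_index_iota geq_min => /andP[/orP[Lk|Kk] kL].
    by rewrite leqNgt kL in Lk.
  by rewrite ltnNge Kk.
split=> //.
- by move=> k; case: ifPn => [/hq|_] //; exact: homog0.
- move=> L; rewrite (sumE _ (wnorm (fun=> r))) ?wnorm0 //.
  rewrite -(big_mkord xpredT (fun k => wnorm _ (q k))) -(big_mkord xpredT (fun k => wnorm _ (q k))).
  rewrite [leRHS](big_cat_nat (n := minn L K)) ?geq_minr //= lerDl sumr_ge0 // => k _.
  exact: wnorm_ge0.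
move=> x _; apply/cvgrPdist_le => e e0; exists K => // L /= KL.
rewrite (sumE _ (fun P => peval P x)) ?peval0 // (minn_idPr KL) addrAC subrr add0r subrr normr0.
exact: ltW.
Qed.

Lemma expansion_leading f a p r M N x : expansion f a p r M ->
    (forall j, (j < N)%N -> p j = 0) -> `|x| <= r ->
  `|f (a + x) - peval (p N) x| <= M / r ^+ N.+1 * `|x| ^+ N.+1.
Proof.
move=> H p0 xr; have r0 := exp_gt0 H.
have hp k : homog k (p k) by case: H.
have w0 (i : 'I_n) : 0 <= r by exact: ltW.
set t := `|x| / r; have t0 : 0 <= t by rewrite divr_ge0 // ltW.
have t1 : t <= 1 by rewrite ler_pdivrMr // mul1r.
have xt : `|x| <= t * r by rewrite /t divfK // gt_eqF.
have -> : M / r ^+ N.+1 * `|x| ^+ N.+1 = M * t ^+ N.+1 by rewrite /t expr_div_n; ring.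
have partE K : (N < K)%N -> \sum_(k < K) peval (p k) x - peval (p N) x =
    \sum_(N.+1 <= k < K) peval (p k) x.
  move=> NK; rewrite -(big_mkord xpredT (fun k => peval (p k) x)).
  rewrite (big_cat_nat (n := N.+1)) //= big_nat_recr //= big_nat_cond big1.
    by rewrite add0r addrAC subrr add0r.
  by move=> k; rewrite andbT => /andP[_ kN]; rewrite p0 // peval0.
have cv : \sum_(k < K) peval (p k) x - peval (p N) x @[K --> \oo] --> f (a + x) - peval (p N) x.
  by apply: cvgB; [exact: (exp_cvg H)|exact: cvg_cst].
have : `|\sum_(k < K) peval (p k) x - peval (p N) x| @[K --> \oo] --> `|f (a + x) - peval (p N) x|.
  exact: cvg_norm.
move=> /cvgr_to_le; apply; exists N.+1 => // K /= NK; rewrite (partE K NK).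
apply: (le_trans (ler_norm_sum _ _ _)).
have := expansion_bound_ge0 H; have := exp_bound H K.
rewrite -(big_mkord xpredT (fun k => wnorm _ (p k))) (big_cat_nat (n := N.+1)) //=.
have : 0 <= \sum_(0 <= k < N.+1) wnorm (fun=> r) (p k) by apply: sumr_ge0 => k _; exact: wnorm_ge0.
move=> h1 h2 _; apply: (@le_trans _ _ ((\sum_(N.+1 <= k < K) wnorm (fun=> r) (p k)) * t ^+ N.+1)).
  rewrite mulr_suml big_nat_cond [leRHS]big_nat_cond; apply: ler_sum => k; rewrite andbT => /andP[Nk _].
  apply: (le_trans (term_le t0 (ltW r0) (hp k) xt)).
  by rewrite mulrC ler_wpM2l ?wnorm_ge0 // ler_wiXn2l.
by rewrite ler_wpM2r ?exprn_ge0 // (le_trans _ h2) // lerDr.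
Qed.

End ExpansionAlgebra.

(** * Formal division *)

Section FormalDivision.
Variables (R : realType) (n : nat).
Implicit Types (x a y z : 'rV[R]_n) (f g u v : 'rV[R]_n -> R) (r s M e : R).
Implicit Types (P Q : mpoly n R) (p q : nat -> mpoly n R).

Lemma segment_continuous f a b :
    (forall t : R, 0 <= t <= 1 -> {for a + t *: (b - a), continuous f}) ->
  {within `[0, 1], continuous (fun t : R => f (a + t *: (b - a)))}.
Proof.
move=> cf; apply: continuous_in_subspaceT => t; rewrite inE /= in_itv /= => /cf.
move=> /at_continuousP ft; apply/at_continuousP => e /ft[r r0 fr].
have b0 : 0 < `|b - a| + 1 by rewrite ltr_wpDl.
exists (r / (`|b - a| + 1)) => [|w]; first by rewrite divr_gt0.
rewrite ltr_pdivlMr // => wt; apply: fr.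
rewrite opprD addrACA subrr add0r -scalerBl normrZ; apply: le_lt_trans wt.
by rewrite ler_wpM2l // lerDl.
Qed.

Definition leading f a N P := exists2 r, 0 < r &
  exists C, forall x, `|x| <= r -> `|f (a + x) - peval P x| <= C * `|x| ^+ N.+1.

Lemma leading_scale f a N P L : leading f a N P -> homog N P -> 0 < L ->
  exists2 r, 0 < r & exists2 C, 0 <= C & forall s z, 0 < s -> s < r -> `|z| <= L ->
    `|f (a + s *: z) - s ^+ N * peval P z| <= s ^+ N * (s * C).
Proof.
move=> [r r0 [C fC]] hP L0; exists (r / L); first by rewrite divr_gt0.
exists (`|C| * L ^+ N.+1) => [|s z s0 sr zL]; first by rewrite mulr_ge0 // exprn_ge0 // ltW.
have sz : `|s *: z| <= s * L by rewrite normrZ gtr0_norm // ler_pM2l.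
have szr : `|s *: z| <= r.
  by rewrite (le_trans sz) // -ler_pdivlMr // ltW.
have := fC _ szr; rewrite (peval_homog _ _ hP) => /le_trans; apply.
have -> : s ^+ N * (s * (`|C| * L ^+ N.+1)) = `|C| * (s * L) ^+ N.+1.
  by rewrite exprMn; move: (L ^+ N.+1) => l; rewrite exprS; ring.
apply: (@le_trans _ _ (`|C| * `|s *: z| ^+ N.+1)); first by rewrite ler_wpM2r ?exprn_ge0 ?ler_norm.
by rewrite ler_wpM2l // lerXn2r ?nnegrE // (le_trans _ sz).
Qed.

(** Blow-up at a: s^-N v(a + s x) tends to P and s^-m u(a + s x) to Q, uniformly on the segment.
    Without a common zero P^2 + Q^2 would have a positive minimum there, while at a zero of v on the
    scaled segment it is at most a multiple of s. *)
Lemma leading_zeros_between u v a N m P Q : leading v a N P -> leading u a m Q ->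
    homog N P -> homog m Q -> (\forall x \near a, {for x, continuous v}) ->
    (\forall x \near a, v x = 0 -> u x = 0) ->
  zeros_between P Q.
Proof.
move=> vP uQ hP hQ /near_normP[r1 r10 cv] /near_normP[r2 r20 vu] b c Pb Pc.
apply: contrapT => noz.
pose z (t : R) := b + t *: (c - b).
have zN t : 0 <= t <= 1 -> `|z t| <= `|b| + `|c - b| + 1.
  move=> /andP[t0 t1]; rewrite (le_trans (ler_normD _ _)) // -addrA lerD2l normrZ ger0_norm //.
  by rewrite (le_trans (ler_piMl _ t1)) // lerDl.
set L := `|b| + `|c - b| + 1 in zN; have L0 : 0 < L by rewrite ltr_wpDl // addr_ge0.
pose phi t := peval P (z t) ^+ 2 + peval Q (z t) ^+ 2.
have [t0 t0I phimin] : exists2 t0, t0 \in `[0, 1]%R & forall t, t \in `[0, 1]%R -> phi t0 <= phi t.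
  apply: EVT_min => //; pose h x := peval P x * peval P x + peval Q x * peval Q x.
  have -> : phi = fun t => h (z t) by apply/funext => t; rewrite /phi /h !expr2.
  apply: (@segment_continuous h) => t _.
  have ch : continuous h.
    by apply: fun_continuousD; apply: fun_continuousM; exact: peval_continuous.
  exact: ch.
have phi0 : 0 < phi t0.
  rewrite lt_neqAle addr_ge0 ?sqr_ge0 // andbT; apply/negP => /eqP/esym/eqP.
  rewrite paddr_eq0 ?sqr_ge0 // !sqrf_eq0 => /andP[/eqP H1 /eqP H2]; apply: noz.
  by exists t0 => //; move: t0I; rewrite in_itv.
have [r3 r30 [C C0 vC]] := leading_scale vP hP L0.
have [r4 r40 [D D0 uD]] := leading_scale uQ hQ L0.
pose K := C + D + 1; have K0 : 0 < K by rewrite ltr_wpDl // addr_ge0.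
have CK : C <= K by rewrite /K -addrA lerDl addr_ge0.
have DK : D <= K by rewrite /K addrAC lerDr addr_ge0.
(* The bound s K < eta makes [v] take the signs of [P] at both ends of the scaled segment, makes
   squares of numbers up to s K at most s K, and keeps 2 s K below the minimum of [phi]. *)
pose eta := Num.min (Num.min (- peval P b) (peval P c)) (Num.min 1 (phi t0 / 2)).
have eta0 : 0 < eta by rewrite !lt_min ltr01 Pc oppr_gt0 Pb divr_gt0.
pose s0 := Num.min (Num.min (r1 / L) (r2 / L)) (Num.min (Num.min r3 r4) (eta / K)).
have s00 : 0 < s0 by rewrite !lt_min r30 r40 !divr_gt0.
pose s := s0 / 2; have sp : 0 < s by rewrite divr_gt0.
have ss0 : s < s0 by rewrite /s ltr_pdivrMr // mulr_natr mulr2n ltrDl.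
move: ss0; rewrite !lt_min !ltr_pdivlMr // => /andP[/andP[sr1 sr2] /andP[/andP[sr3 sr4]]].
rewrite /eta !lt_min => /andP[/andP[sKb sKc] /andP[sK1 sKphi]].
have sN : 0 < s ^+ N by rewrite exprn_gt0.
have sm : 0 < s ^+ m by rewrite exprn_gt0.
have sCK : s * C <= s * K by rewrite ler_pM2l.
have sDK : s * D <= s * K by rewrite ler_pM2l.
have near_a (r : R) y : s * L < r -> `|y| <= L -> `|a + s *: y - a| < r.
  move=> sr yL; rewrite addrAC subrr add0r normrZ gtr0_norm //.
  by apply: le_lt_trans sr; rewrite ler_pM2l.
pose sa := a + s *: b; pose sb := a + s *: c.
have zE t : sa + t *: (sb - sa) = a + s *: z t.
  by rewrite /sa /sb opprD addrACA subrr add0r -scalerBr -addrA scalerA [t * s]mulrC -(scalerA s) -scalerDr.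
have z0 : z 0 = b by rewrite /z scale0r addr0.
have z1 : z 1 = c by rewrite /z scale1r addrC subrK.
have I0 : 0 <= (0 : R) <= 1 by rewrite lexx ler01.
have I1 : 0 <= (1 : R) <= 1 by rewrite lexx ler01.
have v0 : v (sa + 0 *: (sb - sa)) <= 0.
  have := vC s (z 0) sp sr3 (zN _ I0); rewrite zE z0 => /ler_normlP[_].
  rewrite lerBlDr -mulrDr => /le_trans; apply.
  by rewrite pmulr_rle0 // addrC -lerBrDl sub0r (le_trans sCK) // ltW.
have v1 : 0 <= v (sa + 1 *: (sb - sa)).
  have := vC s (z 1) sp sr3 (zN _ I1); rewrite zE z1 => /ler_normlP[+ _].
  rewrite opprB lerBlDr -lerBlDl -mulrBr; apply: le_trans.
  by rewrite pmulr_rge0 // subr_ge0 (le_trans sCK) // ltW.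
have [t tI vt] : exists2 t, t \in `[0, 1]%R & v (sa + t *: (sb - sa)) = 0.
  apply: IVT => //; last by rewrite ge_min v0 le_max v1 orbT.
  by apply: segment_continuous => t /zN zt; rewrite zE; apply: cv; exact: near_a.
move: tI (phimin t tI); rewrite in_itv /= => /zN zt; rewrite leNgt => /negP; apply.
have ut : u (a + s *: z t) = 0 by apply: vu; [exact: near_a | rewrite -zE].
have Pt : `|peval P (z t)| <= s * K.
  have := vC s (z t) sp sr3 zt; rewrite -zE vt sub0r normrN normrM gtr0_norm //.
  by rewrite ler_pM2l // => /le_trans; apply.
have Qt : `|peval Q (z t)| <= s * K.
  have := uD s (z t) sp sr4 zt; rewrite ut sub0r normrN normrM gtr0_norm //.
  by rewrite ler_pM2l // => /le_trans; apply.
have sK0 : 0 <= s * K by rewrite mulr_ge0 // ltW.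
have sq w : `|w| <= s * K -> w ^+ 2 <= s * K.
  move=> wK; rewrite -real_normK ?num_real // expr2 -[leRHS]mulr1.
  by apply: ler_pM => //; apply: le_trans wK (ltW sK1).
apply: le_lt_trans (lerD (sq _ Pt) (sq _ Qt)) _; rewrite -mulr2n -mulr_natr.
by rewrite -ltr_pdivlMr.
Qed.

Lemma homog_unique k l P : P != 0 -> homog k P -> homog l P -> k = l.
Proof.
rewrite -msupp_eq0 => P0 hk hl; case E : (msupp P) P0 => [|m t] // _.
have mP : m \in msupp P by rewrite E mem_head.
by rewrite -(homog_supp hk mP) (homog_supp hl mP).
Qed.

Section Quotient.
Variables (u v : 'rV[R]_n -> R) (a : 'rV[R]_n) (p q : nat -> mpoly n R) (r M M' : R) (N : nat).
Hypotheses (Hv : expansion v a p r M) (Hu : expansion u a q r M').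
Hypotheses (p_low : forall j, (j < N)%N -> p j = 0) (pN0 : p N != 0).
Hypothesis pN_harm : mlaplacian (p N) = 0.
Hypotheses (v_cont : \forall x \near a, {for x, continuous v})
  (v_zero : \forall x \near a, v x = 0 -> u x = 0).

(** The homogeneous parts of u - v g, where g has the finitely many parts [F]. *)
Let residual (F : seq (mpoly n R)) j := q j - cauchy p (nth 0 F) j.

Let homog_seq (F : seq (mpoly n R)) := forall k, (k < size F)%N -> homog k (nth 0 F k).

(** The residual belongs to an actual function, which vanishes wherever u and v do; this allows the
    zero argument to be repeated at every degree. *)
Lemma residual_expansion F : homog_seq F -> exists (g : 'rV[R]_n -> R) r' M'',
  expansion (fun x => u x - v x * g x) a (residual F) r' M''.
Proof.
move=> hF; have r0 := exp_gt0 Hv; have r20 : 0 < r / 2 by rewrite divr_gt0.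
have r2r : r / 2 <= r by lra.
have Hg := expansion_poly a r0 hF.
have H := expansionB (expansion_le r20 r2r Hu) (expansionM Hv Hg).
eexists; exists (r / 2); eexists.
rewrite (_ : residual F = fun k => q k - cauchy p
  (fun k0 => if (k0 < size F)%N then nth 0 F k0 else 0) k); first exact: H.
apply/funext => j; congr (_ - _); apply: eq_bigr => i _; congr (_ * _).
by case: ltnP => // h; rewrite nth_default.
Qed.

Lemma residual_step F m : homog_seq F -> (forall j, (j < m)%N -> residual F j = 0) ->
  homog m (residual F m) /\ divides (p N) (residual F m).
Proof.
move=> hF F0; have [g [r' [M'' H]]] := residual_expansion hF.
have hR k : homog k (residual F k) by case: H.
have hp k : homog k (p k) by case: Hv.
split=> //; apply: (harmonic_division (hp N) pN0 pN_harm).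
apply: (@leading_zeros_between (fun x => u x - v x * g x) v a N m) => //.
- exists r; first exact: exp_gt0 Hv.
  by exists (M / r ^+ N.+1) => x xr; exact: expansion_leading Hv p_low xr.
- exists r'; first exact: exp_gt0 H.
  by exists (M'' / r' ^+ m.+1) => x xr; exact: expansion_leading H F0 xr.
apply: filterS v_zero => x vu vx; by rewrite vx mul0r subr0 vu.
Qed.

(** On the prefixes built below the residual is divisible, so the default 0 does not intervene; it
    only allows the sequence to be defined before divisibility is proved. *)
Let next F := xget 0 [set c | residual F (N + size F)%N = p N * c].
Let quot_prefix k := iter k (fun F => rcons F (next F)) [::].
Definition formal_quotient k := nth 0 (quot_prefix k.+1) k.

Lemma size_quot_prefix k : size (quot_prefix k) = k.
Proof. by elim: k => [|k IH] //=; rewrite size_rcons IH. Qed.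

Lemma nth_quot_prefix k i : (i < k)%N -> nth 0 (quot_prefix k) i = formal_quotient i.
Proof.
elim: k => [|k IH] //; rewrite ltnS leq_eqVlt => /orP[/eqP->//|ik].
by rewrite /= nth_rcons size_quot_prefix ik IH.
Qed.

Lemma cauchy_rcons F c j : cauchy p (nth 0 (rcons F c)) j =
  cauchy p (nth 0 F) j + (if (size F <= j)%N then p (j - size F)%N * c else 0).
Proof.
have nthE i : nth 0 (rcons F c) i = nth 0 F i + (if i == size F then c else 0).
  rewrite nth_rcons; case: ltngtP => [iF|iF|->]; rewrite ?addr0 //.
    by rewrite nth_default // ltnW.
  by rewrite nth_default // add0r.
rewrite /cauchy; under eq_bigr do rewrite nthE mulrDr; rewrite big_split; congr (_ + _).
case: ifPn => [Fj|Fj].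
  have jF : (j - size F < j.+1)%N by rewrite ltnS leq_subr.
  rewrite (bigD1 (Ordinal jF)) //= subKn // eqxx big1 ?addr0 // => i ij.
  rewrite ifN ?mulr0 //; apply: contraNneq ij => ijF; apply/eqP/val_inj => /=.
  by rewrite -ijF subKn // leq_ord.
rewrite big1 // => i _; rewrite ifN ?mulr0 //; apply: contraNneq Fj => <-.
exact: leq_subr.
Qed.

(** Both claims are carried together because the division step needs homogeneous parts as well as a
    residual vanishing in all lower degrees. *)
Lemma quot_prefixP k : homog_seq (quot_prefix k) /\
  forall j, (j < N + k)%N -> residual (quot_prefix k) j = 0.
Proof.
have hp j : homog j (p j) by case: Hv.
elim: k => [|k [hF F0]].
  (* Below degree [N] the parts of [u] vanish: the first nonzero one would be a multiple of [p N]
     and so have degree at least [N]. *)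
  split=> // j; rewrite addn0; elim/ltn_ind: j => j IH jN.
  have h0 : homog_seq (quot_prefix 0) by [].
  have [|hR [c E]] := @residual_step (quot_prefix 0) j h0; first by move=> i ij; exact: IH (ltn_trans ij jN).
  apply/eqP/negPn/negP => R0; have := R0; rewrite E => E0.
  have [k' [l [hk _ jE]]] : exists k l, [/\ homog k (p N), homog l c & j = (k + l)%N].
    by apply: homog_factor => //; rewrite -E.
  by move: jN; rewrite jE (homog_unique pN0 hk (hp N)) ltnNge leq_addr.
have [hR [c E]] := residual_step hF F0.
set F := quot_prefix k in hF F0 hR E *.
have sF : size F = k := size_quot_prefix k.
have nE : residual F (N + k)%N = p N * next F.
  have : [set c | residual F (N + size F)%N = p N * c] (next F) by apply: (@xgetI _ _ _ c); rewrite /= sF.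
  by rewrite /= sF.
have hn : homog k (next F).
  have [->|n0] := eqVneq (next F) 0; first exact: homog0.
  have [k' [l [hk hl jE]]] : exists k' l, [/\ homog k' (p N), homog l (next F) & (N + k)%N = (k' + l)%N].
    by apply: homog_factor; rewrite -?nE // nE mulf_neq0.
  move: jE; rewrite (homog_unique pN0 hk (hp N)) => /eqP; rewrite eqn_add2l => /eqP ->.
  exact: hl.
have stepE : quot_prefix k.+1 = rcons F (next F) by [].
rewrite stepE; split=> [i|j].
  rewrite size_rcons sF ltnS nth_rcons sF leq_eqVlt => /orP[/eqP->|ik].
    by rewrite ltnn eqxx.
  by rewrite ik; apply: hF; rewrite sF.
rewrite addnS ltnS leq_eqVlt /residual cauchy_rcons sF opprD addrA => /orP[/eqP->|jk].
  by rewrite leq_addl addnK -/(residual F _) nE subrr.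
rewrite -/(residual F j) F0 // sub0r; case: ifPn => kj; rewrite ?oppr0 //.
by rewrite p_low ?mul0r ?oppr0 // ltn_subLR // addnC.
Qed.

Lemma homog_formal_quotient k : homog k (formal_quotient k).
Proof. by apply: (quot_prefixP k.+1).1; rewrite size_quot_prefix. Qed.

Lemma formal_quotientP j : q j = cauchy p formal_quotient j.
Proof.
have := (quot_prefixP j.+1).2 j; rewrite addnS ltnS leq_addl => /(_ isT)/eqP.
rewrite subr_eq0 => /eqP->; apply: eq_bigr => i _; congr (_ * _).
by rewrite nth_quot_prefix // ltnS leq_subr.
Qed.

End Quotient.
End FormalDivision.

(** * Convergence of the quotient *)

Lemma digits_inj n B (f g : 'I_n -> nat) :
    (forall i, (f i < B)%N) -> (forall i, (g i < B)%N) ->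
    (\sum_i f i * B ^ i = \sum_i g i * B ^ i)%N -> f =1 g.
Proof.
elim: n f g => [|n IH] f g fB gB; first by move=> _ [].
have B0 : (0 < B)%N := leq_ltn_trans (leq0n _) (fB ord0).
have shiftE (h : 'I_n.+1 -> nat) :
    (\sum_i h i * B ^ i = (\sum_(i < n) h (lift ord0 i) * B ^ i) * B + h ord0)%N.
  rewrite big_ord_recl expn0 muln1 addnC big_distrl; congr (_ + _)%N.
  by apply: eq_bigr => i _; rewrite lift0 expnSr mulnA.
rewrite !shiftE => E; have E0 : f ord0 = g ord0.
  by have := congr1 (modn^~ B) E; rewrite !modnMDl !modn_small.
move: E; rewrite E0 => /eqP; rewrite eqn_add2r eqn_pmul2r // => /eqP/IH H i.
have [j ->|->//] := unliftP ord0 i.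
by apply: (H (fun j => fB _) (fun j => gB _)).
Qed.

Section Convergence.
Variables (R : realType) (n : nat).
Implicit Types (x a y z : 'rV[R]_n) (f g u v : 'rV[R]_n -> R) (r s M e : R).
Implicit Types (P Q : mpoly n R) (p q F : nat -> mpoly n R) (w : 'I_n -> R).

Lemma wnormX w (m : multinom n) : wnorm w (mpolyX R m) = mweight w m.
Proof. by rewrite -[mpolyX R m]mulr1 wnormXM -[1](mpolyC1 n R) wnormC normr1 mulr1. Qed.

(* The weights [w i = delta ^ B ^ i] turn the weight of a monomial into [delta] to
   the power of the integer whose digits in base [B] are its exponents; distinct
   monomials get distinct powers, so the smallest power dominates for small [delta]. *)
Lemma dominant_weights P : P != 0 -> exists w m,
  [/\ forall i, 0 < w i <= 1, m \in msupp P
    & wnorm w (P - mcoeff m P *: mpolyX R m) <= 4^-1 * (`|mcoeff m P| * mweight w m)].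
Proof.
move=> P0; pose B := (mmeasure mdeg P).+1.
pose val (m : multinom n) := (\sum_i m i * B ^ i)%N.
have digit m i : m \in msupp P -> (m i < B)%N.
  move=> mP; rewrite ltnS ltnW // (leq_ltn_trans _ (mmeasure_mnm_lt mdeg mP)) //=.
  by rewrite mdegE (bigD1 i) //= leq_addr.
have exk : exists k : nat, has (fun m => val m == k) (msupp P).
  move: P0; rewrite -msupp_eq0; case E : (msupp P) => [|m t] // _.
  by exists (val m); rewrite /= eqxx.
case: (ex_minnP exk) => k /hasP[m mP /eqP mk] kmin.
have {kmin} mmin m' : m' \in msupp P -> m' != m -> (val m < val m')%N.
  move=> m'P m'm; rewrite ltn_neqAle mk kmin ?andbT; last by apply/hasP; exists m'.
  rewrite -mk; apply: contraNneq m'm => E; apply/eqP/mnmP => i; apply/esym.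
  by apply: (digits_inj (B := B)) E i => j; exact: digit.
pose c := mcoeff m P; have c0 : 0 < `|c| by rewrite normr_gt0 -mcoeff_msupp.
pose S := wnorm (fun=> 1) P.
have m1 (m' : multinom n) : mweight (fun=> 1 : R) m' = 1.
  by rewrite /mweight big1 // => i _; rewrite expr1n.
have cS : `|c| <= S.
  by have := mcoeff_le P m (w := fun=> 1); rewrite m1 mulr1; apply => _; exact: ler01.
have S0 : 0 < S := lt_le_trans c0 cS.
pose d := `|c| / (4 * S).
have d0 : 0 < d by rewrite divr_gt0 // mulr_gt0.
have d1 : d <= 1 by rewrite ler_pdivrMr ?mulr_gt0 // mul1r; move: cS S0; clear; lra.
pose w (i : 'I_n) := d ^+ (B ^ i).
have wval (m' : multinom n) : mweight w m' = d ^+ val m'.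
  rewrite /mweight /val expr_sum; apply: eq_bigr => i _.
  by rewrite /w -exprM mulnC.
exists w, m; split=> //; first by move=> i; rewrite exprn_gt0 // exprn_ile1 // ltW.
have w0 i : 0 <= w i by rewrite exprn_ge0 // ltW.
rewrite {1}[P]mpolyE (bigD1_seq m) ?msupp_uniq //= addrAC subrr add0r.
apply: (le_trans (wnorm_sum _ _ _ w0)).
apply: (@le_trans _ _ (\sum_(m' <- msupp P) `|mcoeff m' P| * d ^+ (val m).+1)); last first.
  rewrite -mulr_suml wval -/c exprS.
  have -> : \sum_(m' <- msupp P) `|mcoeff m' P| = S.
    by rewrite /S /wnorm; apply: eq_bigr => m' _; rewrite m1 mulr1.
  rewrite le_eqVlt; apply/orP; left; apply/eqP; rewrite /d; move: (_ ^+ val m) => t.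
  by field; rewrite gt_eqF.
rewrite [leRHS](bigD1_seq m) ?msupp_uniq //=.
apply: (@le_trans _ _ (\sum_(m' <- msupp P | m' != m) `|mcoeff m' P| * d ^+ (val m).+1)); last first.
  by rewrite lerDr mulr_ge0 ?exprn_ge0 // ltW.
rewrite big_seq_cond [leRHS]big_seq_cond; apply: ler_sum => m' /andP[m'P m'm].
rewrite wnormZ wnormX wval ler_wpM2l //.
by apply: ler_wiXn2l; [exact: ltW | | exact: mmin].
Qed.

Lemma cauchy_rev p q j : cauchy p q j = \sum_(i < j.+1) p (j - i)%N * q i.
Proof.
rewrite /cauchy (reindex_inj rev_ord_inj); apply: eq_bigr => i _ /=.
by rewrite subSS subKn // leq_ord.
Qed.

Lemma cauchy_shift p q N k : (forall j, (j < N)%N -> p j = 0) ->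
  cauchy p q (N + k) = \sum_(i < k) p (N + k - i)%N * q i + p N * q k.
Proof.
move=> p0; rewrite cauchy_rev -(big_mkord xpredT (fun i => p (N + k - i)%N * q i)).
rewrite (big_cat_nat (n := k.+1)) ?ltnS ?leq_addl //= [X in _ + X]big_nat_cond.
rewrite [X in _ + X]big1 ?addr0 => [|i]; last first.
  rewrite andbT => /andP[ki iN]; rewrite p0 ?mul0r // ltn_subLR //.
  by rewrite addnC ltn_add2r.
by rewrite big_nat_recr //= big_mkord addnK.
Qed.

(** In suitable weights one term of [p N] has norm D, while the rest of [p N] and the higher parts
    of [p] contribute at most D / 4 each. The division recursion summed over k < K then reads D S <=
    M' + D S / 4 + D S / 4, where S is the partial sum of the norms, so S <= 2 M' / D for every
    K. *)
Lemma quotient_bound p q F r M M' N : 0 < r ->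
    (forall k, homog k (p k)) -> (forall k, homog k (F k)) ->
    (forall K, \sum_(k < K) wnorm (fun=> r) (p k) <= M) ->
    (forall K, \sum_(k < K) wnorm (fun=> r) (q k) <= M') ->
    (forall j, (j < N)%N -> p j = 0) -> p N != 0 -> (forall j, q j = cauchy p F j) ->
  exists2 s, 0 < s & exists M'', forall K, \sum_(k < K) wnorm (fun=> s) (F k) <= M''.
Proof.
move=> r0 hp hF pM qM p0 pN qE.
have [w [m [w01 mp dom]]] := dominant_weights pN.
have mN : mdeg m = N := homog_supp (hp N) mp.
set c := mcoeff m (p N) in dom; have c0 : 0 < `|c| by rewrite normr_gt0 -mcoeff_msupp.
have wm0 : 0 < mweight w m.
  by apply: prodr_gt0 => i _; rewrite exprn_gt0 //; have /andP[] := w01 i.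
have M0 : 0 <= M by have := pM 0%N; rewrite big_ord0.
pose E := 4^-1 * (`|c| * mweight w m); have E0 : 0 < E by rewrite !mulr_gt0.
(* Dilating by [t] scales the norms of the parts of degree above [N] by at most t^(N+1), one factor
   better than the part of degree [N]; this factor brings their total below D / 4. *)
pose t := Num.min 1 (E * r ^+ N / (M + 1)).
have t0 : 0 < t by rewrite lt_min ltr01 divr_gt0 ?mulr_gt0 ?exprn_gt0 // ltr_wpDl.
have t1 : t <= 1 by rewrite ge_min lexx.
have tM : t * M <= E * r ^+ N.
  apply: (@le_trans _ _ (t * (M + 1))); first by rewrite ler_wpM2l ?lerDl // ltW.
  by rewrite -ler_pdivlMr ?ltr_wpDl // ge_min lexx orbT.
have t0' := ltW t0; have r0' := ltW r0.
pose s := t * r; have s0 : 0 < s by rewrite mulr_gt0.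
have sr : s <= r by rewrite /s ler_piMl // ltW.
pose W P := wnorm (fun i => s * w i) P.
have s0' := ltW s0; have w1 i : w i <= 1 by have /andP[] := w01 i.
have w0 i : 0 <= w i by have /andP[/ltW] := w01 i.
have ws0 i : 0 <= s * w i by rewrite mulr_ge0.
have wsr i : 0 <= s * w i <= r.
  by rewrite ws0 (le_trans _ sr) // ler_piMr.
have W0 P : 0 <= W P by exact: wnorm_ge0.
pose D := `|c| * mweight (fun i => s * w i) m.
have DE : D = s ^+ N * (`|c| * mweight w m).
  by rewrite /D -wnormX (wnorm_homog _ _ (k := N)) ?wnormX -?mN; [ring | exact: homogX].
have D0 : 0 < D by rewrite DE !mulr_gt0 // exprn_gt0.
have lead : W (p N - c *: mpolyX R m) <= 4^-1 * D.
  rewrite /W (wnorm_homog _ _ (k := N)).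
    by rewrite DE mulrCA ler_wpM2l // exprn_ge0 // ltW.
  by apply: homogB => //; apply: homogZ; rewrite -mN; exact: homogX.
(* The part [p N] is treated apart; the value 0 at index 0 gives the tail the shape of a Cauchy
   product. *)
pose G l := if l is 0 then 0 else W (p (N + l)%N).
have G0 l : 0 <= G l by case: l => [|l]; [exact: lexx | exact: W0].
have tail L : \sum_(l < L) G l <= 4^-1 * D.
  have -> : 4^-1 * D = s ^+ N * E by rewrite DE /E; ring.
  apply: (@le_trans _ _ (t ^+ N.+1 * M)); last first.
    have -> : t ^+ N.+1 * M = t ^+ N * (t * M) by rewrite exprSr mulrA.
    have -> : s ^+ N * E = t ^+ N * (E * r ^+ N) by rewrite exprMn; ring.
    exact: ler_wpM2l (exprn_ge0 _ (ltW t0)) _ _ tM.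
  apply: (@le_trans _ _ (\sum_(l < L) t ^+ N.+1 * wnorm (fun=> r) (p (N + l)%N))).
    apply: ler_sum => -[[|l] /= _] _; first by rewrite mulr_ge0 ?exprn_ge0 ?wnorm_ge0.
    apply: (@le_trans _ _ (wnorm (fun=> t * r) (p (N + l.+1)%N))).
      by apply: wnorm_le => i; rewrite ws0 /= -/s ler_piMr.
    rewrite (wnorm_homog (fun=> r) t (hp _)) ler_wpM2r ?wnorm_ge0 //.
    by rewrite ler_wiXn2l // addnS ltnS leq_addr.
  rewrite -mulr_sumr ler_wpM2l ?exprn_ge0 //; apply: le_trans (pM (N + L)%N).
  by rewrite big_split_ord /= lerDr; apply: sumr_ge0 => i _; exact: wnorm_ge0.
have main k : D * W (F k) <= W (q (N + k)%N) + \sum_(i < k.+1) W (F i) * G (k - i)%N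
    + 4^-1 * D * W (F k).
  have -> : D * W (F k) = W (c *: mpolyX R m * F k).
    by rewrite -[in RHS]scalerAl /W wnormZ wnormXM mulrA.
  have -> : c *: mpolyX R m * F k =
      q (N + k)%N - \sum_(i < k) p (N + k - i)%N * F i - (p N - c *: mpolyX R m) * F k.
    by rewrite qE cauchy_shift //; ring.
  apply: (le_trans (wnormB _ _ ws0)); apply: lerD.
    apply: (le_trans (wnormB _ _ ws0)); rewrite lerD2l big_ord_recr /= subnn mulr0 addr0.
    apply: (le_trans (wnorm_sum _ _ _ ws0)); apply: ler_sum => i _.
    rewrite (le_trans (wnormM _ _ ws0)) // mulrC -addnBA; last exact: ltnW.
    by case E1 : (k - i)%N => [|l] //; move: (ltn_ord i); rewrite -subn_gt0 E1.
  by apply: (le_trans (wnormM _ _ ws0)); rewrite ler_wpM2r ?W0.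
have bound K : \sum_(k < K) W (F k) <= 2 * M' / D.
  set S := \sum_(k < K) _; have S0 : 0 <= S by apply: sumr_ge0.
  have H1 : \sum_(k < K) W (q (N + k)%N) <= M'.
    apply: le_trans (qM (N + K)%N); rewrite big_split_ord /= -[leLHS]add0r.
    apply: lerD; first by apply: sumr_ge0 => i _; exact: wnorm_ge0.
    by apply: ler_sum => i _; exact: wnorm_le.
  have H2 : \sum_(k < K) \sum_(i < k.+1) W (F i) * G (k - i)%N <= 4^-1 * D * S.
    rewrite (cauchy_sum (fun i j => W (F i) * G j)) mulrC mulr_suml.
    by apply: ler_sum => i _; rewrite -mulr_sumr ler_wpM2l.
  have H3 : D * S <= M' + 4^-1 * D * S + 4^-1 * D * S.
    rewrite {1}/S mulr_sumr; apply: le_trans (ler_sum _ _) _.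
      by move=> k _; exact: main.
    by rewrite !big_split /= -mulr_sumr -/S; apply: lerD => //; exact: lerD.
  rewrite ler_pdivlMr // mulrC.
  have : 4^-1 * D * S = 4^-1 * (D * S) by rewrite -mulrA.
  move: H3; move: (D * S) (4^-1 * D * S) => A B; lra.
(* The weights are at most 1, so their product lies below each of them and gives a single radius. *)
have [prod0 prod1] : 0 < \prod_i w i /\ forall i, \prod_i w i <= w i.
  split=> [|i]; first by apply: prodr_gt0 => i _; have /andP[] := w01 i.
  rewrite (bigD1 i) //= ler_piMr //.
  by apply: prodr_ile1 => j _; rewrite w0 w1.
exists (s * \prod_i w i); first exact: mulr_gt0.
exists (2 * M' / D) => K; apply: le_trans (bound K); apply: ler_sum => k _.
by apply: wnorm_le => i; rewrite mulr_ge0 ?(ltW prod0) //= ler_wpM2l.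
Qed.

Lemma expansion_of_bound a F s M : 0 < s -> (forall k, homog k (F k)) ->
    (forall K, \sum_(k < K) wnorm (fun=> s) (F k) <= M) ->
  exists f, expansion f a F s M.
Proof.
move=> s0 hF FM; exists (fun y => limn (fun K => \sum_(k < K) peval (F k) (y - a))).
split=> // x xs; rewrite addrAC subrr add0r.
suff : cvgn (fun K => \sum_(k < K) peval (F k) x) by [].
have sE (h : nat -> R) : series h = fun K => \sum_(k < K) h k.
  by apply/funext => K; rewrite /series /= big_mkord.
rewrite -(sE (fun k => peval (F k) x)); apply: normed_cvg.
rewrite [X in cvgn X](sE (fun k => `|peval (F k) x|)).
apply: nondecreasing_is_cvgn.
  by apply/nondecreasing_seqP => K; rewrite big_ord_recr /= lerDl.
exists M => _ [K _ <-]; apply: le_trans (FM K); apply: ler_sum => k _.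
by apply: peval_le => i; exact: le_trans (coord_norm_le _ _) xs.
Qed.

Lemma local_division u v a p q r M M' N :
    expansion v a p r M -> expansion u a q r M' ->
    (forall j, (j < N)%N -> p j = 0) -> p N != 0 -> mlaplacian (p N) = 0 ->
    (\forall x \near a, {for x, continuous v}) -> (\forall x \near a, v x = 0 -> u x = 0) ->
  exists f F s M'', expansion f a F s M'' /\ \forall x \near a, u x = v x * f x.
Proof.
move=> Hv Hu p0 pN pNh cv vu.
have hp k : homog k (p k) by case: Hv.
pose F := formal_quotient p q N.
have hF k : homog k (F k) by exact: (homog_formal_quotient Hv Hu p0 pN pNh cv vu).
have qE : forall j, q j = cauchy p F j by exact: (formal_quotientP Hv Hu p0 pN pNh cv vu).
have [s s0 [M'' FM]] := quotient_bound (exp_gt0 Hv) hp hF (exp_bound Hv) (exp_bound Hu) p0 pN qE.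
have [f Hf] := expansion_of_bound a s0 hF FM.
exists f, F, s, M''; split=> //.
pose t := Num.min r s; have t0 : 0 < t by rewrite lt_min s0 (exp_gt0 Hv).
have tr : t <= r by rewrite ge_min lexx.
have ts : t <= s by rewrite ge_min lexx orbT.
have H := expansionM (expansion_le t0 tr Hv) (expansion_le t0 ts Hf).
apply/near_normP; exists (t / 2) => [|x /ltW xa]; first by rewrite divr_gt0.
have xr : `|x - a| <= r.
  by apply: le_trans xa _; apply: le_trans _ tr; move: t0; clear; lra.
have L1 := exp_cvg H xa; have L2 := exp_cvg Hu xr.
rewrite /= !(addrC a) !subrK in L1 L2.
apply: (cvg_unique _ _ L1) => //.
have -> : (fun K => \sum_(k < K) peval (cauchy p F k) (x - a)) =
    (fun K => \sum_(k < K) peval (q k) (x - a)).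
  by apply/funext => K; apply: eq_bigr => k _; rewrite qE.
exact: L2.
Qed.

End Convergence.

(** * Unique continuation and gluing *)

Section Gluing.
Local Opaque partial.
Variables (R : realType) (n : nat).
Implicit Types (x a y z w : 'rV[R]_n) (f g u v : 'rV[R]_n -> R) (r s M e : R).
Implicit Types (P Q : mpoly n R) (p q : nat -> mpoly n R) (U : set 'rV[R]_n).

Lemma expansion_tail f a p r M K x : expansion f a p r M -> `|x| <= r / 2 ->
  `|f (a + x) - \sum_(k < K) peval (p k) x| <= M / 2 ^+ K.
Proof.
move=> H xr; have r0 := exp_gt0 H.
have hp k : homog k (p k) by case: H.
have xr1 : `|x| <= r by apply: le_trans xr _; move: r0; clear; lra.
have xr2 : `|x| <= 2^-1 * r by rewrite mulrC.
have h0 : (0 : R) <= 2^-1 by rewrite invr_ge0.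
have h1 : (2^-1 : R) <= 1 by rewrite invf_le1 // ler1n.
have w0 (i : 'I_n) : 0 <= r by exact: ltW.
have cv : \sum_(k < L) peval (p k) x - \sum_(k < K) peval (p k) x @[L --> \oo] -->
    f (a + x) - \sum_(k < K) peval (p k) x.
  by apply: cvgB; [exact: (exp_cvg H)|exact: cvg_cst].
have : `|\sum_(k < L) peval (p k) x - \sum_(k < K) peval (p k) x| @[L --> \oo] -->
    `|f (a + x) - \sum_(k < K) peval (p k) x| by exact: cvg_norm.
move=> /cvgr_to_le; apply; exists K => // L /= KL.
rewrite -(big_mkord xpredT (fun k => peval (p k) x)) (big_cat_nat (n := K)) //=.
rewrite big_mkord addrAC subrr add0r (le_trans (ler_norm_sum _ _ _)) //.
rewrite ler_pdivlMr ?exprn_gt0 // mulr_suml; apply: le_trans (exp_bound H L).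
rewrite -(big_mkord xpredT (fun k => wnorm (fun=> r) (p k))) [leRHS](big_cat_nat (n := K)) //=.
rewrite -[leLHS]add0r; apply: lerD; first by apply: sumr_ge0 => k _; exact: wnorm_ge0.
rewrite big_nat_cond [leRHS]big_nat_cond; apply: ler_sum => k; rewrite andbT => /andP[Kk _].
rewrite -ler_pdivlMr ?exprn_gt0 // (le_trans (term_le h0 (ltW r0) (hp k) xr2)) //.
by rewrite mulrC ler_wpM2l ?wnorm_ge0 // -exprVn ler_wiXn2l.
Qed.

Lemma expansion_continuous f a p r M x : expansion f a p r M -> `|x - a| < r / 2 ->
  {for x, continuous f}.
Proof.
move=> H xa; apply/at_continuousP => e e0.
have e3 : 0 < e / 3 by rewrite divr_gt0.
have /cvgrPdist_le/(_ _ e3)[K _ KP] := half_pow_cvg M.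
have {KP} MK : M / 2 ^+ K <= e / 3.
  by have := KP K (leqnn K); rewrite /= sub0r normrN; apply: le_trans; exact: ler_norm.
pose g y := \sum_(k < K) peval (p k) (y - a).
have fg y : `|y - a| < r / 2 -> `|f y - g y| <= e / 3.
  move=> /ltW ya; have := expansion_tail K H ya; rewrite (addrC a) subrK => /le_trans; exact.
have cg : {for x - a, continuous (fun y => \sum_(k < K) peval (p k) y)}.
  by apply: fun_continuous_sum => k; exact: peval_continuous.
have [r1 r10 gP] := (at_continuousP _ _).1 cg _ e3.
exists (Num.min r1 (r / 2 - `|x - a|)) => [|y]; first by rewrite lt_min r10 subr_gt0.
rewrite lt_min => /andP[yx1 yx2].
have ya : `|y - a| < r / 2.
  have -> : y - a = (y - x) + (x - a) by rewrite addrA subrK.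
  by rewrite (le_lt_trans (ler_normD _ _)) // -ltrBrDr.
have gxy : `|g x - g y| <= e / 3.
  by apply: gP; rewrite opprB addrA subrK.
have -> : f x - f y = (f x - g x) + (g x - g y) - (f y - g y) by ring.
rewrite (le_trans (ler_normB _ _)) // (le_trans (lerD (ler_normD _ _) (lexx _))) //.
by have := fg x xa; have := fg y ya; move: gxy; lra.
Qed.

Lemma taylor_near0 k f a : (\forall x \near a, f x = 0) -> taylor k f a = 0.
Proof.
elim: k f => [|k IH] f f0.
  by rewrite /taylor (nbhs_singleton f0) mpolyC0.
rewrite taylorS big1 ?scaler0 // => i _; rewrite IH ?mulr0 //.
move: f0 => /near_normP[r r0 f0]; apply/near_normP; exists r => // x xa.
suff [_ <-] : is_derive x (basis_vec i) (f : _ -> R^o) 0 by [].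
apply: (@near_eq_is_derive _ _ (fun=> 0)).
apply/near_normP; exists (r - `|x - a|) => [|y yx]; first by rewrite subr_gt0.
rewrite f0 //; have -> : y - a = (y - x) + (x - a) by rewrite addrA subrK.
by rewrite (le_lt_trans (ler_normD _ _)) // -ltrBrDr.
Qed.

Lemma peval_taylorS k f a w : peval (taylor k.+1 f a) w =
  k.+1%:R^-1 * \sum_i w ord0 i * peval (taylor k (partial i f) a) w.
Proof.
rewrite taylorS pevalZ peval_sum; congr (_ * _); apply: eq_bigr => i _.
by rewrite pevalM; congr (_ * _); rewrite /peval mevalXU.
Qed.

Lemma taylor_continuous U k f a w : open U -> harm U f -> U a ->
  {for a, continuous (fun x => peval (taylor k f x) w)}.
Proof.
move=> oU + Ua; elim: k f => [|k IH] f H.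
  rewrite (_ : (fun x => _) = f); first by apply: (harm_cont H).
  by apply/funext => x; rewrite /taylor /peval mevalC.
rewrite (_ : (fun x => _) = fun x => k.+1%:R^-1 *
  \sum_i w ord0 i * peval (taylor k (partial i f) x) w); last first.
  by apply/funext => x; rewrite peval_taylorS.
apply: at_continuousZ; elim: (index_enum _) => [|i t IHt].
  rewrite (_ : (fun x => _) = fun=> 0); first exact: cst_continuous.
  by apply/funext => x; rewrite big_nil.
rewrite (_ : (fun x => _) = fun x => w ord0 i * peval (taylor k (partial i f) x) w +
  \sum_(i <- t) w ord0 i * peval (taylor k (partial i f) x) w); last first.
  by apply/funext => x; rewrite big_cons.
apply: at_continuousD => //; apply: at_continuousZ; apply: IH.
exact: (harm_partial i oU H).1.
Qed.

(** The set where all Taylor parts vanish is open by the local expansion and relatively closed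
    because each part depends continuously on the centre; [U] is connected. *)
Lemma unique_continuation U f a : (0 < n)%N -> domain U -> harm U f -> U a ->
  (forall k, taylor k f a = 0) -> forall x, U x -> f x = 0.
Proof.
move=> n0 [_ oU cU] H Ua fa.
pose Z := [set x | U x /\ forall k, taylor k f x = 0].
have near0 x : Z x -> \forall y \near x, f y = 0.
  move=> [Ux fx]; have [r [M E]] := harm_expansion n0 oU H Ux.
  apply/near_normP; exists r; first exact: exp_gt0 E.
  move=> y /ltW yx; have := exp_cvg E yx; rewrite (addrC x) subrK.
  move=> L; apply: (cvg_unique _ L) => //.
  rewrite (_ : (fun K => _) = fun=> 0); first exact: cvg_cst.
  by apply/funext => K; apply: big1 => k _; rewrite fx peval0.
have oZ : open Z.
  rewrite openE => x Zx; have fx := near0 _ Zx; have Ux : \forall y \near x, U y.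
    by apply: open_nbhs_nbhs; split=> //; exact: Zx.1.
  have : \forall y \near x, \forall z \near y, f z = 0 by exact/nbhs_interior.
  by move=> fxx; near=> y; split=> [|k]; [near: y | apply: taylor_near0; near: y].
have ZU : Z = U.
  apply: cU; first by exists a.
    by exists Z => //; apply/seteqP; split=> x; [move=> Zx; split=> //; exact: Zx.1|case].
  exists (closure Z); first exact: closed_closure.
  apply/seteqP; split=> [x Zx|x [Ux clx]]; first by split; [exact: Zx.1|exact: subset_closure].
  split=> // k; apply: (peval_eq0_near (a := x) ltr01) => w _.
  apply/eqP/negPn/negP => c0; set c := peval _ w in c0.
  have c2 : 0 < `|c| / 2 by rewrite divr_gt0 // normr_gt0.
  have [r r0 cr] := (at_continuousP _ _).1 (@taylor_continuous U k f x w oU H Ux) _ c2.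
  have [y [[_ fy] yx]] : (Z `&` [set y | `|y - x| < r]) !=set0.
    by apply: clx; have : \forall y \near x, `|y - x| < r by apply/near_normP; exists r.
  have := cr y yx; rewrite fy peval0 subr0 -/c; move: c2; move: `|c| => d; clear; lra.
by move=> x; rewrite -ZU => /near0/nbhs_singleton.
Unshelve. all: end_near. Qed.

Lemma real_analytic_division U u v : (0 < n)%N -> domain U -> real_analytic U u -> harm U v ->
    zero_set U v `<=` zero_set U u ->
  exists f, real_analytic U f /\ forall x, U x -> u x = v x * f x.
Proof.
move=> n0 dU hu H vu; have [_ oU _] := dU.
have v_cont a : U a -> \forall x \near a, {for x, continuous v}.
  move=> Ua; have : \forall x \near a, U x by exact: open_nbhs_nbhs.
  by apply: filterS; exact: (harm_cont H).
have v_zero a : U a -> \forall x \near a, v x = 0 -> u x = 0.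
  move=> Ua; have : \forall x \near a, U x by exact: open_nbhs_nbhs.
  by apply: filterS => x Ux vx; have [] : zero_set U u x by exact: vu.
(* In the first case v, hence u, is identically zero and the quotient 0 serves. In the second every
   point has a lowest nonzero part to divide by. *)
have [[a [Ua va]]|nz] := pselect (exists a, U a /\ forall k, taylor k v a = 0).
  have v0 := unique_continuation n0 dU H Ua va.
  exists (fun=> 0); split=> [b _|x Ux]; last first.
    by rewrite mulr0; have [] : zero_set U u x by apply: vu; split=> //; exact: v0.
  exists (fun=> 0); apply/near_normP; exists 1 => // x _.
  apply/power_series_sumP => e e0; exists fset0 => B _.
  by rewrite big1 ?subr0 ?normr0 ?ltW // => al _; rewrite mul0r.
(* The condition [U a] stands under the existential so that choice yields a family indexed by all
   points. *)
have local a : exists g, U a -> (exists F s M, expansion g a F s M) /\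
    \forall x \near a, u x = v x * g x.
  have [Ua|] := pselect (U a); last by exists (fun=> 0).
  have exk : exists k, taylor k v a != 0.
    apply: contrapT => /forallNP h; apply: nz; exists a; split=> // k.
    by apply/eqP/negPn/negP/h.
  case: (ex_minnP exk) => N vN Nmin.
  have v_low j : (j < N)%N -> taylor j v a = 0.
    by move=> jN; apply/eqP; apply: contraTT jN => /Nmin; rewrite -leqNgt.
  have [r [M Hv]] := harm_expansion n0 oU H Ua.
  have [q [r' [M' Hu]]] := analytic_expansion n0 hu Ua.
  pose t := Num.min r r'; have t0 : 0 < t by rewrite lt_min (exp_gt0 Hv) (exp_gt0 Hu).
  have tr : t <= r by rewrite ge_min lexx.
  have tr' : t <= r' by rewrite ge_min lexx orbT.
  have [g [F [s [M'' [Hg ug]]]]] := local_division (expansion_le t0 tr Hv)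
    (expansion_le t0 tr' Hu) v_low vN (mlaplacian_taylor N oU Ua H) (v_cont a Ua) (v_zero a Ua).
  by exists g => _; split=> //; exists F, s, M''.
have [G GP] := choice local.
(* Near [x] both quotients solve the same equation, so v times their difference is zero. If they
   differed at [x], by continuity [v] would vanish near [x], and with it all its Taylor parts
   there. *)
have agree a : U a -> \forall x \near a, G x x = G a x.
  move=> Ua; have [[F [s [M E]]] /near_normP[r1 r10 ug]] := GP a Ua.
  have s0 := exp_gt0 E.
  have /near_normP[r2 r20 Ur] : \forall x \near a, U x by exact: open_nbhs_nbhs.
  apply/near_normP; exists (Num.min (s / 2) (Num.min r1 r2)) => [|x].
    by rewrite !lt_min r10 r20 divr_gt0.
  rewrite !lt_min => /and3P[xs x1 x2]; have Ux := Ur x x2.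
  have [[F' [s' [M' E']]] /near_normP[r3 r30 ug']] := GP x Ux.
  have cG : {for x, continuous (G a)} := expansion_continuous E xs.
  have cG' : {for x, continuous (G x)}.
    by apply: (expansion_continuous E'); rewrite subrr normr0 divr_gt0 // (exp_gt0 E').
  apply/eqP; rewrite -subr_eq0; apply/negPn/negP => d0.
  have d2 : 0 < `|G x x - G a x| / 2 by rewrite divr_gt0 // normr_gt0.
  have cD : {for x, continuous (fun y => G x y - G a y)} by exact: (cvgB cG' cG).
  have [r4 r40 dP] := (at_continuousP _ _).1 cD _ d2.
  apply: nz; exists x; split=> // k; apply: taylor_near0; apply/near_normP.
  exists (Num.min (r1 - `|x - a|) (Num.min r3 r4)) => [|y].
    by rewrite !lt_min subr_gt0 x1 r30 r40.
  rewrite !lt_min => /and3P[y1 y3 y4].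
  have ya : `|y - a| < r1.
    have -> : y - a = (y - x) + (x - a) by rewrite addrA subrK.
    by rewrite (le_lt_trans (ler_normD _ _)) // -ltrBrDr.
  have : v y * (G x y - G a y) = 0 by rewrite mulrBr -ug // -ug' // subrr.
  move=> /eqP; rewrite mulf_eq0 => /orP[/eqP->//|/eqP D0].
  by have := dP y y4; rewrite D0 subr0; move: d2; move: `|_| => d; clear; lra.
(* By [agree], the diagonal coincides near each [a] with the one expansion at [a], which gives its
   power series. *)
exists (fun x => G x x); split=> [a Ua|x Ux]; last first.
  by have [_ /nbhs_singleton] := GP x Ux.
have [[F [s [M E]]] _] := GP a Ua; have [c cP] := expansion_power_series E.
by exists c; move: cP (agree a Ua); apply: filterS2 => x + ->.
Qed.

End Gluing.

Local Open Scope ring_scope.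

Theorem theorem2p6 (R : realType) (n : nat) (hn : (2 <= n)%N)
    (Omega : set 'rV[R]_n) (hOmega : domain Omega)
    (u v : 'rV[R]_n -> R)
    (hu : real_analytic Omega u) (hv : harmonic_in Omega v)
    (hZ : zero_set Omega v `<=` zero_set Omega u) :
  exists f : 'rV[R]_n -> R,
    real_analytic Omega f /\ forall x, Omega x -> u x = v x * f x.
Proof.
have n0 : (0 < n)%N by exact: ltn_trans hn.
have [_ oOmega _] := hOmega.
exact: real_analytic_division n0 hOmega hu (harmonic_in_harm oOmega hv) hZ.
Qed.
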